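(* Let $n,q$ be integers with $1\le q\le n-2$, let $\Omega=\{(t,z)\in\mathbb{R}\times\mathbb{C}^n : t^2+|z|^4\le 1\}$ be the closed unit ball in the $(2n+1)$-dimensional Heisenberg group $\mathbb{H}^n$, and let $\square_b$ be the Kohn Laplacian on $L^2_{(0,q)}(\Omega)$ with $\overline{\partial}_b$-Neumann boundary conditions. Then the Neumann operator $N_b\colon L^2_{(0,q)}(\Omega)\to L^2_{(0,q)}(\Omega)$, i.e. the bounded inverse of $\square_b$, is not a compact operator.
   Context: The Heisenberg group $\mathbb{H}^n=\mathbb{R}_t\times\mathbb{C}^n_z$ carries the CR structure spanned over $\mathbb{C}$ by the vector fields $L_j=\partial_{z^j}+i\bar z^j\partial_t$, $j=1,\dots,n$; write $\overline{L}_j=\partial_{\bar z^j}-i z^j\partial_t$ for the conjugates. With $w=t+i|z|^2$, the closed unit ball is $\Omega=\{|w|\le 1\}=\{t^2+|z|^4\le 1\}$. A $(0,q)$-form on $\Omega$ is an expression $f=\sum_{|J|=q} f_{\bar J}\,d\bar z^J$, where $J=\{j_1<\dots<j_q\}\subset\{1,\dots,n\}$, $d\bar z^J=d\bar z^{j_1}\wedge\dots\wedge d\bar z^{j_q}$ and the $f_{\bar J}$ are complex-valued functions. The pointwise Hermitian inner product is the one for which the $d\bar z^J$ are orthonormal, and $L^2_{(0,q)}(\Omega)$ is the Hilbert space of $(0,q)$-forms with square-integrable coefficients with respect to Lebesgue measure, $\langle f,g\rangle_{L^2}=\int_\Omega\sum_J f_{\bar J}\overline{g_{\bar J}}\,dV$.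 On smooth forms, $\overline{\partial}_b f=\sum_{k}\sum_J(\overline{L}_k f_{\bar J})\,d\bar z^k\wedge d\bar z^J$. For each $q$, $\overline{\partial}_b$ also denotes the maximal extension to a closed, densely defined operator $L^2_{(0,q)}(\Omega)\to L^2_{(0,q+1)}(\Omega)$ (the domain consists of those $f\in L^2_{(0,q)}(\Omega)$ for which $\overline{\partial}_b f$, computed in the sense of distributions on the interior of $\Omega$, lies in $L^2_{(0,q+1)}(\Omega)$), and $\overline{\partial}_b^*$ denotes its $L^2$ Hilbert space adjoint. The Kohn Laplacian is the unbounded operator on $L^2_{(0,q)}(\Omega)$ given by $\square_b=\overline{\partial}_b\overline{\partial}_b^*+\overline{\partial}_b^*\overline{\partial}_b$ with $$\mathrm{Dom}(\square_b)=\{u\in\mathrm{Dom}(\overline{\partial}_b^* )\cap\mathrm{Dom}(\overline{\partial}_b):\ \overline{\partial}_b u\in\mathrm{Dom}(\overline{\partial}_b^* ),\ \overline{\partial}_b^*u\in\mathrm{Dom}(\overline{\partial}_b)\}.$$ It is a known result (Shaw) that $\square_b$ is closed, densely defined and self-adjoint, and that for $1\le q\le n-2$ there is a bounded operator $N_b\colon L^2_{(0,q)}(\Omega)\to\mathrm{Dom}(\square_b)\subset L^2_{(0,q)}(\Omega)$, the Neumann operator, with $\square_bN_b=\mathrm{Id}$ on $L^2_{(0,q)}(\Omega)$ and $N_b\square_b=\mathrm{Id}$ on $\mathrm{Dom}(\square_b)$. *)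

(* Defs.v *)
From HB Require Import structures.
From mathcomp Require Import all_boot all_order all_algebra.
From mathcomp Require Import all_classical all_reals all_analysis.
From mathcomp Require Import complex.

Set Implicit Arguments.
Unset Strict Implicit.
Unset Printing Implicit Defensive.
Import Order.TTheory GRing.Theory Num.Theory.
Import numFieldNormedType.Exports.

Local Open Scope classical_set_scope.
Local Open Scope ring_scope.

(* The library has no sigma-algebra on row vectors.  As for tuples, we take the
   one generated by the coordinates; over R it is the Borel sigma-algebra. *)
Definition measure_row_display : measure_display -> measure_display.
Proof. exact. Qed.

Section measurable_row.
Context {d} {T : measurableType d}.
Variable n : nat.

Definition row_coord (i : 'I_n) (x : 'rV[T]_n) : T := x ord0 i.

Let row_set0 : g_sigma_preimage row_coord set0.
Proof. exact: sigma_algebra0. Qed.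

Let row_setC A : g_sigma_preimage row_coord A -> g_sigma_preimage row_coord (~` A).
Proof. exact: sigma_algebraC. Qed.

Let row_bigcup (F : _^nat) : (forall i, g_sigma_preimage row_coord (F i)) ->
  g_sigma_preimage row_coord (\bigcup_i (F i)).
Proof. exact: sigma_algebra_bigcup. Qed.

HB.instance Definition _ := @isMeasurable.Build (measure_row_display d)
  'rV[T]_n (g_sigma_preimage row_coord) row_set0 row_setC row_bigcup.

Lemma measurable_row_coord (i : 'I_n) :
  measurable_fun [set: 'rV[T]_n] (row_coord i).
Proof.
move=> _ Y mY; rewrite setTI; apply: sub_sigma_algebra => /=.
rewrite -bigcup_seq/=; exists i => /=; first by rewrite mem_index_enum.
by exists Y => //; rewrite setTI.
Qed.

Lemma measurable_fun_row d' (T' : measurableType d') (f : T' -> 'rV[T]_n) :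
  (forall i, measurable_fun setT (row_coord i \o f)) -> measurable_fun setT f.
Proof.
move=> mf _ Y mY; rewrite setTI.
have : <<s \big[setU/set0]_(i < n)
    preimage_set_system setT (row_coord i) measurable >> `<=`
    [set B | measurable (f @^-1` B)].
  apply: smallest_sub.
    split => [|A mA|F mF].
    - by rewrite /= preimage_set0.
    - by move=> /= ; rewrite setTD preimage_setC; apply: measurableC.
    - by move=> /=; rewrite preimage_bigcup; apply: bigcup_measurable => i _; exact: mF.
  rewrite -bigcup_seq => A [i _ [B mB <-]] /=; rewrite setTI.
  have := mf i measurableT B mB.
  by rewrite setTI comp_preimage.
exact.
Qed.

End measurable_row.

(* The library gives [m1 \x m2] a sigma-finite instance only for
   sub-probabilities; this alias carries the general one. *)
Section sigma_finite_product.
Context d1 d2 (T1 : measurableType d1) (T2 : measurableType d2) (R : realType).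
Variable m1 : {sigma_finite_measure set T1 -> \bar R}.
Variable m2 : {sigma_finite_measure set T2 -> \bar R}.

Definition sfprod : set (T1 * T2) -> \bar R := (m1 \x m2)%E.

HB.instance Definition _ := Measure.on sfprod.

Let sfprod_sigma_finite : sigma_finite setT sfprod.
Proof.
have /sigma_finiteP[F [TF ndF Foo]] := sigma_finiteT m1.
have /sigma_finiteP[G [TG ndG Goo]] := sigma_finiteT m2.
exists (fun k => F k `*` G k).
  rewrite -setXTT TF TG predeqE => -[x y]; split.
    move=> [/= [k _ Fkx] [l _ Gly]]; exists (maxn k l) => //; split.
    - by move: x Fkx; exact/subsetPset/ndF/leq_maxl.
    - by move: y Gly; exact/subsetPset/ndG/leq_maxr.
  by move=> [k _ []/= ? ?]; split; exists k.
move=> k; have [? ?] := Foo k; have [? ?] := Goo k.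
split; first exact: measurableX.
by rewrite /sfprod product_measure1E// lte_mul_pinfty// ge0_fin_numE.
Qed.

HB.instance Definition _ := @Measure_isSigmaFinite.Build _ _ _ sfprod
  sfprod_sigma_finite.

End sigma_finite_product.

Section cons_measure.
Context {R : realType} (n : nat).
Variable mu : {sigma_finite_measure set 'rV[R]_n -> \bar R}.

Definition row_cons (p : R * 'rV[R]_n) : 'rV[R]_n.+1 :=
  \row_i (if unlift ord0 i is Some j then p.2 ord0 j else p.1).

Definition row_uncons (x : 'rV[R]_n.+1) : R * 'rV[R]_n :=
  (x ord0 ord0, \row_j x ord0 (lift ord0 j)).

Lemma row_consK : cancel row_cons row_uncons.
Proof.
case=> a y; rewrite /row_uncons /row_cons !mxE unlift_none; congr pair.
by apply/rowP => j; rewrite !mxE liftK.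
Qed.

Lemma measurable_row_cons : measurable_fun setT row_cons.
Proof.
apply: measurable_fun_row => i.
rewrite (_ : _ \o _ = fun p : R * 'rV[R]_n =>
  if unlift ord0 i is Some j then row_coord j p.2 else p.1); last first.
  by apply/funext => p; rewrite /= /row_coord /row_cons mxE.
case: (unlift ord0 i) => [j|]; last exact: measurable_fst.
by apply: measurableT_comp; [exact: measurable_row_coord|exact: measurable_snd].
Qed.

Lemma measurable_row_uncons : measurable_fun setT row_uncons.
Proof.
apply/measurable_fun_pairP; split.
  exact: (measurable_row_coord ord0).
apply: measurable_fun_row => j.
rewrite (_ : _ \o _ = row_coord (lift ord0 j)); last first.
  by apply/funext => x; rewrite /= /row_coord mxE.
exact: measurable_row_coord.
Qed.

Definition cons_measure : set 'rV[R]_n.+1 -> \bar R :=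
  pushforward (sfprod lebesgue_measure mu) row_cons.

Let cons_measure0 : cons_measure set0 = 0%E.
Proof. by rewrite /cons_measure /pushforward preimage_set0 measure0. Qed.

Let cons_measure_ge0 A : (0 <= cons_measure A)%E.
Proof. by rewrite /cons_measure /pushforward; exact: measure_ge0. Qed.

Let cons_measure_sigma_additive : semi_sigma_additive cons_measure.
Proof.
move=> F mF tF mUF; rewrite /cons_measure /pushforward preimage_bigcup.
apply: measure_semi_sigma_additive.
- by move=> k; rewrite -[X in measurable X]setTI; apply: measurable_row_cons.
- apply/trivIsetP => /= i j _ _ ij; rewrite -preimage_setI.
  by move/trivIsetP : tF => /(_ _ _ _ _ ij) ->//; rewrite preimage_set0.
- by rewrite -preimage_bigcup -[X in measurable X]setTI; apply: measurable_row_cons.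
Qed.

HB.instance Definition _ := isMeasure.Build _ _ _ cons_measure
  cons_measure0 cons_measure_ge0 cons_measure_sigma_additive.

Let cons_measure_sigma_finite : sigma_finite setT cons_measure.
Proof.
have [F FT mF] := sigma_finiteT (sfprod lebesgue_measure mu).
exists (fun k => row_uncons @^-1` F k).
  by rewrite -preimage_bigcup -FT preimage_setT.
move=> k; have [mFk Fk] := mF k; split.
  by rewrite -[X in measurable X]setTI; exact: measurable_row_uncons.
rewrite /cons_measure /pushforward -comp_preimage.
rewrite (_ : row_uncons \o row_cons = id) ?preimage_id//.
by apply/funext => p; exact: row_consK.
Qed.

HB.instance Definition _ := @Measure_isSigmaFinite.Build _ _ _ cons_measure
  cons_measure_sigma_finite.

End cons_measure.

Fixpoint lebesgue_row (R : realType) (n : nat) :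
    {sigma_finite_measure set 'rV[R]_n -> \bar R} :=
  match n with
  | 0 => [the {sigma_finite_measure set _ -> \bar R} of dirac (0 : 'rV[R]_0)]
  | n'.+1 => [the {sigma_finite_measure set _ -> \bar R} of
               cons_measure (lebesgue_row R n')]
  end.

(* A point (t, (x, y)) of R x (R^n x R^n) stands for (t, x + iy) in R x C^n. *)
Notation heis R n := (R * ('rV[R]_n * 'rV[R]_n))%type.

(* The measure lives on [measurableTypeR R * _], which is convertible to
   [heis R n]; the latter carries the normed-space structure. *)
Definition heis_vol (R : realType) (n : nat) :
    {sigma_finite_measure
      set (measurableTypeR R * ('rV[R]_n * 'rV[R]_n))%type -> \bar R} :=
  [the {sigma_finite_measure set _ -> \bar R} of
    sfprod lebesgue_measure (sfprod (lebesgue_row R n) (lebesgue_row R n))].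

Section heisenberg.
Context {R : realType} {n : nat}.
Notation X := (heis R n).
Notation C := (R[i]).
Notation mu := (heis_vol R n).
Local Notation Re := complex.Re.
Local Notation Im := complex.Im.

Definition zcoord (p : X) (k : 'I_n) : C :=
  Complex (p.2.1 ord0 k) (p.2.2 ord0 k).

Definition znorm2 (p : X) : R :=
  \sum_(k < n) (p.2.1 ord0 k ^+ 2 + p.2.2 ord0 k ^+ 2).

Definition heis_ball : set X := [set p | p.1 ^+ 2 + znorm2 p ^+ 2 <= 1].
Local Notation Omega := heis_ball.

Definition dir_t : X := (1, (0, 0)).
Definition dir_x (k : 'I_n) : X := (0, (delta_mx ord0 k, 0)).
Definition dir_y (k : 'I_n) : X := (0, (0, delta_mx ord0 k)).

(* In finite dimension, f is C^(k+1) iff its directional derivatives exist and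
   are C^k; continuity of f is then automatic. *)
Fixpoint Ck (k : nat) (f : X -> R) : Prop :=
  continuous f /\
  match k with
  | 0 => True
  | k'.+1 => forall v : X,
      (forall p, derivable f p v) /\ Ck k' (fun p => 'D_v f p)
  end.

Definition smooth (f : X -> R) : Prop := forall k, Ck k f.

Definition csmooth (f : X -> C) : Prop :=
  smooth (fun p => Re (f p)) /\ smooth (fun p => Im (f p)).

Definition cderive (v : X) (f : X -> C) (p : X) : C :=
  Complex ('D_v (fun p => Re (f p)) p) ('D_v (fun p => Im (f p)) p).

Definition d_zbar (k : 'I_n) (f : X -> C) (p : X) : C :=
  2%:R^-1 * (cderive (dir_x k) f p + Complex 0 1 * cderive (dir_y k) f p).

Definition Lbar (k : 'I_n) (f : X -> C) (p : X) : C :=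
  d_zbar k f p - Complex 0 1 * zcoord p k * cderive dir_t f p.

Definition test_function (phi : X -> C) : Prop :=
  csmooth phi /\
  exists K : set X, [/\ compact K, K `<=` Omega° &
                        forall p, ~ K p -> phi p = 0].

Definition cintegral (h : X -> C) : C :=
  Complex (\int[mu]_(p in Omega) Re (h p)) (\int[mu]_(p in Omega) Im (h p)).

(* The value at [phi] of the distribution [Lbar k u]: the formal transpose of
   Lbar_k is - Lbar_k, since z^k does not depend on t. *)
Definition Lbar_distr (k : 'I_n) (u : X -> C) (phi : X -> C) : C :=
  - cintegral (fun p => u p * Lbar k phi p).

(* A family of coefficients f_J, J ranging over all subsets of {1, ..., n};
   the (0,q)-forms are those with f_J = 0 unless #|J| = q, see [L2form]. *)
Definition heis_form : Type := {set 'I_n} -> X -> C.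

Definition L2fun (u : X -> C) : Prop :=
  [/\ measurable_fun (Omega : set (measurableTypeR R * _)) (fun p => Re (u p)),
      measurable_fun (Omega : set (measurableTypeR R * _)) (fun p => Im (u p)) &
      (\int[mu]_(p in Omega) (Re (u p) ^+ 2 + Im (u p) ^+ 2)%:E < +oo)%E].

Definition L2form (q : nat) (f : heis_form) : Prop :=
  (forall J : {set 'I_n}, #|J| != q -> f J = (fun=> 0)) /\ (forall J, L2fun (f J)).

(* Elements of L^2 are classes of forms for this relation. *)
Definition form_ae_eq (f g : heis_form) : Prop :=
  forall J, {ae mu, forall p, Omega p -> f J p = g J p}.

Definition inner (f g : heis_form) : C :=
  cintegral (fun p => \sum_(J : {set 'I_n}) f J p * conjc (g J p)).

Definition L2norm (f : heis_form) : R := Num.sqrt (Re (inner f f)).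

(* For k not in J, dzbar^k /\ dzbar^J = wedge_sign k J * dzbar^(k |: J). *)
Definition wedge_sign (k : 'I_n) (J : {set 'I_n}) : C :=
  (-1) ^+ #|[set j in J | (j < k)%N]|.

(* g = dbar_b f: maximal extension on (0,q)-forms, as a graph. *)
Definition dbar_graph (q : nat) (f g : heis_form) : Prop :=
  [/\ L2form q f, L2form q.+1 g &
    forall (K : {set 'I_n}) (phi : X -> C), test_function phi ->
      cintegral (fun p => g K p * phi p) =
      \sum_(k < n) \sum_(J : {set 'I_n} | (k \notin J) && (k |: J == K))
        wedge_sign k J * Lbar_distr k (f J) phi].

(* h = dbar_b^* g, the Hilbert space adjoint of dbar_b on (0,q)-forms. *)
Definition dbar_adj_graph (q : nat) (g h : heis_form) : Prop :=
  [/\ L2form q.+1 g, L2form q h &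
    forall u v, dbar_graph q u v -> inner v g = inner u h].

(* v = Box_b u on (0,q)-forms, for q >= 1. *)
Definition kohn_graph (q : nat) (u v : heis_form) : Prop :=
  exists a b c d : heis_form,
    [/\ dbar_adj_graph q.-1 u a, dbar_graph q u b,
        dbar_adj_graph q b c, dbar_graph q.-1 a d &
        L2form q v /\ form_ae_eq v (fun J p => d J p + c J p)].

Record neumann_operator (q : nat) (N : heis_form -> heis_form) : Prop := {
  neumann_L2 : forall f, L2form q f -> L2form q (N f);
  neumann_ae : forall f g, L2form q f -> L2form q g ->
    form_ae_eq f g -> form_ae_eq (N f) (N g);
  neumann_linear : forall (a : C) f g, L2form q f -> L2form q g ->
    form_ae_eq (N (fun J p => a * f J p + g J p))
               (fun J p => a * N f J p + N g J p);
  neumann_bounded : exists M : R, forall f, L2form q f ->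
    L2norm (N f) <= M * L2norm f;
  neumann_right : forall f, L2form q f -> kohn_graph q (N f) f;
  neumann_left : forall u v, kohn_graph q u v -> form_ae_eq (N v) u
}.

Definition compact_operator (q : nat) (N : heis_form -> heis_form) : Prop :=
  forall f : nat -> heis_form,
    (forall k, L2form q (f k)) ->
    (exists M : R, forall k, L2norm (f k) <= M) ->
    exists2 s : nat -> nat, {homo s : i j / (i < j)%N} &
      exists2 g : heis_form, L2form q g &
        L2norm (fun J p => N (f (s k)) J p - g J p) @[k --> \oo] --> (0 : R).

End heisenberg.

Arguments heis_form : clear implicits.

(* Main.v *)
Require Import Defs.
From mathcomp Require Import all_boot all_order all_algebra.
From mathcomp Require Import all_classical all_reals all_analysis.
From mathcomp Require Import measurable_realfun complex ring lra.

Set Implicit Arguments.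
Unset Strict Implicit.
Unset Printing Implicit Defensive.
Import Order.TTheory GRing.Theory Num.Theory.
Import numFieldNormedType.Exports.

Local Open Scope classical_set_scope.
Local Open Scope ring_scope.

(** Write w = t + i|z|^2. The function exp(- i k w) is annihilated by every
    Lbar_j, and its modulus is exp(k |z|^2). As k grows, its L^2 mass on the ball
    therefore concentrates near the sphere t = 0, |z| = 1 of the boundary.

    For a set A of q + 1 indices, let u be the contraction of the form
    c_k exp(- i k w) dzbar^A, normalised in L^2, with the field
    sum_a conj(z_a) d/d conj(z_a). Two computations make u an excellent trial form.
    - dbar_b u = (q + 1) c_k exp(- i k w) dzbar^A, because the coefficients are CR
      functions ([dbar_graph_contract]); its norm is q + 1 for all k.
    - The adjoint of dbar_b is defined at u and kills it
      ([dbar_adj_graph_contract]). The (0,1)-covector of rho = |w|^2 is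
      proportional to the one dual to the field, and contracting twice with the
      same field gives 0: this is the boundary condition, and the same
      antisymmetry cancels the interior terms, the coefficients being functions of
      t and |z|^2. The adjoint is computed by duality against cutoff(rho) u, a test
      form which the formal adjoint kills identically for the same reason; the
      cutoff is then removed by dominated convergence.

    For every form u killed by the adjoint, the Cauchy-Schwarz inequality gives
    |u|^3 <= |dbar_b u|^2 |N u| ([neumann_estimate]). Hence compactness of N would
    make precompact in L^2 every sequence of such forms that is bounded in L^2 and
    has bounded images under dbar_b.

    This fails here. The functions c_k exp(- i k w) have L^2 norm 1 while their L^1
    norms tend to 0 ([peak_L1_small]), so the packets u_k are asymptotically
    orthogonal; and their norms stay away from 0 provided A_k contains an index a
    carrying at least the n-th part of the mass of |z|^2 ([rinner_packet_ge]).

    The underlying analysis rests on three facts: continuous functions are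
    measurable for the sigma-algebra generated by the coordinates, the volume is
    invariant under translations, and consequently a directional derivative of
    a smooth function with compact support has integral 0; this is the only
    integration by parts. *)

(** * Directional derivatives and smooth functions *)

Lemma is_derive1_chain {R : realType} (f g : R -> R) (x df dg : R) :
  is_derive (f x) 1 g dg -> is_derive x 1 f df ->
  is_derive x 1 (fun y => g (f y)) (dg * df).
Proof.
move=> [gd gE] [fd fE]; split.
  have /derivable1_diffP gd' := gd; have /derivable1_diffP fd' := fd.
  exact/derivable1_diffP/(differentiable_comp fd' gd').
by have := derive1_comp fd gd; rewrite !derive1E gE fE.
Qed.

Section line_derivative.
Context {R : realType} {V : normedModType R}.
Implicit Types (f : V -> R) (p v : V).

(** The derivative of f along v at p + s v is that of s |-> f (p + s v) at s. *)
Lemma is_derive_line f p v (s df : R) :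
  is_derive (p + s *: v) v f df <->
  is_derive s 1 (fun x : R => f (p + x *: v)) df.
Proof.
have E : (fun h : R => h^-1 *: ((f \o shift (p + s *: v)) (h *: v) - f (p + s *: v))) =
  (fun h : R => h^-1 *: (((fun x : R => f (p + x *: v)) \o shift s) (h *: 1) -
     (fun x : R => f (p + x *: v)) s)).
  apply/funext => h /=; congr (_ *: (f _ - _)).
  by rewrite -[h *: 1]/(h * 1) mulr1 scalerDl addrCA.
split => -[dv dE]; split.
- by rewrite /derivable -E.
- by rewrite -dE /derive E.
- by rewrite /derivable E.
- by rewrite -dE /derive -E.
Qed.

Lemma is_derive_comp_line (g : R -> R) f p v (dg df : R) :
  is_derive (f p) 1 g dg -> is_derive p v f df ->
  is_derive p v (g \o f) (dg * df).
Proof.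
move=> gd fd.
have fd0 : is_derive (p + 0 *: v) v f df by rewrite scale0r addr0.
have fl := (is_derive_line f p v 0 df).1 fd0.
suff : is_derive (p + 0 *: v) v (g \o f) (dg * df) by rewrite scale0r addr0.
apply/is_derive_line/(is_derive1_chain _ fl).
by rewrite scale0r addr0.
Qed.

Lemma is_derive_affine f p v (c : R) :
  (forall h : R, f (h *: v + p) = f p + h * c) -> is_derive p v f c.
Proof.
move=> fl.
have H : h^-1 *: ((f \o shift p) (h *: v) - f p) @[h --> 0^'] --> c.
  apply: cvg_near_cst; near=> h.
  rewrite /= fl addrAC subrr add0r -[_ *: _]/(h^-1 * _) mulKf//.
  by near: h; exact: nbhs_dnbhs_neq.
by split; [apply/cvg_ex; exists c|exact/cvg_lim].
Unshelve. all: by end_near. Qed.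

End line_derivative.

Section smooth_closure.
Context {R : realType} {n : nat}.
Notation X := (heis R n).
Implicit Types (f g : X -> R).

Lemma Ck_continuous k f : Ck k f -> continuous f.
Proof. by case: k => [|k] []. Qed.

Lemma CkW k f : Ck k.+1 f -> Ck k f.
Proof.
elim: k f => [|k IH] f [cf /= Hf]; first by split.
by split => // v; split; [exact: (Hf v).1|exact/IH/(Hf v).2].
Qed.

Lemma Ck_cst k (c : R) : Ck k (fun _ : X => c).
Proof.
elim: k c => [|k IH] c; split => //; try exact: cst_continuous.
move=> v; split; first by move=> p; exact: derivable_cst.
have -> : (fun p : X => 'D_v (fun _ : X => c) p) = fun=> 0 by apply/funext => p; rewrite derive_cst.
exact: IH.
Qed.

Lemma CkD k f g : Ck k f -> Ck k g -> Ck k (fun p => f p + g p).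
Proof.
elim: k f g => [|k IH] f g.
  by move=> [cf _] [cg _]; split => // p; apply: continuousD; [exact: cf|exact: cg].
move=> [cf Hf] [cg Hg]; split; first by move=> p; apply: continuousD; [exact: cf|exact: cg].
move=> v; split; first by move=> p; apply: derivableD; [exact: (Hf v).1|exact: (Hg v).1].
rewrite (_ : (fun p => 'D_v _ p) = fun p => 'D_v f p + 'D_v g p).
  by apply: IH; [exact: (Hf v).2|exact: (Hg v).2].
by apply/funext => p; rewrite deriveD//; [exact: (Hf v).1|exact: (Hg v).1].
Qed.

Lemma CkM k f g : Ck k f -> Ck k g -> Ck k (fun p => f p * g p).
Proof.
elim: k f g => [|k IH] f g.
  by move=> [cf _] [cg _]; split => // p; apply: continuousM; [exact: cf|exact: cg].
move=> Cf Cg; have [cf Hf] := Cf; have [cg Hg] := Cg.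
split; first by move=> p; apply: continuousM; [exact: cf|exact: cg].
move=> v; split; first by move=> p; apply: derivableM; [exact: (Hf v).1|exact: (Hg v).1].
rewrite (_ : (fun p => 'D_v _ p) = fun p => f p * 'D_v g p + g p * 'D_v f p).
  apply: CkD; apply: IH; [exact: CkW|exact: (Hg v).2|exact: CkW|exact: (Hf v).2].
by apply/funext => p; rewrite deriveM//; [exact: (Hf v).1|exact: (Hg v).1].
Qed.

(** Closure under composition with a family g of functions of a real variable
    that is stable under derivation, the derivative of [g i] being [g (d i)]. *)
Lemma Ck_comp k (I : Type) (d : I -> I) (g : I -> R -> R) f :
  (forall i (x : R), is_derive x (1 : R) (g i) (g (d i) x)) ->
  Ck k f -> forall i, Ck k (fun p => g i (f p)).
Proof.
move=> dg; have cg i : continuous (g i).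
  move=> x; apply/differentiable_continuous/derivable1_diffP.
  by case: (dg i x).
elim: k f => [|k IH] f.
  by move=> [cf _] i; split => // p; apply: continuous_comp; [exact: cf|exact: cg].
move=> Cf i; have [cf Hf] := Cf.
split; first by move=> p; apply: continuous_comp; [exact: cf|exact: cg].
have D v p : is_derive p v (fun p => g i (f p)) (g (d i) (f p) * 'D_v f p).
  exact: (is_derive_comp_line (dg i (f p)) (derivableP ((Hf v).1 p))).
move=> v; split; first by move=> p; case: (D v p).
rewrite (_ : (fun p => 'D_v _ p) = fun p => g (d i) (f p) * 'D_v f p).
  by apply: CkM; [apply: IH; exact: CkW|exact: (Hf v).2].
by apply/funext => p; case: (D v p).
Qed.

Lemma smooth_cst (c : R) : smooth (fun _ : X => c).
Proof. by move=> k; exact: Ck_cst. Qed.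

Lemma smoothD f g : smooth f -> smooth g -> smooth (fun p => f p + g p).
Proof. by move=> sf sg k; exact: CkD. Qed.

Lemma smoothM f g : smooth f -> smooth g -> smooth (fun p => f p * g p).
Proof. by move=> sf sg k; exact: CkM. Qed.

Lemma smoothN f : smooth f -> smooth (fun p => - f p).
Proof.
move=> sf; have -> : (fun p => - f p) = fun p => -1 * f p by apply/funext => p; rewrite mulN1r.
exact/smoothM/sf/smooth_cst.
Qed.

Lemma smoothB f g : smooth f -> smooth g -> smooth (fun p => f p - g p).
Proof. by move=> sf sg; exact/smoothD/smoothN. Qed.

Lemma smoothX f m : smooth f -> smooth (fun p => f p ^+ m).
Proof.
move=> sf; elim: m => [|m IH].
  exact: smooth_cst.
have -> : (fun p => f p ^+ m.+1) = fun p => f p * f p ^+ m by apply/funext => p; rewrite exprS.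
exact: smoothM.
Qed.

Lemma smooth_sum (I : Type) (r : seq I) (P : pred I) (F : I -> X -> R) :
  (forall i, P i -> smooth (F i)) -> smooth (fun p => \sum_(i <- r | P i) F i p).
Proof.
move=> sF; elim: r => [|i r IH].
  have -> : (fun p => \sum_(i <- [::] | P i) F i p) = fun=> 0 by apply/funext => p; rewrite big_nil.
  exact: smooth_cst.
have -> : (fun p => \sum_(j <- i :: r | P j) F j p) =
    fun p => if P i then F i p + \sum_(j <- r | P j) F j p else \sum_(j <- r | P j) F j p.
  by apply/funext => p; rewrite big_cons.
by case: (boolP (P i)) => // Pi; apply: smoothD => //; exact: sF.
Qed.

Lemma smooth_comp (I : Type) (d : I -> I) (g : I -> R -> R) f :
  (forall i (x : R), is_derive x (1 : R) (g i) (g (d i) x)) ->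
  smooth f -> forall i, smooth (fun p => g i (f p)).
Proof. by move=> dg sf i k; exact: (Ck_comp dg). Qed.

Lemma smooth_linear f (l : X -> R) : continuous f ->
  (forall (h : R) v p, f (h *: v + p) = f p + h * l v) -> smooth f.
Proof.
move=> cf fl [|k]; split => // v.
have D p : is_derive p v f (l v) by apply: is_derive_affine.
split; first by move=> p; case: (D p).
rewrite (_ : (fun p => 'D_v _ p) = fun=> l v); first exact: Ck_cst.
by apply/funext => p; case: (D p).
Qed.

Lemma continuous_coord_t : continuous (fun p : X => p.1).
Proof. by move=> p; exact: cvg_fst. Qed.

Lemma continuous_coord_x k : continuous (fun p : X => p.2.1 ord0 k).
Proof.
move=> p; apply: (@continuous_comp _ _ _ (fun p : X => p.2.1) (fun M : 'rV[R]_n => M ord0 k)).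
  apply: (@continuous_comp _ _ _ (fun p : X => p.2) fst); [exact: cvg_snd|exact: cvg_fst].
exact: coord_continuous.
Qed.

Lemma continuous_coord_y k : continuous (fun p : X => p.2.2 ord0 k).
Proof.
move=> p; apply: (@continuous_comp _ _ _ (fun p : X => p.2.2) (fun M : 'rV[R]_n => M ord0 k)).
  apply: (@continuous_comp _ _ _ (fun p : X => p.2) snd); [exact: cvg_snd|exact: cvg_snd].
exact: coord_continuous.
Qed.

Lemma smooth_t : smooth (fun p : X => p.1).
Proof.
apply: (@smooth_linear _ (fun p : X => p.1)); first exact: continuous_coord_t.
by move=> h v p /=; rewrite addrC.
Qed.

Lemma smooth_x k : smooth (fun p : X => p.2.1 ord0 k).
Proof.
apply: (@smooth_linear _ (fun p : X => p.2.1 ord0 k)); first exact: continuous_coord_x.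
by move=> h v p /=; rewrite !mxE addrC.
Qed.

Lemma smooth_y k : smooth (fun p : X => p.2.2 ord0 k).
Proof.
apply: (@smooth_linear _ (fun p : X => p.2.2 ord0 k)); first exact: continuous_coord_y.
by move=> h v p /=; rewrite !mxE addrC.
Qed.

Lemma smooth_znorm2 : smooth (@znorm2 R n).
Proof.
apply: smooth_sum => k _; apply: smoothD; apply: smoothX; [exact: smooth_x|exact: smooth_y].
Qed.

Lemma smooth_expR f : smooth f -> smooth (fun p => expR (f p)).
Proof.
by move=> sf; exact: (@smooth_comp unit id (fun=> expR) _ _ sf tt).
Qed.

Lemma smooth_cos_sin f : smooth f ->
  smooth (fun p => cos (f p)) /\ smooth (fun p => sin (f p)).
Proof.
move=> sf.
(* The four functions +-cos, +-sin: [h.2] gives the sign, [h.1] tells cos from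
   sin. *)
pose d (h : bool * bool) := (~~ h.1, h.1 (+) h.2).
pose g (h : bool * bool) x : R := (-1) ^+ h.2 * (if h.1 then cos x else sin x).
have dg i (x : R) : is_derive x (1 : R) (g i) (g (d i) x).
  case: i => -[] b; rewrite /g /d /=.
  - have := @is_deriveZ _ _ _ cos ((-1) ^+ b) x 1 _ (is_derive_cos x).
    by congr (is_derive _ _ _ _); rewrite signrN mulNr -mulrN.
  - exact: (@is_deriveZ _ _ _ sin ((-1) ^+ b) x 1 _ (is_derive_sin x)).
split.
  have := smooth_comp dg sf (true, false); rewrite /g /= expr0.
  by under eq_fun do rewrite mul1r.
have := smooth_comp dg sf (false, false); rewrite /g /= expr0.
by under eq_fun do rewrite mul1r.
Qed.

End smooth_closure.

(** * A flat bump function *)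

Section bump.
Context {R : realType}.

(** The function P(1/x) exp(-1/x), extended by 0 to x <= 0; its derivative is
    of the same form. *)
Definition flat_exp (P : {poly R}) (x : R) : R :=
  if 0 < x then P.[x^-1] * expR (- x^-1) else 0.

(** The polynomial Q such that Q(1/x) exp(-1/x) is the derivative of
    P(1/x) exp(-1/x). *)
Definition flat_exp_deriv (P : {poly R}) : {poly R} := 'X^2 * (P - P^`()).

(** Applied to 'X * P, this bounds the difference quotient of [flat_exp P] at 0. *)
Lemma flat_exp_linear_bound (P : {poly R}) :
  exists2 C : R, 0 <= C & forall x, x <= 1 -> `|flat_exp P x| <= C * `|x|.
Proof.
pose S := \sum_(i < size P) `|P`_i|; pose N := size P.
exists (S * N.+1`!%:R); first by rewrite mulr_ge0// sumr_ge0.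
move=> x x1; rewrite /flat_exp; case: ltP => [x0|_]; last by rewrite normr0 !mulr_ge0// sumr_ge0.
pose y := x^-1; have y1 : 1 <= y by rewrite invf_ge1.
have y0 : 0 < y by rewrite invr_gt0.
rewrite normrM -/y (ger0_norm (expR_ge0 _)) expRN (gtr0_norm x0).
rewrite ler_pdivrMr ?expR_gt0//.
apply: (@le_trans _ _ (S * y ^+ N)).
  rewrite horner_coef (le_trans (ler_norm_sum _ _ _))// /S mulr_suml ler_sum// => i _.
  by rewrite normrM ler_wpM2l// normrX (gtr0_norm y0) ler_weXn2l// ltnW.
rewrite -!mulrA ler_wpM2l ?sumr_ge0//.
have := expR_ge1Dxn N (ltW y0).
move=> H; have {}H : y ^+ N.+1 / N.+1`!%:R <= expR y by apply: le_trans H; rewrite lerDr.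
rewrite ler_pdivrMr ?ltr0n ?fact_gt0// in H.
rewrite mulrCA -ler_pdivrMl// mulrC.
by move: H; rewrite -/y exprSr [_ * N.+1`!%:R]mulrC.
Qed.

Lemma is_derive_flat_exp P (x : R) :
  is_derive x (1 : R) (flat_exp P) (flat_exp (flat_exp_deriv P) x).
Proof.
have [x0|x0|->] := ltgtP x 0.
- rewrite /(flat_exp _ x) ltNge (ltW x0) /=.
  apply: (@near_eq_is_derive _ _ _ (cst 0)).
  near=> z; rewrite /flat_exp ltNge.
  suff -> : z <= 0 by [].
  by near: z; exact: lt_le_nbhsl.
- rewrite /(flat_exp _ x) x0.
  have N0 : \forall z \near x, P.[z^-1] * expR (- z^-1) = flat_exp P z.
    near=> z; rewrite /flat_exp.
    suff -> : 0 < z by [].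
    by near: z; exact: lt_nbhsr.
  apply: (near_eq_is_derive N0).
  have xn0 : x != 0 by rewrite gt_eqF.
  have dV : is_derive x (1 : R) (fun z : R => z^-1) (- x ^- 2).
    have did : derivable (@id R) x 1 by exact: derivable_id.
    split; first exact: (@derivableV _ _ id _ _ xn0 did).
    by rewrite (@deriveV _ _ id _ _ xn0 did) derive_id [_ *: _]mulr1.
  have d1 := is_derive1_chain (is_derive_poly P x^-1) dV.
  have dE (z : R) : is_derive z (1 : R) expR (expR z).
    exact: is_derive_expR.
  have dN : is_derive x (1 : R) (fun z : R => - z^-1) (x ^- 2).
    by have := is_deriveN dV; rewrite opprK.
  have d2 := is_derive1_chain (dE _) dN.
  have := is_deriveM d1 d2; congr (is_derive _ _ _ _).
  rewrite /flat_exp_deriv !hornerE /=.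
  rewrite /GRing.scale /=.
  rewrite exprVn; ring.
- rewrite {2}/flat_exp ltxx.
  have H : h^-1 *: ((flat_exp P \o shift 0) (h *: 1) - flat_exp P 0) @[h --> 0^'] --> (0 : R).
    have E h : h^-1 *: ((flat_exp P \o shift 0) (h *: 1) - flat_exp P 0) = flat_exp ('X * P) h.
      rewrite /= addr0 {2}/flat_exp ltxx subr0 -[h *: 1]/(h * 1) mulr1.
      rewrite /flat_exp; case: ifP => _; last by rewrite scaler0.
      by rewrite !hornerE -mulrA.
    under eq_fun do rewrite E.
    have [C C0 HC] := flat_exp_linear_bound ('X * P).
    apply/cvgr0Pnorm_lt => e e0; near=> h.
    apply: le_lt_trans (HC h _) _.
      by apply: ltW; near: h; apply: nbhs_dnbhs; exact: lt_nbhsl.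
    apply: (@le_lt_trans _ _ ((C + 1) * `|h|)).
      by rewrite ler_wpM2r// lerDl.
    rewrite -ltr_pdivlMl; last by rewrite ltr_wpDl.
    near: h; apply: nbhs_dnbhs; exists ((C + 1)^-1 * e) => /=.
      by rewrite mulr_gt0// invr_gt0 ltr_wpDl.
    by move=> z /=; rewrite sub0r normrN.
  by split; [apply/cvg_ex; exists 0|exact/cvg_lim].
Unshelve. all: by end_near. Qed.

Lemma flat_exp_le0 P (x : R) : x <= 0 -> flat_exp P x = 0.
Proof. by rewrite /flat_exp ltNge => ->. Qed.

Lemma flat_exp_ge0 (x : R) : 0 <= flat_exp 1 x.
Proof. by rewrite /flat_exp; case: ifP => // _; rewrite hornerE mul1r expR_ge0. Qed.

Lemma flat_exp_le1 (x : R) : flat_exp 1 x <= 1.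
Proof.
rewrite /flat_exp; case: ifP => // x0.
by rewrite hornerE mul1r expR_le1 oppr_le0 invr_ge0 ltW.
Qed.

Lemma cvg_flat_exp (a : R) : 0 < a -> flat_exp 1 (m%:R * a - 1) @[m --> \oo] --> (1 : R).
Proof.
move=> a0.
have E1 : (1 : R) = expR (- 0) by rewrite oppr0 expR0.
suff : expR (- (m%:R * a - 1)^-1) @[m --> \oo] --> (1 : R).
  apply: cvg_trans; apply: near_eq_cvg; near=> m.
  rewrite /flat_exp.
  suff -> : 0 < m%:R * a - 1 by rewrite hornerE mul1r.
  rewrite subr_gt0 -ltr_pdivrMr//.
  by near: m; exact: nbhs_infty_gtr.
have K : (- (m%:R * a - 1)^-1) @[m --> \oo] --> (- 0 : R); last first.
  by rewrite [X in _ --> X]E1; apply: (@continuous_cvg _ _ _ _ _ _ (@expR R)); [exact: continuous_expR|exact: K].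
have P0 : \forall m \near \oo, 0 < m%:R * a - 1.
  near=> m; rewrite subr_gt0 -ltr_pdivrMr//.
  by near: m; exact: nbhs_infty_gtr.
apply: cvgN; apply/(gtr0_cvgV0 P0).
apply/cvgryPgt => M; near=> m.
rewrite ltrBrDr -ltr_pdivrMr//.
by near: m; exact: nbhs_infty_gtr.
Unshelve. all: by end_near. Qed.

End bump.

(** * Measurability of continuous functions *)

Section coordinates.
Context {R : realType} {n : nat}.
Notation X := (heis R n).
Notation MX := (measurableTypeR R * ('rV[R]_n * 'rV[R]_n))%type.

Lemma row_norm_leP (M : 'rV[R]_n) (e : R) : 0 <= e ->
  reflect (forall k, `|M ord0 k| <= e) (`|M| <= e).
Proof.
move=> e0; rewrite [X in X <= e]/Num.norm/= mx_normrE; apply: (iffP idP) => [/bigmax_leP[_ H] k|H].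
  exact: (H (ord0, k)).
by apply/bigmax_leP; split => // -[i k] _ /=; rewrite ord1.
Qed.

Lemma heis_norm_le (p : X) (e : R) : 0 <= e -> `|p.1| <= e ->
  (forall k, `|p.2.1 ord0 k| <= e) -> (forall k, `|p.2.2 ord0 k| <= e) -> `|p| <= e.
Proof.
move=> e0 pt px py; rewrite prod_normE ge_max pt /= prod_normE ge_max.
by apply/andP; split; apply/row_norm_leP.
Qed.

Lemma heis_norm_t (p : X) : `|p.1| <= `|p|.
Proof. by rewrite [leRHS]prod_normE le_max lexx. Qed.

Lemma heis_norm_x (p : X) k : `|p.2.1 ord0 k| <= `|p|.
Proof.
apply: (@le_trans _ _ `|p.2.1|); first exact: (row_norm_leP _ (normr_ge0 _) _).
by rewrite !prod_normE !le_max lexx !orbT.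
Qed.

Lemma heis_norm_y (p : X) k : `|p.2.2 ord0 k| <= `|p|.
Proof.
apply: (@le_trans _ _ `|p.2.2|); first exact: (row_norm_leP _ (normr_ge0 _) _).
by rewrite !prod_normE !le_max lexx !orbT.
Qed.

Lemma measurable_coord_t : measurable_fun setT (fun p : MX => p.1).
Proof. exact: measurable_fst. Qed.

Lemma measurable_coord_x k : measurable_fun setT (fun p : MX => p.2.1 ord0 k).
Proof.
apply: (@measurableT_comp _ _ _ _ _ _ (row_coord k) _ (fun p : MX => p.2.1)).
  exact: measurable_row_coord.
by apply: measurableT_comp; [exact: measurable_fst|exact: measurable_snd].
Qed.

Lemma measurable_coord_y k : measurable_fun setT (fun p : MX => p.2.2 ord0 k).
Proof.
apply: (@measurableT_comp _ _ _ _ _ _ (row_coord k) _ (fun p : MX => p.2.2)).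
  exact: measurable_row_coord.
by apply: measurableT_comp; [exact: measurable_snd|exact: measurable_snd].
Qed.

(** The lattice point with coordinates in (m + 1)^-1 Z just below [p], as a
    point of a countable type. *)
Definition grid_floor (m : nat) (p : X) : int * ('rV[int]_n * 'rV[int]_n) :=
  let fl (x : R) : int := Num.floor (m.+1%:R * x) in
  (fl p.1, (map_mx fl p.2.1, map_mx fl p.2.2)).

(** The lattice point encoded by [c]. *)
Definition grid_point (m : nat) (c : int * ('rV[int]_n * 'rV[int]_n)) : X :=
  let pt (k : int) : R := k%:~R / m.+1%:R in
  (pt c.1, (map_mx pt c.2.1, map_mx pt c.2.2)).

Lemma grid_floor_near (m : nat) (p : X) :
  `|grid_point m (grid_floor m p) - p| <= m.+1%:R^-1.
Proof.
have fl (x : R) : `|(Num.floor (m.+1%:R * x))%:~R / m.+1%:R - x| <= m.+1%:R^-1.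
  have /andP[h1 h2] := floor_itv (m.+1%:R * x).
  rewrite -[X in _ - X](mulfK (_ : m.+1%:R != 0 :> R))//.
  rewrite -mulrBl normrM normfV (ger0_norm (ler0n _ _)) -[leRHS]mul1r ler_wpM2r ?invr_ge0//.
  rewrite ler0_norm ?subr_le0 ?[x * _]mulrC//.
  by rewrite opprB lerBlDr addrC (le_trans (ltW h2))// intrD.
apply: heis_norm_le => [||k|k]; first by rewrite invr_ge0.
- exact: fl.
- by rewrite !mxE; exact: fl.
- by rewrite !mxE; exact: fl.
Qed.

Lemma measurable_grid_fibre (m : nat) c :
  measurable ([set p | grid_floor m p = c] : set MX).
Proof.
have mI (k : int) : measurable [set x : measurableTypeR R | Num.floor (m.+1%:R * x) = k].
  rewrite (_ : mkset _ = `[k%:~R / m.+1%:R, (k + 1)%:~R / m.+1%:R[%classic).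
    exact: measurable_itv.
  apply/seteqP; split => x /=.
    move=> <-; have /andP[h1 h2] := floor_itv (m.+1%:R * x).
    by rewrite in_itv /= ler_pdivrMr// ltr_pdivlMr// ![x * _]mulrC h1 h2.
  rewrite in_itv /= ler_pdivrMr// ltr_pdivlMr// => h.
  by apply: floor_def; rewrite [_ * x]mulrC.
rewrite (_ : mkset _ = [set p : MX | Num.floor (m.+1%:R * p.1) = c.1] `&`
   ((\bigcap_(k in [set: 'I_n]) [set p : MX | Num.floor (m.+1%:R * p.2.1 ord0 k) = c.2.1 ord0 k]) `&`
   (\bigcap_(k in [set: 'I_n]) [set p : MX | Num.floor (m.+1%:R * p.2.2 ord0 k) = c.2.2 ord0 k]))).
  apply: measurableI; first by rewrite -[X in measurable X]setTI; exact: (measurable_coord_t measurableT (mI _)).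
  apply: measurableI; (apply: fin_bigcap_measurable => [|k _]; first exact: finite_finset);
    rewrite -[X in measurable X]setTI.
    exact: (measurable_coord_x k measurableT (mI (c.2.1 ord0 k))).
  exact: (measurable_coord_y k measurableT (mI (c.2.2 ord0 k))).
apply/seteqP; split => p /=.
  by move=> <-; split => //; split => k _ /=; rewrite mxE.
case: c => c1 [c2 c3] [/= e1 [e2 e3]]; rewrite /grid_floor e1; congr (_, (_, _)).
  by apply/rowP => k; rewrite mxE; exact: e2.
by apply/rowP => k; rewrite mxE; exact: e3.
Qed.

Lemma cvg_grid_point (p : X) : grid_point m (grid_floor m p) @[m --> \oo] --> p.
Proof.
apply/cvgrPdist_le => _/posnumP[e]; near=> m.
rewrite distrC (le_trans (grid_floor_near _ _))// ltW//.
by near: m; exact: near_infty_natSinv_lt.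
Unshelve. all: by end_near. Qed.

(** The sigma-algebra is generated by the coordinates, not by the open sets; a
    continuous function is the limit of functions that are constant on the cells
    of finer and finer lattices. *)
Lemma continuous_measurable_heis (f : X -> R) :
  continuous f -> measurable_fun setT (f : MX -> R).
Proof.
move=> cf; apply/measurable_EFinP.
apply: (@emeasurable_fun_cvg _ _ _ _ (fun m p => (f (grid_point m (grid_floor m p)))%:E)).
  move=> m; apply/measurable_EFinP => _ Y mY; rewrite setTI.
  rewrite (_ : _ @^-1` Y = \bigcup_c (if `[< Y (f (grid_point m c)) >] then
     ([set p | grid_floor m p = c] : set MX) else set0)).
    apply: countable_bigcupT_measurable; first exact: countableP.
    move=> c; case: ifPn => _; [exact: measurable_grid_fibre|exact: measurable0].
  apply/seteqP; split => p /=.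
    by move=> Yp; exists (grid_floor m p) => //; rewrite asboolT.
  by move=> [c _]; case: ifPn => // /asboolP Yc /= ->.
move=> p _; apply/fine_cvgP; split; first exact: nearW.
by apply: (@continuous_cvg _ _ _ _ _ _ f); [exact: cf|exact: cvg_grid_point].
Qed.

End coordinates.

(** * Translation invariance and volumes of boxes *)

Section translation.
Context {R : realType}.

(** The translated measure agrees with the Lebesgue measure on intervals. *)
Lemma lebesgue_measure_shift (a : R) (A : set (measurableTypeR R)) : measurable A ->
  lebesgue_measure ((fun x : measurableTypeR R => x + a) @^-1` A) = lebesgue_measure A.
Proof.
move=> mA.
have ms : measurable_fun setT ((fun x => x + a) : measurableTypeR R -> measurableTypeR R).
  by apply: measurable_funD; [exact: measurable_id|exact: measurable_cst].
pose m : {measure set (measurableTypeR R) -> \bar R} :=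
  measure_function_pushforward__canonical__measure_function_Measure lebesgue_measure ms.
rewrite [RHS](@lebesgue_measure_unique _ m)//.
move=> _ [[x y] _ <-] /=; rewrite /m /= /pushforward.
have -> : (fun x => x + a) @^-1` `]x, y] = `]x - a, y - a]%classic.
  by apply/seteqP; split => z /=; rewrite !in_itv /= ltrBlDr lerBrDr.
rewrite !lebesgue_measure_itv /= !lte_fin ltrD2r; case: ifP => // _.
by rewrite -!EFinB opprB addrA subrK.
Qed.

Lemma sfprod_shift_r d1 d2 (T1 : measurableType d1) (T2 : measurableType d2)
  (m1 : {sigma_finite_measure set T1 -> \bar R}) (m2 : {sigma_finite_measure set T2 -> \bar R})
  (s : T2 -> T2) (A : set (T1 * T2)) :
  (forall B, measurable B -> m2 (s @^-1` B) = m2 B) -> measurable A ->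
  sfprod m1 m2 ((fun p => (p.1, s p.2)) @^-1` A) = sfprod m1 m2 A.
Proof.
move=> ms mA; rewrite /sfprod /product_measure1.
apply: eq_integral => x _ /=.
rewrite -[RHS]ms; last exact: measurable_xsection.
congr (m2 _); apply/seteqP; split => y /=; rewrite /xsection /= !inE //.
Qed.

(** Slicing along the second factor: the product measure is defined by the slices
    along the first one. *)
Lemma sfprod_ysection d1 d2 (T1 : measurableType d1) (T2 : measurableType d2)
  (m1 : {sigma_finite_measure set T1 -> \bar R}) (m2 : {sigma_finite_measure set T2 -> \bar R})
  (A : set (T1 * T2)) : measurable A ->
  sfprod m1 m2 A = (\int[m2]_y m1 (ysection A y))%E.
Proof.
move=> mA; rewrite /sfprod.
apply: (@product_measure_unique _ _ _ _ _ m1 m2 [the measure _ _ of (m1 \x^ m2)%E]) => // B C mB mC.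
exact: product_measure2E.
Qed.

Lemma sfprod_shift_l d1 d2 (T1 : measurableType d1) (T2 : measurableType d2)
  (m1 : {sigma_finite_measure set T1 -> \bar R}) (m2 : {sigma_finite_measure set T2 -> \bar R})
  (s : T1 -> T1) (A : set (T1 * T2)) : measurable_fun setT s ->
  (forall B, measurable B -> m1 (s @^-1` B) = m1 B) -> measurable A ->
  sfprod m1 m2 ((fun p => (s p.1, p.2)) @^-1` A) = sfprod m1 m2 A.
Proof.
move=> meas_s ms mA; rewrite !sfprod_ysection//; last first.
  rewrite -[X in measurable X]setTI.
  have : measurable_fun setT (fun p : T1 * T2 => (s p.1, p.2)).
    apply/measurable_fun_pairP; split; last exact: measurable_snd.
    exact: (measurableT_comp meas_s measurable_fst).
  exact.
apply: eq_integral => y _ /=.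
rewrite -[RHS]ms; last exact: measurable_ysection.
congr (m1 _); apply/seteqP; split => x /=; rewrite /ysection /= !inE //.
Qed.

Lemma lebesgue_row_shift (n : nat) (v : 'rV[R]_n) (A : set 'rV[R]_n) : measurable A ->
  lebesgue_row R n ((fun x => x + v) @^-1` A) = lebesgue_row R n A.
Proof.
elim: n v A => [|n IH] v A mA.
  by congr (lebesgue_row R 0 _); apply/seteqP; split => x /=; rewrite (_ : x + v = x)//; apply/rowP => -[].
rewrite /= /cons_measure /pushforward.
set B := @row_cons R n @^-1` A.
have mB : measurable B by rewrite -[X in measurable X]setTI; exact: measurable_row_cons.
pose v' : 'rV[R]_n := \row_j v ord0 (lift ord0 j).
have mv : measurable_fun setT (fun x : measurableTypeR R => x + v ord0 ord0).
  by apply: measurable_funD; [exact: measurable_id|exact: measurable_cst].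
have mv' : measurable_fun setT (fun x : 'rV[R]_n => x + v').
  apply: measurable_fun_row => i.
  rewrite (_ : _ \o _ = fun x : 'rV[R]_n => row_coord i x + v' ord0 i).
    apply: (@measurable_funD _ _ _ _ (row_coord i) (fun=> v' ord0 i)).
      exact: measurable_row_coord.
    exact: measurable_cst.
  by apply/funext => x; rewrite /= /row_coord mxE.
rewrite (_ : _ @^-1` _ = (fun p : measurableTypeR R * 'rV[R]_n => (p.1 + v ord0 ord0, p.2)) @^-1`
    ((fun p => (p.1, p.2 + v')) @^-1` B)).
  rewrite (@sfprod_shift_l _ _ _ _ lebesgue_measure (lebesgue_row R n) (fun x : measurableTypeR R => x + v ord0 ord0))//.
  - apply: (@sfprod_shift_r _ _ _ _ lebesgue_measure (lebesgue_row R n) (fun x => x + v')) => //.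
    by move=> C mC; exact: IH.
  - by move=> C mC; exact: lebesgue_measure_shift.
  - rewrite -[X in measurable X]setTI.
    have : measurable_fun setT (fun p : measurableTypeR R * 'rV[R]_n => (p.1, p.2 + v')).
      apply/measurable_fun_pairP; split; first exact: measurable_fst.
      exact: (measurableT_comp mv' measurable_snd).
    exact.
apply/seteqP; split => -[x y]; rewrite /B /=.
  all: suff -> : row_cons (x, y) + v = row_cons (x + v ord0 ord0, y + v') by [].
  all: apply/rowP => j; rewrite !mxE; case: unliftP => [k ->|->] //=; by rewrite !mxE.
Qed.

Lemma heis_vol_shift (n : nat) (v : heis R n)
  (A : set (measurableTypeR R * ('rV[R]_n * 'rV[R]_n))%type) : measurable A ->
  heis_vol R n ((fun p : heis R n => p + v) @^-1` A) = heis_vol R n A.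
Proof.
move=> mA; case: v => a [b c].
have ma : measurable_fun setT (fun x : measurableTypeR R => x + a).
  by apply: measurable_funD; [exact: measurable_id|exact: measurable_cst].
have mb (w : 'rV[R]_n) : measurable_fun setT (fun x : 'rV[R]_n => x + w).
  apply: measurable_fun_row => i.
  rewrite (_ : _ \o _ = fun x : 'rV[R]_n => row_coord i x + w ord0 i).
    apply: (@measurable_funD _ _ _ _ (row_coord i) (fun=> w ord0 i)).
      exact: measurable_row_coord.
    exact: measurable_cst.
  by apply/funext => x; rewrite /= /row_coord mxE.
pose ss (x : 'rV[R]_n * 'rV[R]_n) := (x.1 + b, x.2 + c).
have mss : measurable_fun setT ss.
  apply/measurable_fun_pairP; split.
    exact: (measurableT_comp (mb b) measurable_fst).
  exact: (measurableT_comp (mb c) measurable_snd).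
have Pss B : measurable B -> sfprod (lebesgue_row R n) (lebesgue_row R n) (ss @^-1` B) =
    sfprod (lebesgue_row R n) (lebesgue_row R n) B.
  move=> mB.
  rewrite (_ : _ @^-1` _ = (fun p => (p.1 + b, p.2)) @^-1`
    ((fun p : 'rV[R]_n * 'rV[R]_n => (p.1, p.2 + c)) @^-1` B)); last by [].
  rewrite (@sfprod_shift_l _ _ _ _ (lebesgue_row R n) (lebesgue_row R n) (fun x => x + b))//.
  - apply: (@sfprod_shift_r _ _ _ _ (lebesgue_row R n) (lebesgue_row R n) (fun x => x + c)) => //.
    by move=> C mC; exact: lebesgue_row_shift.
  - by move=> C mC; exact: lebesgue_row_shift.
  - rewrite -[X in measurable X]setTI.
    have : measurable_fun setT (fun p : 'rV[R]_n * 'rV[R]_n => (p.1, p.2 + c)).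
      apply/measurable_fun_pairP; split; first exact: measurable_fst.
      exact: (measurableT_comp (mb c) measurable_snd).
    exact.
have mC : measurable ((fun p => (p.1, ss p.2)) @^-1` A).
  rewrite -[X in measurable X]setTI.
  have : measurable_fun setT (fun p : measurableTypeR R * ('rV[R]_n * 'rV[R]_n) => (p.1, ss p.2)).
    apply/measurable_fun_pairP; split; first exact: measurable_fst.
    exact: (measurableT_comp mss measurable_snd).
  exact.
have Pa B : measurable B ->
    lebesgue_measure ((fun x : measurableTypeR R => x + a) @^-1` B) = lebesgue_measure B.
  by move=> mB; exact: lebesgue_measure_shift.
have E1 := sfprod_shift_l (sfprod (lebesgue_row R n) (lebesgue_row R n)) ma Pa mC.
have E2 := sfprod_shift_r lebesgue_measure Pss mA.
exact: (etrans E1 E2).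
Qed.

End translation.

Section boxes.
Context {R : realType}.

(** The open cube with centre [c] and half-width [r]. *)
Definition row_cube (n : nat) (c : 'rV[R]_n) (r : R) : set 'rV[R]_n :=
  [set x | forall k, `|x ord0 k - c ord0 k| < r].

Lemma measurable_row_cube n (c : 'rV[R]_n) r : measurable (row_cube c r).
Proof.
rewrite (_ : row_cube c r = \bigcap_(k in [set: 'I_n]) (row_coord k @^-1` ball (c ord0 k) r)).
  apply: fin_bigcap_measurable => [|k _]; first exact: finite_finset.
  rewrite -[X in measurable X]setTI; apply: (measurable_row_coord k) => //.
  exact: measurable_ball.
apply/seteqP; split => x /= H k; first by move=> _; rewrite -ball_normE /row_coord /= distrC; exact: H.
by have := H k I; rewrite -ball_normE /row_coord /= distrC.
Qed.

Lemma lebesgue_row_cube n (c : 'rV[R]_n) r : 0 <= r ->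
  lebesgue_row R n (row_cube c r) = ((r *+ 2) ^+ n)%:E.
Proof.
move=> r0; elim: n c => [|n IH] c.
  rewrite expr0 /= diracE mem_set// /row_cube /= => -[] //.
rewrite /= /cons_measure /pushforward.
rewrite (_ : _ @^-1` _ = ball (c ord0 ord0) r `*` row_cube (\row_j c ord0 (lift ord0 j)) r).
  rewrite /sfprod product_measure1E.
  - by rewrite [X in (X * _)%E = _]lebesgue_measure_ball// IH -EFinM exprS.
  - exact: measurable_ball.
  - exact: measurable_row_cube.
apply/seteqP; split => -[a y] /=.
  move=> H; split => [|k].
    by have := H ord0; rewrite /row_cons /= mxE unlift_none -ball_normE /= distrC.
  by have := H (lift ord0 k); rewrite /row_cons !mxE liftK.
move=> [/= Ha Hy] k; rewrite /row_cons mxE; case: unliftP => [j ->|->] /=.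
  by have := Hy j; rewrite mxE.
by move: Ha; rewrite -ball_normE /= distrC.
Qed.

(** The box with centre [c], of half-width [s] in t and [r] in the other
    coordinates. *)
Definition heis_box n (c : heis R n) (s r : R) : set (heis R n) :=
  [set p | `|p.1 - c.1| < s /\ row_cube c.2.1 r p.2.1 /\ row_cube c.2.2 r p.2.2].

Lemma heis_boxE n (c : heis R n) (s r : R) :
  heis_box c s r = ball c.1 s `*` (row_cube c.2.1 r `*` row_cube c.2.2 r).
Proof.
apply/seteqP; split => p [/= H1 [H2 H3]]; split => //.
  by rewrite -ball_normE /= distrC.
by move: H1; rewrite -ball_normE /= distrC.
Qed.

Notation MX n := (measurableTypeR R * ('rV[R]_n * 'rV[R]_n))%type.

Lemma measurable_heis_box n (c : heis R n) s r : measurable (heis_box c s r : set (MX n)).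
Proof.
rewrite heis_boxE; apply: measurableX; first exact: measurable_ball.
by apply: measurableX; exact: measurable_row_cube.
Qed.

Lemma heis_vol_box n (c : heis R n) s r : 0 <= s -> 0 <= r ->
  heis_vol R n (heis_box c s r) = (s *+ 2 * ((r *+ 2) ^+ n) ^+ 2)%:E.
Proof.
move=> s0 r0.
have inner : sfprod (lebesgue_row R n) (lebesgue_row R n)
    (row_cube c.2.1 r `*` row_cube c.2.2 r) = (((r *+ 2) ^+ n) ^+ 2)%:E.
  transitivity (lebesgue_row R n (row_cube c.2.1 r) * lebesgue_row R n (row_cube c.2.2 r))%E.
    by apply: product_measure1E; exact: measurable_row_cube.
  rewrite expr2 EFinM.
  exact: (congr2 mule (lebesgue_row_cube c.2.1 r0) (lebesgue_row_cube c.2.2 r0)).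
rewrite heis_boxE EFinM -inner -(lebesgue_measure_ball c.1 s0).
apply: product_measure1E; first exact: measurable_ball.
by apply: measurableX; exact: measurable_row_cube.
Qed.

End boxes.

(** * The Heisenberg ball and integrals of derivatives *)

Section ball_geometry.
Context {R : realType} {n : nat}.
Notation X := (heis R n).
Notation MX := (measurableTypeR R * ('rV[R]_n * 'rV[R]_n))%type.
Notation mu := (heis_vol R n).
Local Notation Omega := (@heis_ball R n).

(** The squared modulus |w|^2 of w = t + i |z|^2. *)
Definition rho (p : X) : R := p.1 ^+ 2 + znorm2 p ^+ 2.

Lemma smooth_rho : smooth rho.
Proof. by apply: smoothD; apply: smoothX; [exact: smooth_t|exact: smooth_znorm2]. Qed.

Lemma smooth_continuous (f : X -> R) : smooth f -> continuous f.
Proof. by move=> /(_ 0); exact: Ck_continuous. Qed.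

Lemma continuous_rho : continuous rho.
Proof. exact: smooth_continuous smooth_rho. Qed.

Lemma znorm2_ge0 (p : X) : 0 <= znorm2 p.
Proof. by apply: sumr_ge0 => k _; rewrite addr_ge0// sqr_ge0. Qed.

Lemma znorm2_ge_coord (p : X) k : p.2.1 ord0 k ^+ 2 + p.2.2 ord0 k ^+ 2 <= znorm2 p.
Proof.
rewrite /znorm2 (bigD1 k)//= lerDl; apply: sumr_ge0 => j _.
by rewrite addr_ge0// sqr_ge0.
Qed.

Lemma znorm2_le1 (p : X) : Omega p -> znorm2 p <= 1.
Proof.
move=> Op; rewrite -(@ler_pXn2r R 2) ?nnegrE ?znorm2_ge0// expr1n.
by apply: le_trans Op; rewrite lerDr sqr_ge0.
Qed.

Let sqr_le1 (x : R) : x ^+ 2 <= 1 -> `|x| <= 1.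
Proof. by move=> h; rewrite -ler_sqr ?nnegrE// expr1n real_normK ?num_real. Qed.

Lemma heis_ball_norm (p : X) : Omega p -> `|p| <= 1.
Proof.
move=> Op; have z1 := znorm2_le1 Op; apply: heis_norm_le => // [|k|k]; apply: sqr_le1.
- by apply: le_trans Op; rewrite lerDl sqr_ge0.
- by apply: le_trans z1; apply: le_trans (znorm2_ge_coord _ k); rewrite lerDl sqr_ge0.
- by apply: le_trans z1; apply: le_trans (znorm2_ge_coord _ k); rewrite lerDr sqr_ge0.
Qed.

Lemma heis_norm_box (p : X) (B : R) : `|p| < B -> heis_box 0 B B p.
Proof.
move=> pB; split; first by rewrite subr0 (le_lt_trans (heis_norm_t _) pB).
split => k; rewrite mxE subr0.
  exact: (le_lt_trans (heis_norm_x _ _) pB).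
exact: (le_lt_trans (heis_norm_y _ _) pB).
Qed.

Lemma measurable_le_rho (c : R) : measurable ([set p | rho p <= c] : set MX).
Proof.
have := continuous_measurable_heis continuous_rho measurableT (measurable_itv `]-oo, c]).
rewrite setTI; congr (measurable _).
Qed.

Lemma measurable_heis_ball : measurable (Omega : set MX).
Proof. exact: (measurable_le_rho 1). Qed.

Lemma heis_vol_ball_lty : (mu Omega < +oo)%E.
Proof.
apply: (@le_lt_trans _ _ (mu (heis_box 0 2 2))).
  apply: le_measure; rewrite ?inE.
  - exact: measurable_heis_ball.
  - exact: measurable_heis_box.
  - move=> p Op; apply: heis_norm_box; apply: le_lt_trans (heis_ball_norm Op) _.
    by rewrite ltr1n.
have -> := @heis_vol_box R n 0 2 2 (ler0n _ _) (ler0n _ _).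
exact: ltry.
Qed.

Lemma lt_rho_interior : [set p | rho p < 1] `<=` Omega°.
Proof.
have oU : open [set p | rho p < 1].
  by apply: (@open_comp _ _ rho [set x | x < 1]) => [p _|]; [exact: continuous_rho|exact: open_lt].
move=> p rp; apply: (@filterS _ (nbhs p) _ [set p | rho p < 1]); first by move=> y /= /ltW.
exact: open_nbhs_nbhs.
Qed.

Lemma compact_heis_norm_le (c : R) : compact [set p : X | `|p| <= c].
Proof.
have K : compact (`[-c, c] `*` ([set x : 'rV[R]_n | forall k, `[-c, c]%classic (x ord0 k)] `*`
   [set x : 'rV[R]_n | forall k, `[-c, c]%classic (x ord0 k)])).
  apply: compact_setX; first exact: segment_compact.
  by apply: compact_setX; apply: (@rV_compact _ _ (fun=> `[-c, c]%classic)) => _; exact: segment_compact.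
apply: (subclosed_compact _ K).
  apply: (@preimage_closed _ _ (fun p : X => `|p|) [set x | x <= c]) => [p _|]; first exact: norm_continuous.
  exact: closed_le.
move=> p /= pc; split => /=; first by rewrite in_itv /= -ler_norml (le_trans (heis_norm_t _)).
split => k /=; rewrite in_itv /= -ler_norml.
  by rewrite (le_trans (heis_norm_x _ _)).
by rewrite (le_trans (heis_norm_y _ _)).
Qed.

Lemma compact_le_rho (c : R) : c <= 1 -> compact [set p | rho p <= c].
Proof.
move=> c1; apply: (subclosed_compact _ (@compact_heis_norm_le 1)).
  apply: (@preimage_closed _ _ rho [set x | x <= c]) => [p _|]; first exact: continuous_rho.
  exact: closed_le.
by move=> p /= pc; apply: heis_ball_norm; exact: le_trans c1.
Qed.

End ball_geometry.

Section integration.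
Context d (T : measurableType d) (R : realType) (mu : {measure set T -> \bar R}).

Lemma bounded_integrable (A : set T) (f : T -> R) (M : R) : measurable A ->
  (mu A < +oo)%E -> measurable_fun A f -> (forall x, A x -> `|f x| <= M) ->
  mu.-integrable A (EFin \o f).
Proof.
move=> mA Afin mf fM; apply: measurable_bounded_integrable => //.
exists M; split; first exact: num_real.
by move=> x Mx y Ay; exact: le_trans (fM y Ay) (ltW Mx).
Qed.

Lemma Rdominated_cvg (D : set T) (f_ : nat -> T -> R) (f g : T -> R) : measurable D ->
  (forall m, measurable_fun D (f_ m)) ->
  (forall x, D x -> f_ m x @[m --> \oo] --> f x) ->
  mu.-integrable D (EFin \o g) -> (forall m x, D x -> `|f_ m x| <= g x) ->
  \int[mu]_(x in D) f_ m x @[m --> \oo] --> \int[mu]_(x in D) f x.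
Proof.
move=> mD mf ff ig fg.
have mff : measurable_fun D f by exact: (measurable_fun_cvg mf).
have fE : forall x, D x -> (f_ m x)%:E @[m --> \oo] --> (f x)%:E.
  by move=> x Dx; apply/fine_cvgP; split; [exact: nearW|exact: ff].
have gE m x : D x -> (`|(f_ m x)%:E| <= (EFin \o g) x)%E by move=> Dx; rewrite lee_fin fg.
have mfE m : measurable_fun D (EFin \o f_ m) by exact/measurable_EFinP.
have := @dominated_cvg _ _ _ mu D mD _ (EFin \o f) (EFin \o g) mfE fE (fun x _ => isT) ig gE.
have fint : mu.-integrable D (EFin \o f).
  apply: le_integrable ig => //; first exact/measurable_EFinP.
  move=> x Dx; rewrite /= lee_fin; apply: (@le_trans _ _ (g x)); last exact: ler_norm.
  have cn : `|f_ m x| @[m --> \oo] --> `|f x| by apply: cvg_norm; exact: ff.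
  rewrite -(cvg_lim _ cn)//; apply: limr_le; first by apply/cvg_ex; exists `|f x|.
  by apply: nearW => m; exact: fg.
move=> H; apply: (fine_cvg (f := fun m => (\int[mu]_(x in D) (f_ m x)%:E)%E)).
by rewrite /Rintegral fineK//; exact: integrable_fin_num.
Qed.

(** Change of variables under a measure-preserving map. *)
Lemma Rintegral_invariant (phi : T -> T) (f : T -> R) :
  measurable_fun setT phi -> (forall A, measurable A -> mu (phi @^-1` A) = mu A) ->
  mu.-integrable setT (EFin \o f) ->
  mu.-integrable setT (EFin \o (f \o phi)) /\
  \int[mu]_(x in setT) f (phi x) = \int[mu]_(x in setT) f x.
Proof.
move=> mphi inv /integrableP[mf fi].
pose m' : {measure set T -> \bar R} :=
  measure_function_pushforward__canonical__measure_function_Measure mu mphi.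
have E g : (\int[mu]_(x in setT) g x = \int[m']_(x in setT) g x)%E.
  by apply: eq_measure_integral => A mA _; rewrite /m' /= /pushforward inv.
have ic : mu.-integrable setT (EFin \o (f \o phi)).
  apply/integrableP; split; first exact: (measurableT_comp mf mphi).
  have := @ge0_integral_pushforward _ _ _ _ R phi mphi mu setT (fun x => `|(f x)%:E|)%E.
  rewrite preimage_setT => <- //.
  - by rewrite -(E (fun x => `|(f x)%:E|)%E).
  - by apply: measurableT_comp => //.
split=> //.
rewrite /Rintegral; congr fine; rewrite [RHS](E (EFin \o f)).
have := @integral_pushforward _ _ _ _ R phi mphi mu setT (EFin \o f) mf.
by rewrite preimage_setT => ->.
Qed.

End integration.

Section translation_derivative.
Context {R : realType} {n : nat}.
Notation X := (heis R n).
Notation MX := (measurableTypeR R * ('rV[R]_n * 'rV[R]_n))%type.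
Notation mu := (heis_vol R n).

Lemma measurable_heis_shift (v : X) : measurable_fun setT ((fun p => p + v) : MX -> MX).
Proof.
apply/measurable_fun_pairP; split.
  by apply: measurable_funD; [exact: measurable_coord_t|exact: measurable_cst].
apply/measurable_fun_pairP; split; apply: measurable_fun_row => k.
  rewrite (_ : _ \o _ = fun p : MX => p.2.1 ord0 k + v.2.1 ord0 k).
    by apply: measurable_funD; [exact: measurable_coord_x|exact: measurable_cst].
  by apply/funext => p; rewrite /= /row_coord mxE.
rewrite (_ : _ \o _ = fun p : MX => p.2.2 ord0 k + v.2.2 ord0 k).
  by apply: measurable_funD; [exact: measurable_coord_y|exact: measurable_cst].
by apply/funext => p; rewrite /= /row_coord mxE.
Qed.

(** The difference quotients of f have integral 0 by translation invariance, and
    are bounded by the mean value theorem: dominated convergence applies. *)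
Lemma integral_derive0 (f g : X -> R) (v : X) (M B : R) :
  continuous f -> continuous g -> (forall p, is_derive p v f (g p)) ->
  (forall p, `|f p| <= M) -> (forall p, `|g p| <= M) ->
  (forall p, B < `|p| -> f p = 0) ->
  \int[mu]_(p in setT) g p = 0.
Proof.
move=> cf cg fg fM gM f0.
pose A : set MX := heis_box 0 (`|B| + `|v| + 1) (`|B| + `|v| + 1).
have mA : measurable A by exact: measurable_heis_box.
have C0 : 0 <= `|B| + `|v| + 1 by rewrite !addr_ge0.
have fA : (mu A < +oo)%E.
  by rewrite /A (heis_vol_box _ C0 C0) ltry.
have outA p : ~ A p -> `|B| + `|v| < `|p|.
  move=> nA; rewrite ltNge; apply/negP => pB; apply: nA; apply: heis_norm_box.
  by rewrite ltr_pwDr.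
have M0 : 0 <= M by apply: le_trans (fM 0).
have gI : mu.-integrable setT (EFin \o (fun p : MX => M * \1_A p)).
  have : mu.-integrable A (EFin \o (fun _ : MX => M)).
    by apply: (@bounded_integrable _ _ _ mu A (fun=> M) `|M|).
  move=> /(integrable_mkcond _ mA).1; apply: eq_integrable => // p _ /=.
  by rewrite patchE indicE; case: ifP; rewrite ?mulr1 ?mulr0.
have integ (k : X -> R) : continuous k -> (forall p, `|k p| <= M) ->
   (forall p, `|B| + `|v| < `|p| -> k p = 0) -> mu.-integrable setT (EFin \o k).
  move=> ck kM k0; apply: le_integrable gI => //.
    by apply/measurable_EFinP; exact: continuous_measurable_heis.
  move=> p _; rewrite /= lee_fin indicE.
  have [pA|pA] := boolP (p \in A); first by rewrite mulr1 (ger0_norm M0).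
  by rewrite k0 ?normr0//; apply: outA => pA'; move: pA; rewrite mem_set.
pose e (m : nat) : R := m.+1%:R^-1.
have e0 m : 0 < e m by rewrite invr_gt0.
have e1 m : e m <= 1 by rewrite invf_le1// ler1n.
pose h m (p : X) := (e m)^-1 * (f (p + e m *: v) - f p).
have cshift m : continuous (fun p : X => f (p + e m *: v)).
  move=> p; apply: (@continuous_comp _ _ _ (fun p : X => p + e m *: v) f); last exact: cf.
  by apply: cvgD; [exact: cvg_id|exact: cvg_cst].
have ch m : continuous (h m).
  move=> p; apply: cvgM; first exact: cvg_cst.
  by apply: cvgB; [exact: cshift|exact: cf].
have hM m p : `|h m p| <= M.
  have dl (x : R) : is_derive x (1 : R) (fun s : R => f (p + s *: v)) (g (p + x *: v)).
    exact: ((is_derive_line f p v x (g (p + x *: v))).1 (fg (p + x *: v))).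
  have [|c _] := @MVT R (fun s : R => f (p + s *: v)) (fun s => g (p + s *: v)) 0 (e m) (e0 m) (fun x _ => dl x).
    by apply: derivable_within_continuous => x _; case: (dl x).
  rewrite scale0r addr0 subr0 => E.
  by rewrite /h E mulrCA mulVf ?gt_eqF// mulr1.
have h0 m p : `|B| + `|v| < `|p| -> h m p = 0.
  move=> Bp; have Bp' : B < `|p|.
    by apply: le_lt_trans Bp; rewrite (le_trans (ler_norm B))// lerDl.
  rewrite /h (f0 _ Bp') f0 ?subrr ?mulr0//.
  apply: (@le_lt_trans _ _ `|B|); first exact: ler_norm.
  apply: (@lt_le_trans _ _ (`|p| - `|e m *: v|)); last exact: lerB_normD.
  rewrite ltrBrDr (le_lt_trans _ Bp)// lerD2l normrZ (gtr0_norm (e0 m)).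
  by rewrite ler_piMl.
have hg p : h m p @[m --> \oo] --> g p.
  have [dv dE] := fg p.
  have H : k^-1 *: ((f \o shift p) (k *: v) - f p) @[k --> 0^'] --> g p.
    by rewrite -dE; exact: dv.
  have ed : e m @[m --> \oo] --> 0^'.
    move=> U [/= r r0 Ur]; suff : \forall m \near \oo, U (e m) by [].
    near=> m; apply: Ur; last exact: lt0r_neq0 (e0 m).
    rewrite /= sub0r normrN (gtr0_norm (e0 m)).
    by near: m; exact: (near_infty_natSinv_lt (PosNum r0)).
  have := cvg_comp _ _ ed H.
  by apply: cvg_trans; apply: near_eq_cvg; apply: nearW => m; rewrite /= /h (addrC p).
have I0 m : \int[mu]_(p in setT) h m p = 0.
  have fI : mu.-integrable setT (EFin \o f).
    apply: integ => // p Bp; apply: f0; apply: le_lt_trans Bp.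
    by rewrite (le_trans (ler_norm B))// lerDl.
  have ms : measurable_fun setT ((fun p => p + e m *: v) : MX -> MX).
    exact: measurable_heis_shift.
  have [sI sE] := Rintegral_invariant ms (@heis_vol_shift R n (e m *: v)) fI.
  rewrite /h RintegralZl//; last exact: (integrableB measurableT sI fI).
  by rewrite RintegralB// sE subrr mulr0.
have := @Rdominated_cvg _ MX R mu setT h g (fun p => M * \1_A p) measurableT.
move=> /(_ _ _ gI) D.
have {}D : \int[mu]_(x in setT) h m x @[m --> \oo] --> \int[mu]_(x in setT) g x.
  apply: D => [m|p _|m p _]; [exact: continuous_measurable_heis|exact: hg|].
  rewrite indicE; have [pA|pA] := boolP (p \in A); first by rewrite mulr1.
  by rewrite h0 ?normr0 ?mulr0//; apply: outA => pA'; move: pA; rewrite mem_set.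
rewrite -(cvg_lim _ D)//; apply: lim_near_cst => //.
by apply: nearW => m; exact: I0.
Unshelve. all: by end_near. Qed.

End translation_derivative.

(** * Complex-valued functions and the operators Lbar *)

Section real_integrable.
Context d (T : measurableType d) (R : realType) (mu : {measure set T -> \bar R}).
Variables (D : set T) (mD : measurable D).
Implicit Types f g : T -> R.

Lemma RintegrableD f g : mu.-integrable D (EFin \o f) -> mu.-integrable D (EFin \o g) ->
  mu.-integrable D (EFin \o (fun x => f x + g x)).
Proof. exact: integrableD. Qed.

Lemma RintegrableB f g : mu.-integrable D (EFin \o f) -> mu.-integrable D (EFin \o g) ->
  mu.-integrable D (EFin \o (fun x => f x - g x)).
Proof. exact: integrableB. Qed.

Lemma RintegrableZ (c : R) f : mu.-integrable D (EFin \o f) ->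
  mu.-integrable D (EFin \o (fun x => c * f x)).
Proof. exact: integrableZl. Qed.

Lemma Rle_integrable f g : measurable_fun D f -> (forall x, D x -> `|f x| <= g x) ->
  mu.-integrable D (EFin \o g) -> mu.-integrable D (EFin \o f).
Proof.
move=> mf fg; apply: le_integrable => //; first exact/measurable_EFinP.
by move=> x Dx; rewrite /= lee_fin (le_trans (fg x Dx))// ler_norm.
Qed.

End real_integrable.

Section complex_parts.
Context {R : realType}.
Notation C := (R[i]).
Local Notation Re := complex.Re.
Local Notation Im := complex.Im.
Implicit Types a b : C.

Lemma ReM a b : Re (a * b) = Re a * Re b - Im a * Im b.
Proof. by case: a b => [? ?] [? ?]. Qed.

Lemma ImM a b : Im (a * b) = Re a * Im b + Im a * Re b.
Proof. by case: a b => [? ?] [? ?]. Qed.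

Lemma ReD a b : Re (a + b) = Re a + Re b. Proof. by case: a b => [? ?] [? ?]. Qed.
Lemma ImD a b : Im (a + b) = Im a + Im b. Proof. by case: a b => [? ?] [? ?]. Qed.
Lemma Re_sum (I : Type) (r : seq I) (P : pred I) (F : I -> C) :
  Re (\sum_(i <- r | P i) F i) = \sum_(i <- r | P i) Re (F i).
Proof. exact: (big_morph _ ReD (erefl _)). Qed.

Lemma Im_sum (I : Type) (r : seq I) (P : pred I) (F : I -> C) :
  Im (\sum_(i <- r | P i) F i) = \sum_(i <- r | P i) Im (F i).
Proof. exact: (big_morph _ ImD (erefl _)). Qed.

Lemma complex_ext a b : Re a = Re b -> Im a = Im b -> a = b.
Proof. by case: a b => [? ?] [? ?] /= -> ->. Qed.

End complex_parts.

Section complex_smooth.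
Context {R : realType} {n : nat}.
Notation X := (heis R n).
Notation C := (R[i]).
Local Notation Re := complex.Re.
Local Notation Im := complex.Im.
Implicit Types (f g : X -> C) (r : X -> R).

Lemma csmooth_cst (c : C) : csmooth (fun _ : X => c).
Proof. by split; exact: smooth_cst. Qed.

Lemma csmoothD f g : csmooth f -> csmooth g -> csmooth (fun p => f p + g p).
Proof.
move=> [rf If] [rg Ig]; split.
  have -> : (fun p => Re (f p + g p)) = (fun p => Re (f p) + Re (g p)) by apply/funext => p; rewrite ReD.
  exact: smoothD.
have -> : (fun p => Im (f p + g p)) = (fun p => Im (f p) + Im (g p)) by apply/funext => p; rewrite ImD.
exact: smoothD.
Qed.

Lemma csmoothM f g : csmooth f -> csmooth g -> csmooth (fun p => f p * g p).
Proof.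
move=> [rf If] [rg Ig]; split.
  have -> : (fun p => Re (f p * g p)) = (fun p => Re (f p) * Re (g p) - Im (f p) * Im (g p)).
    by apply/funext => p; rewrite ReM.
  by apply: smoothB; exact: smoothM.
have -> : (fun p => Im (f p * g p)) = (fun p => Re (f p) * Im (g p) + Im (f p) * Re (g p)).
  by apply/funext => p; rewrite ImM.
by apply: smoothD; exact: smoothM.
Qed.

Lemma csmooth_conj f : csmooth f -> csmooth (fun p => conjc (f p)).
Proof.
move=> [rf If]; split.
  by have -> : (fun p => Re (conjc (f p))) = (fun p => Re (f p)) by apply/funext => p; case: (f p).
have -> : (fun p => Im (conjc (f p))) = (fun p => - Im (f p)) by apply/funext => p; case: (f p).
exact: smoothN.
Qed.

Lemma csmooth_sum (I : Type) (s : seq I) (P : pred I) (F : I -> X -> C) :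
  (forall i, P i -> csmooth (F i)) -> csmooth (fun p => \sum_(i <- s | P i) F i p).
Proof.
move=> sF; split.
  have -> : (fun p => Re (\sum_(i <- s | P i) F i p)) = (fun p => \sum_(i <- s | P i) Re (F i p)).
    by apply/funext => p; rewrite Re_sum.
  by apply: smooth_sum => i /sF[].
have -> : (fun p => Im (\sum_(i <- s | P i) F i p)) = (fun p => \sum_(i <- s | P i) Im (F i p)).
  by apply/funext => p; rewrite Im_sum.
by apply: smooth_sum => i /sF[].
Qed.

Lemma csmooth_real r : smooth r -> csmooth (fun p => Complex (r p) 0).
Proof. by move=> sr; split => //=; exact: smooth_cst. Qed.

Lemma csmooth_zcoord k : csmooth (fun p : X => zcoord p k).
Proof. by split; [exact: smooth_x|exact: smooth_y]. Qed.

Lemma smooth_derivable r v p : smooth r -> derivable r p v.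
Proof. by move=> sr; exact: ((sr 1).2 v).1. Qed.

Lemma smooth_derive r v : smooth r -> smooth (fun p => 'D_v r p).
Proof. by move=> sr k; exact: ((sr k.+1).2 v).2. Qed.

Lemma cderiveD f g v p : csmooth f -> csmooth g ->
  cderive v (fun q => f q + g q) p = cderive v f p + cderive v g p.
Proof.
move=> [rf If] [rg Ig]; rewrite /cderive.
have -> : (fun q => Re (f q + g q)) = (fun q => Re (f q) + Re (g q)) by apply/funext => q; rewrite ReD.
have -> : (fun q => Im (f q + g q)) = (fun q => Im (f q) + Im (g q)) by apply/funext => q; rewrite ImD.
by rewrite !deriveD//; exact: smooth_derivable.
Qed.

Lemma cderiveM f g v p : csmooth f -> csmooth g ->
  cderive v (fun q => f q * g q) p = cderive v f p * g p + f p * cderive v g p.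
Proof.
move=> [rf If] [rg Ig]; rewrite /cderive.
have -> : (fun q => Re (f q * g q)) = (fun q => Re (f q) * Re (g q) - Im (f q) * Im (g q)).
  by apply/funext => q; rewrite ReM.
have -> : (fun q => Im (f q * g q)) = (fun q => Re (f q) * Im (g q) + Im (f q) * Re (g q)).
  by apply/funext => q; rewrite ImM.
have d1 := @smooth_derivable _ v p rf; have d2 := @smooth_derivable _ v p If.
have d3 := @smooth_derivable _ v p rg; have d4 := @smooth_derivable _ v p Ig.
rewrite (deriveB (derivableM d1 d3) (derivableM d2 d4)).
rewrite (deriveD (derivableM d1 d4) (derivableM d2 d3)).
rewrite (deriveM d1 d3) (deriveM d2 d4) (deriveM d1 d4) (deriveM d2 d3).
move: ('D_v _ p) ('D_v _ p) ('D_v _ p) ('D_v _ p) => a b c d.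
by case: (f p) (g p) => [x y] [z t] /=; apply: complex_ext => /=; rewrite /GRing.scale /=; ring.
Qed.

Lemma cderive_cst (c : C) v p : cderive v (fun _ : X => c) p = 0.
Proof. by rewrite /cderive !derive_cst. Qed.

Lemma LbarD k f g p : csmooth f -> csmooth g ->
  Lbar k (fun q => f q + g q) p = Lbar k f p + Lbar k g p.
Proof.
move=> sf sg; have D v := @cderiveD _ _ v p sf sg; rewrite /Lbar /d_zbar !D.
move: (2%:R^-1 : C) (Complex 0 1 : C) (zcoord p k) (cderive (dir_x k) f p) (cderive (dir_y k) f p)
  (cderive dir_t f p) (cderive (dir_x k) g p) (cderive (dir_y k) g p) (cderive dir_t g p).
by move=> *; ring.
Qed.

Lemma LbarM k f g p : csmooth f -> csmooth g ->
  Lbar k (fun q => f q * g q) p = Lbar k f p * g p + f p * Lbar k g p.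
Proof.
move=> sf sg; have D v := @cderiveM _ _ v p sf sg; rewrite /Lbar /d_zbar !D.
move: (2%:R^-1 : C) (Complex 0 1 : C) (zcoord p k) (cderive (dir_x k) f p) (cderive (dir_y k) f p)
  (cderive dir_t f p) (cderive (dir_x k) g p) (cderive (dir_y k) g p) (cderive dir_t g p) (f p) (g p).
by move=> *; ring.
Qed.

Lemma Lbar_cst k (c : C) p : Lbar k (fun _ : X => c) p = 0.
Proof. by rewrite /Lbar /d_zbar !cderive_cst !mulr0 addr0 mulr0 subr0. Qed.

Lemma LbarZ k (c : C) f p : csmooth f -> Lbar k (fun q => c * f q) p = c * Lbar k f p.
Proof. by move=> sf; rewrite (LbarM _ _ (csmooth_cst c) sf) Lbar_cst mul0r add0r. Qed.

Lemma Lbar_sum k (I : Type) (s : seq I) (P : pred I) (F : I -> X -> C) p :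
  (forall i, P i -> csmooth (F i)) ->
  Lbar k (fun q => \sum_(i <- s | P i) F i q) p = \sum_(i <- s | P i) Lbar k (F i) p.
Proof.
move=> sF; elim: s => [|i s IH].
  have -> : (fun q => \sum_(i <- [::] | P i) F i q) = fun=> 0 by apply/funext => q; rewrite big_nil.
  by rewrite Lbar_cst big_nil.
have -> : (fun q => \sum_(j <- i :: s | P j) F j q) =
    fun q => if P i then F i q + \sum_(j <- s | P j) F j q else \sum_(j <- s | P j) F j q.
  by apply/funext => q; rewrite big_cons.
rewrite big_cons; case: (boolP (P i)) => Pi; last exact: IH.
by rewrite LbarD ?IH//; [exact: sF|exact: csmooth_sum].
Qed.

Lemma csmooth_Lbar k f : csmooth f -> csmooth (Lbar k f).
Proof.
move=> [rf If]; have cd v : csmooth (cderive v f) by split; exact: smooth_derive.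
apply: csmoothD.
  apply: csmoothM; first exact: csmooth_cst.
  by apply: csmoothD => //; apply: csmoothM => //; exact: csmooth_cst.
have -> : (fun p => - (Complex 0 1 * zcoord p k * cderive dir_t f p)) =
   (fun p => - Complex 0 1 * (zcoord p k * cderive dir_t f p)).
  by apply/funext => p; rewrite mulNr mulrA.
apply: csmoothM; first exact: csmooth_cst.
by apply: csmoothM => //; exact: csmooth_zcoord.
Qed.

Let derive_coord (r l : X -> R) v p :
  (forall (h : R) v p, r (h *: v + p) = r p + h * l v) -> 'D_v r p = l v.
Proof. by move=> H; have [] := is_derive_affine (fun h => H h v p). Qed.

Lemma Lbar_zcoord k j p : Lbar k (fun q : X => zcoord q j) p = 0.
Proof.
rewrite /Lbar /d_zbar /cderive /zcoord /=.
have dx v q : 'D_v (fun q : X => q.2.1 ord0 j) q = v.2.1 ord0 j.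
  by apply: (@derive_coord _ (fun v : X => v.2.1 ord0 j)) => h w s /=; rewrite !mxE addrC.
have dy v q : 'D_v (fun q : X => q.2.2 ord0 j) q = v.2.2 ord0 j.
  by apply: (@derive_coord _ (fun v : X => v.2.2 ord0 j)) => h w s /=; rewrite !mxE addrC.
rewrite !dx !dy /= !mxE /=; apply: complex_ext => /=; ring.
Qed.

Lemma Lbar_zcoord_conj k j p : Lbar k (fun q : X => conjc (zcoord q j)) p = (k == j)%:R.
Proof.
rewrite /Lbar /d_zbar /cderive /zcoord /=.
have dx v q : 'D_v (fun q : X => q.2.1 ord0 j) q = v.2.1 ord0 j.
  by apply: (@derive_coord _ (fun v : X => v.2.1 ord0 j)) => h w s /=; rewrite !mxE addrC.
have dy v q : 'D_v (fun q : X => - q.2.2 ord0 j) q = - v.2.2 ord0 j.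
  by apply: (@derive_coord _ (fun v : X => - v.2.2 ord0 j)) => h w s /=; rewrite !mxE; ring.
rewrite !dx !dy /= !mxE /= [j == k]eq_sym; by case: eqP => _ /=; apply: complex_ext => /=; field.
Qed.

End complex_smooth.

Section compact_support.
Context {R : realType} {n : nat}.
Notation X := (heis R n).
Notation MX := (measurableTypeR R * ('rV[R]_n * 'rV[R]_n))%type.
Notation C := (R[i]).
Notation mu := (heis_vol R n).
Local Notation Omega := (@heis_ball R n).
Local Notation Re := complex.Re.
Local Notation Im := complex.Im.

(** Smooth real functions with compact support in the interior of the ball. *)
Definition real_test (f : X -> R) : Prop :=
  smooth f /\ exists K : set X, [/\ compact K, K `<=` Omega° & forall p, ~ K p -> f p = 0].

Lemma test_functionP (phi : X -> C) : test_function phi ->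
  real_test (fun p => Re (phi p)) /\ real_test (fun p => Im (phi p)).
Proof.
move=> [[rp ip] [K [cK KO K0]]]; split; split=> //; exists K; split=> // p Kp; by rewrite K0.
Qed.

Lemma test_functionMl (f phi : X -> C) : csmooth f -> test_function phi ->
  test_function (fun p => f p * phi p).
Proof.
move=> sf [sp [K [cK KO K0]]]; split; first exact: csmoothM.
by exists K; split => // p Kp; rewrite K0// mulr0.
Qed.

Lemma real_testM (f g : X -> R) : smooth f -> real_test g -> real_test (fun p => f p * g p).
Proof.
move=> sf [sg [K [cK KO K0]]]; split; first exact: smoothM.
by exists K; split => // p Kp; rewrite K0// mulr0.
Qed.

Lemma real_test_out (f : X -> R) p : real_test f -> ~ Omega p -> f p = 0.
Proof.
move=> [sf [K [cK KO K0]]] Op; apply: K0 => Kp; apply: Op.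
exact: (interior_subset (KO _ Kp)).
Qed.

Lemma real_test_derive (f : X -> R) v : real_test f -> real_test (fun p => 'D_v f p).
Proof.
move=> [sf [K [cK KO K0]]]; split; first exact: smooth_derive.
exists K; split => // p Kp.
have oK : open (~` K) by apply: closed_openC; apply: compact_closed => //; exact: norm_hausdorff.
rewrite (@near_eq_derive _ _ _ f (cst 0)) ?derive_cst//.
apply: (@filterS _ (nbhs p) _ (~` K)); last exact: open_nbhs_nbhs.
by move=> q /K0.
Qed.

Lemma continuous_ball_bounded (f : X -> R) : continuous f ->
  exists2 M : R, 0 <= M & forall p, Omega p -> `|f p| <= M.
Proof.
move=> cf.
have : compact (f @` [set p | `|p| <= 1]).
  apply: continuous_compact; last exact: compact_heis_norm_le.
  exact: continuous_subspaceT.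
move=> /compact_bounded[M [_ HM]]; exists (`|M| + 1); first by rewrite addr_ge0.
move=> p /heis_ball_norm p1; apply: (HM (`|M| + 1)); last by exists p.
by rewrite (le_lt_trans (ler_norm M))// ltrDl.
Qed.

Lemma continuous_ball_integrable (f : X -> R) : continuous f ->
  mu.-integrable (Omega : set MX) (EFin \o f).
Proof.
move=> cf; have [M _ HM] := continuous_ball_bounded cf.
apply: (@bounded_integrable _ _ _ mu _ _ M) => //; first exact: measurable_heis_ball.
  exact: heis_vol_ball_lty.
apply: measurable_funTS; exact: continuous_measurable_heis.
Qed.

Lemma smooth_ball_integrable (f : X -> R) : smooth f -> mu.-integrable (Omega : set MX) (EFin \o f).
Proof. by move=> /smooth_continuous; exact: continuous_ball_integrable. Qed.

Lemma real_test_integral (f : X -> R) v : real_test f ->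
  \int[mu]_(p in Omega) ('D_v f p) = 0.
Proof.
move=> tf; have sf := tf.1.
have tg := real_test_derive v tf.
rewrite Rintegral_mkcond.
have -> : (fun p => 'D_v f p) \_ Omega = (fun p => 'D_v f p).
  apply/funext => p; rewrite patchE; case: (boolP (p \in Omega)) => // pO.
  by rewrite (real_test_out tg)// => Op; move: pO; rewrite mem_set.
have [M1 M10 H1] := continuous_ball_bounded (smooth_continuous sf).
have [M2 M20 H2] := continuous_ball_bounded (smooth_continuous tg.1).
have glob (M : R) (h : X -> R) : 0 <= M -> real_test h -> (forall p, Omega p -> `|h p| <= M) ->
    forall p, `|h p| <= M.
  move=> M0 th HM p; have [Op|Op] := pselect (Omega p); first exact: HM.
  by rewrite (real_test_out th Op) normr0.
apply: (@integral_derive0 _ _ f _ v (M1 + M2) 1).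
- exact: smooth_continuous.
- exact: smooth_continuous tg.1.
- by move=> p; exact/derivableP/smooth_derivable.
- by move=> p; rewrite (le_trans (glob _ _ M10 tf H1 p))// lerDl.
- by move=> p; rewrite (le_trans (glob _ _ M20 tg H2 p))// lerDr.
- move=> p p1; rewrite (real_test_out tf)// => /heis_ball_norm.
  by rewrite leNgt p1.
Qed.

(** Integration by parts: as z_k does not depend on t, both parts of [Lbar k F] are
    linear combinations of derivatives of real test functions. *)
Lemma cintegral_Lbar_test k (F : X -> C) : test_function F -> cintegral (Lbar k F) = 0.
Proof.
move=> tF; have [ta tb] := test_functionP tF.
set a := (fun p => Re (F p)) in ta *; set b := (fun p => Im (F p)) in tb *.
have sx := @smooth_x R n k; have sy := @smooth_y R n k.
(* The coefficients x_k and y_k can be moved inside the t-derivative. *)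
have dtx (f : X -> R) p : smooth f ->
    'D_dir_t (fun q : X => q.2.1 ord0 k * f q) p = p.2.1 ord0 k * 'D_dir_t f p.
  move=> sf; rewrite (deriveM (@smooth_derivable _ _ _ dir_t p sx) (@smooth_derivable _ _ _ dir_t p sf)).
  have [_ ->] : is_derive p dir_t (fun q : X => q.2.1 ord0 k) 0.
    by apply: is_derive_affine => h; rewrite /= !mxE; ring.
  by rewrite scaler0 addr0.
have dty (f : X -> R) p : smooth f ->
    'D_dir_t (fun q : X => q.2.2 ord0 k * f q) p = p.2.2 ord0 k * 'D_dir_t f p.
  move=> sf; rewrite (deriveM (@smooth_derivable _ _ _ dir_t p sy) (@smooth_derivable _ _ _ dir_t p sf)).
  have [_ ->] : is_derive p dir_t (fun q : X => q.2.2 ord0 k) 0.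
    by apply: is_derive_affine => h; rewrite /= !mxE; ring.
  by rewrite scaler0 addr0.
have Icomb (c1 c2 c3 c4 : R) (f1 f2 f3 f4 : X -> R) v1 v2 v3 v4 :
    real_test f1 -> real_test f2 -> real_test f3 -> real_test f4 ->
    \int[mu]_(p in Omega) (c1 * 'D_v1 f1 p + c2 * 'D_v2 f2 p + (c3 * 'D_v3 f3 p + c4 * 'D_v4 f4 p)) = 0.
  move=> t1 t2 t3 t4.
  have I c f v : real_test f -> mu.-integrable (Omega : set MX) (EFin \o (fun p => c * 'D_v f p)).
    move=> tf; apply: smooth_ball_integrable; apply: smoothM; first exact: smooth_cst.
    exact: (real_test_derive v tf).1.
  have Z c f v : real_test f -> \int[mu]_(p in Omega) (c * 'D_v f p) = 0.
    move=> tf; rewrite RintegralZl ?real_test_integral ?mulr0//; first exact: measurable_heis_ball.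
    exact: smooth_ball_integrable (real_test_derive v tf).1.
  have mO := @measurable_heis_ball R n.
  rewrite RintegralD//; last 2 first.
    by apply: RintegrableD => //; exact: I.
    by apply: RintegrableD => //; exact: I.
  rewrite !RintegralD ?Z ?addr0//; exact: I.
have hE : (2%:R^-1 : C) = Complex 2^-1 0 by apply: complex_ext => /=; field.
have algR (ax ay at_ bx by_ bt x y : R) : Re (2%:R^-1 * (Complex ax bx + Complex 0 1 * Complex ay by_) -
    Complex 0 1 * Complex x y * Complex at_ bt) =
    2^-1 * ax + - 2^-1 * by_ + (1 * (x * bt) + 1 * (y * at_)).
  by rewrite hE /=; ring.
have algI (ax ay at_ bx by_ bt x y : R) : Im (2%:R^-1 * (Complex ax bx + Complex 0 1 * Complex ay by_) -
    Complex 0 1 * Complex x y * Complex at_ bt) =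
    2^-1 * bx + 2^-1 * ay + (- 1 * (x * at_) + 1 * (y * bt)).
  by rewrite hE /=; ring.
apply: complex_ext.
  rewrite -[RHS](Icomb 2^-1 (- 2^-1) 1 1 a b (fun q : X => q.2.1 ord0 k * b q) (fun q : X => q.2.2 ord0 k * a q)
    (dir_x k) (dir_y k) dir_t dir_t)//; try exact: real_testM.
  apply: eq_Rintegral => p _; rewrite dtx ?dty; [|exact: ta.1|exact: tb.1].
  exact: algR.
rewrite -[RHS](Icomb 2^-1 2^-1 (- 1) 1 b a (fun q : X => q.2.1 ord0 k * a q) (fun q : X => q.2.2 ord0 k * b q)
  (dir_x k) (dir_y k) dir_t dir_t)//; try exact: real_testM.
apply: eq_Rintegral => p _; rewrite dtx ?dty; [|exact: tb.1|exact: ta.1].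
exact: algI.
Qed.

End compact_support.

(** * Square-integrable forms and the energy estimate *)

Section L2.
Context {R : realType} {n : nat}.
Notation X := (heis R n).
Notation MX := (measurableTypeR R * ('rV[R]_n * 'rV[R]_n))%type.
Notation C := (R[i]).
Notation mu := (heis_vol R n).
Local Notation Omega := (@heis_ball R n).
Local Notation Re := complex.Re.
Local Notation Im := complex.Im.
Notation integrable_on f := (mu.-integrable (Omega : set MX) (EFin \o f)).

Let mO : measurable (Omega : set MX) := @measurable_heis_ball R n.

(** Integrability on the ball of a complex-valued function. *)
Definition cintegrable (h : X -> C) : Prop :=
  integrable_on (fun p => Re (h p)) /\ integrable_on (fun p => Im (h p)).

Lemma cintegralD (f g : X -> C) : cintegrable f -> cintegrable g ->
  cintegral (fun p => f p + g p) = cintegral f + cintegral g.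
Proof.
move=> [rf If] [rg Ig]; rewrite /cintegral; apply: complex_ext => /=.
  by rewrite -RintegralD//; apply: eq_Rintegral => p _; rewrite ReD.
by rewrite -RintegralD//; apply: eq_Rintegral => p _; rewrite ImD.
Qed.

Lemma cintegrableD (f g : X -> C) : cintegrable f -> cintegrable g ->
  cintegrable (fun p => f p + g p).
Proof.
move=> [rf If] [rg Ig]; split.
  have -> : (fun p => Re (f p + g p)) = (fun p => Re (f p) + Re (g p)) by apply/funext => p; rewrite ReD.
  exact: RintegrableD.
have -> : (fun p => Im (f p + g p)) = (fun p => Im (f p) + Im (g p)) by apply/funext => p; rewrite ImD.
exact: RintegrableD.
Qed.

Lemma cintegrable0 : cintegrable (fun=> 0).
Proof. by split; exact: (smooth_ball_integrable (smooth_cst 0)). Qed.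

Lemma cintegral0 : cintegral (fun _ : X => 0) = 0.
Proof. by apply: complex_ext; rewrite /= Rintegral_cst ?mul0r. Qed.

Lemma cintegralZ (c : C) (f : X -> C) : cintegrable f ->
  cintegral (fun p => c * f p) = c * cintegral f.
Proof.
move=> [rf If]; rewrite /cintegral; apply: complex_ext.
  rewrite ReM /= -!RintegralZl// -RintegralB//; [|exact: RintegrableZ..].
  by apply: eq_Rintegral => p _; rewrite ReM.
rewrite ImM /= -!RintegralZl// -RintegralD//; [|exact: RintegrableZ..].
by apply: eq_Rintegral => p _; rewrite ImM.
Qed.

Lemma cintegrableZ (c : C) (f : X -> C) : cintegrable f -> cintegrable (fun p => c * f p).
Proof.
move=> [rf If]; split.
  have -> : (fun p => Re (c * f p)) = (fun p => Re c * Re (f p) - Im c * Im (f p)).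
    by apply/funext => p; rewrite ReM.
  by apply: RintegrableB => //; exact: RintegrableZ.
have -> : (fun p => Im (c * f p)) = (fun p => Re c * Im (f p) + Im c * Re (f p)).
  by apply/funext => p; rewrite ImM.
by apply: RintegrableD => //; exact: RintegrableZ.
Qed.

Lemma cintegrable_sum (I : Type) (s : seq I) (P : pred I) (F : I -> X -> C) :
  (forall i, P i -> cintegrable (F i)) -> cintegrable (fun p => \sum_(i <- s | P i) F i p).
Proof.
move=> iF; elim: s => [|i s IH].
  have -> : (fun p => \sum_(i <- [::] | P i) F i p) = fun=> 0 by apply/funext => q; rewrite big_nil.
  exact: cintegrable0.
have -> : (fun q => \sum_(j <- i :: s | P j) F j q) =
    fun q => if P i then F i q + \sum_(j <- s | P j) F j q else \sum_(j <- s | P j) F j q.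
  by apply/funext => q; rewrite big_cons.
by case: (boolP (P i)) => Pi //; apply: cintegrableD => //; exact: iF.
Qed.

Lemma cintegral_sum (I : Type) (s : seq I) (P : pred I) (F : I -> X -> C) :
  (forall i, P i -> cintegrable (F i)) ->
  cintegral (fun p => \sum_(i <- s | P i) F i p) = \sum_(i <- s | P i) cintegral (F i).
Proof.
move=> iF; elim: s => [|i s IH].
  have -> : (fun p => \sum_(i <- [::] | P i) F i p) = fun=> 0 by apply/funext => q; rewrite big_nil.
  by rewrite cintegral0 big_nil.
have -> : (fun q => \sum_(j <- i :: s | P j) F j q) =
    fun q => if P i then F i q + \sum_(j <- s | P j) F j q else \sum_(j <- s | P j) F j q.
  by apply/funext => q; rewrite big_cons.
rewrite big_cons; case: (boolP (P i)) => Pi //; rewrite cintegralD ?IH//; first exact: iF.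
exact: cintegrable_sum.
Qed.

Lemma L2fun_sq_integrable (f : X -> C) : L2fun f ->
  integrable_on (fun p => Re (f p) ^+ 2 + Im (f p) ^+ 2).
Proof.
move=> [mr mi fi]; apply/integrableP; split.
  by apply/measurable_EFinP; apply: measurable_funD; exact: measurable_funX.
rewrite (eq_integral (fun p : MX => (Re (f p) ^+ 2 + Im (f p) ^+ 2)%:E))// => p _.
by rewrite /= ger0_norm// addr_ge0// sqr_ge0.
Qed.

Lemma sq_integrable_L2fun (f : X -> C) :
  measurable_fun (Omega : set MX) (fun p => Re (f p)) ->
  measurable_fun (Omega : set MX) (fun p => Im (f p)) ->
  integrable_on (fun p => Re (f p) ^+ 2 + Im (f p) ^+ 2) -> L2fun f.
Proof.
move=> mr mi /integrableP[_ fi]; split => //.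
rewrite (eq_integral (fun p : MX => `|(Re (f p) ^+ 2 + Im (f p) ^+ 2)%:E|%E))// => p _.
by rewrite /= ger0_norm// addr_ge0// sqr_ge0.
Qed.

(** The pointwise real inner product of complex numbers seen as vectors of R^2. *)
Definition cdot (a b : C) : R := Re a * Re b + Im a * Im b.

Lemma cdot_le (a b : C) : `|cdot a b| <= (Re a ^+ 2 + Im a ^+ 2) + (Re b ^+ 2 + Im b ^+ 2).
Proof.
case: a b => [a1 a2] [b1 b2]; rewrite /cdot /= ler_norml; apply/andP; split; last first.
  rewrite -subr_ge0.
  have -> : a1 ^+ 2 + a2 ^+ 2 + (b1 ^+ 2 + b2 ^+ 2) - (a1 * b1 + a2 * b2) =
    ((a1 - b1) ^+ 2 + (a2 - b2) ^+ 2 + (a1 ^+ 2 + a2 ^+ 2 + b1 ^+ 2 + b2 ^+ 2)) / 2 by field.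
  by rewrite divr_ge0// !addr_ge0// sqr_ge0.
rewrite -subr_ge0.
have -> : a1 * b1 + a2 * b2 - - (a1 ^+ 2 + a2 ^+ 2 + (b1 ^+ 2 + b2 ^+ 2)) =
  ((a1 + b1) ^+ 2 + (a2 + b2) ^+ 2 + (a1 ^+ 2 + a2 ^+ 2 + b1 ^+ 2 + b2 ^+ 2)) / 2 by field.
by rewrite divr_ge0// !addr_ge0// sqr_ge0.
Qed.

Lemma L2fun_cdot_integrable (f g : X -> C) : L2fun f -> L2fun g ->
  integrable_on (fun p => cdot (f p) (g p)).
Proof.
move=> lf lg; have [rf If _] := lf; have [rg Ig _] := lg.
apply: (Rle_integrable mO _ _ (RintegrableD mO (L2fun_sq_integrable lf) (L2fun_sq_integrable lg))).
  by apply: measurable_funD; exact: measurable_funM.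
by move=> p _; exact: cdot_le.
Qed.

Lemma L2fun_conj (f : X -> C) : L2fun f -> L2fun (fun p => conjc (f p)).
Proof.
move=> lf; have [rf If _] := lf.
have e1 p : Re (conjc (f p)) = Re (f p) by case: (f p).
have e2 p : Im (conjc (f p)) = - Im (f p) by case: (f p).
apply: sq_integrable_L2fun.
- by under eq_fun do rewrite e1.
- by under eq_fun do rewrite e2; exact: measurableT_comp.
- under eq_fun do rewrite e1 e2 sqrrN; exact: L2fun_sq_integrable.
Qed.

Lemma L2fun_Mi (f : X -> C) : L2fun f -> L2fun (fun p => Complex 0 1 * f p).
Proof.
move=> lf; have [rf If _] := lf.
have e1 p : Re (Complex 0 1 * f p) = - Im (f p) by rewrite ReM /=; ring.
have e2 p : Im (Complex 0 1 * f p) = Re (f p) by rewrite ImM /=; ring.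
apply: sq_integrable_L2fun.
- by under eq_fun do rewrite e1; exact: measurableT_comp.
- by under eq_fun do rewrite e2.
- under eq_fun do rewrite e1 e2 sqrrN addrC; exact: L2fun_sq_integrable.
Qed.

Lemma L2fun_cintegrableM (f g : X -> C) : L2fun f -> L2fun g -> cintegrable (fun p => f p * g p).
Proof.
move=> lf lg; split.
  have -> : (fun p => Re (f p * g p)) = (fun p => cdot (f p) (conjc (g p))).
    by apply/funext => p; rewrite ReM /cdot; case: (g p) => a b /=; ring.
  exact: L2fun_cdot_integrable (L2fun_conj lg).
have -> : (fun p => Im (f p * g p)) = (fun p => cdot (f p) (Complex 0 1 * conjc (g p))).
  by apply/funext => p; rewrite ImM /cdot ReM ImM; case: (g p) => a b /=; ring.
exact: L2fun_cdot_integrable (L2fun_Mi (L2fun_conj lg)).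
Qed.

Lemma L2funD (f g : X -> C) : L2fun f -> L2fun g -> L2fun (fun p => f p + g p).
Proof.
move=> lf lg; have [rf If _] := lf; have [rg Ig _] := lg.
have e1 p : Re (f p + g p) = Re (f p) + Re (g p) by rewrite ReD.
have e2 p : Im (f p + g p) = Im (f p) + Im (g p) by rewrite ImD.
apply: sq_integrable_L2fun.
- by under eq_fun do rewrite e1; exact: measurable_funD.
- by under eq_fun do rewrite e2; exact: measurable_funD.
- apply: (Rle_integrable mO _ _ (RintegrableZ mO 2 (RintegrableD mO (L2fun_sq_integrable lf) (L2fun_sq_integrable lg)))).
    under eq_fun do rewrite e1 e2.
    by apply: measurable_funD; apply: measurable_funX; exact: measurable_funD.
  move=> p _; rewrite e1 e2 ger0_norm ?addr_ge0 ?sqr_ge0// -subr_ge0.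
  set a := Re (f p); set b := Im (f p); set c := Re (g p); set e := Im (g p).
  have -> : 2 * (a ^+ 2 + b ^+ 2 + (c ^+ 2 + e ^+ 2)) - ((a + c) ^+ 2 + (b + e) ^+ 2) =
    (a - c) ^+ 2 + (b - e) ^+ 2 by ring.
  by rewrite addr_ge0// sqr_ge0.
Qed.

Lemma csmooth_L2fun (f : X -> C) : csmooth f -> L2fun f.
Proof.
move=> [rf If]; apply: sq_integrable_L2fun.
- by apply: measurable_funTS; exact: (continuous_measurable_heis (smooth_continuous rf)).
- by apply: measurable_funTS; exact: (continuous_measurable_heis (smooth_continuous If)).
- by apply: smooth_ball_integrable; apply: smoothD; exact: smoothX.
Qed.

Lemma L2fun0 : L2fun (fun _ : X => 0 : C).
Proof. by apply: csmooth_L2fun; exact: csmooth_cst. Qed.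

Lemma L2funN (f : X -> C) : L2fun f -> L2fun (fun p => -1 * f p).
Proof.
move=> lf; have [rf If _] := lf.
have e1 p : Re (-1 * f p) = - Re (f p) by rewrite ReM /=; ring.
have e2 p : Im (-1 * f p) = - Im (f p) by rewrite ImM /=; ring.
apply: sq_integrable_L2fun.
- by under eq_fun do rewrite e1; exact: measurableT_comp.
- by under eq_fun do rewrite e2; exact: measurableT_comp.
- under eq_fun do rewrite e1 e2 !sqrrN; exact: L2fun_sq_integrable.
Qed.

(** The real part of the inner product of forms. *)
Definition rinner (f g : heis_form R n) : R := Re (inner f g).

(** Forms of arbitrary, possibly mixed, degree with square-integrable coefficients. *)
Definition formL2 (f : heis_form R n) : Prop := forall J, L2fun (f J).

Lemma L2form_formL2 q (f : heis_form R n) : L2form q f -> formL2 f.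
Proof. by case. Qed.

(** The real part of the pointwise inner product. *)
Definition fdot (f g : heis_form R n) (p : X) : R := \sum_(J : {set 'I_n}) cdot (f J p) (g J p).

Lemma rinnerE (f g : heis_form R n) : rinner f g = \int[mu]_(p in Omega) fdot f g p.
Proof.
rewrite /rinner /inner /=; apply: eq_Rintegral => p _; rewrite Re_sum; apply: eq_bigr => J _.
by rewrite ReM /cdot; case: (g J p) => a b /=; ring.
Qed.

Lemma Rintegrable_sum (I : Type) (s : seq I) (F : I -> X -> R) :
  (forall i, integrable_on (F i)) -> integrable_on (fun p => \sum_(i <- s) F i p).
Proof.
move=> iF; elim: s => [|i s IH].
  have -> : (fun p => \sum_(i <- [::]) F i p) = fun=> 0 by apply/funext => q; rewrite big_nil.
  exact: cintegrable0.1.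
have -> : (fun q => \sum_(j <- i :: s) F j q) = fun q => F i q + \sum_(j <- s) F j q.
  by apply/funext => q; rewrite big_cons.
exact: RintegrableD.
Qed.

Lemma Rintegral_sum_ball (I : Type) (r : seq I) (F : I -> X -> R) :
  (forall i, integrable_on (F i)) ->
  \int[mu]_(p in Omega) (\sum_(i <- r) F i p) = \sum_(i <- r) \int[mu]_(p in Omega) F i p.
Proof.
move=> iF; elim: r => [|i r IH].
  rewrite big_nil (_ : (fun p => _) = fun=> 0) ?Rintegral_cst ?mul0r//.
  by apply/funext => p; rewrite big_nil.
rewrite big_cons -IH -RintegralD//; last exact: Rintegrable_sum.
by apply: eq_Rintegral => p _; rewrite big_cons.
Qed.

Lemma fdot_integrable (f g : heis_form R n) : formL2 f -> formL2 g -> integrable_on (fdot f g).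
Proof. by move=> lf lg; apply: Rintegrable_sum => J; exact: L2fun_cdot_integrable. Qed.

Lemma formL2D (f g : heis_form R n) : formL2 f -> formL2 g -> formL2 (fun J p => f J p + g J p).
Proof. by move=> lf lg J; exact: L2funD. Qed.

Lemma rinner_sym (f g : heis_form R n) : rinner f g = rinner g f.
Proof.
rewrite !rinnerE; apply: eq_Rintegral => p _; apply: eq_bigr => J _.
by rewrite /cdot; ring.
Qed.

Lemma rinner_ge0 (f : heis_form R n) : 0 <= rinner f f.
Proof.
rewrite rinnerE; apply: Rintegral_ge0 => p _; apply: sumr_ge0 => J _.
by rewrite /cdot addr_ge0// -expr2 sqr_ge0.
Qed.

Lemma rinnerDr (f g h : heis_form R n) : formL2 f -> formL2 g -> formL2 h ->
  rinner f (fun J p => g J p + h J p) = rinner f g + rinner f h.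
Proof.
move=> lf lg lh; rewrite !rinnerE -RintegralD//; [|exact: fdot_integrable..].
apply: eq_Rintegral => p _; rewrite -big_split /=; apply: eq_bigr => J _.
by rewrite /cdot ReD ImD; ring.
Qed.

Lemma fdot_measurable (f g : heis_form R n) : formL2 f -> formL2 g ->
  measurable_fun (Omega : set MX) (fdot f g).
Proof.
move=> lf lg; have /integrableP[mf _] := fdot_integrable lf lg.
exact/measurable_EFinP.
Qed.

Lemma rinner_ae (f f' g g' : heis_form R n) : formL2 f -> formL2 f' -> formL2 g -> formL2 g' ->
  form_ae_eq f f' -> form_ae_eq g g' -> rinner f g = rinner f' g'.
Proof.
move=> lf lf' lg lg' ff' gg'; rewrite !rinnerE; congr fine.
apply: ae_eq_integral => //.
- by apply/measurable_EFinP; exact: fdot_measurable.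
- by apply/measurable_EFinP; exact: fdot_measurable.
have F : Filter (almost_everywhere mu) by exact: (ae_filter_ringOfSetsType mu).
have H J : {ae mu, forall p, Omega p -> f J p = f' J p /\ g J p = g' J p}.
  apply: (@filterS2 _ _ F _ _ _ _ (ff' J) (gg' J)) => p h1 h2 Op; split; [exact: h1|exact: h2].
pose P k (p : MX) := if unpickle k is Some J then Omega p -> f J p = f' J p /\ g J p = g' J p else True.
have HP k : {ae mu, forall p, P k p}.
  by rewrite /P; case: (unpickle k) => [J|]; [exact: H|exact: aeW].
apply: (@filterS _ _ F _ _ _ (ae_foralln HP)) => p Hp Op /=; congr EFin; apply: eq_bigr => J _.
by have := Hp (pickle J); rewrite /P pickleK => /(_ Op)[-> ->].
Qed.

(** The right-hand side is the squared norm of s f + t g. *)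
Lemma rinner_quadratic (f g : heis_form R n) (s t : R) : formL2 f -> formL2 g ->
  0 <= s ^+ 2 * rinner f f + 2 * s * t * rinner f g + t ^+ 2 * rinner g g.
Proof.
move=> lf lg; rewrite !rinnerE -!RintegralZl//; [|exact: fdot_integrable..].
have I1 := RintegrableZ mO (s ^+ 2) (fdot_integrable lf lf).
have I2 := RintegrableZ mO (2 * s * t) (fdot_integrable lf lg).
have I3 := RintegrableZ mO (t ^+ 2) (fdot_integrable lg lg).
rewrite -(RintegralD mO I1 I2) -(RintegralD mO (RintegrableD mO I1 I2) I3).
apply: Rintegral_ge0 => p _.
rewrite /fdot !mulr_sumr -!big_split /=; apply: sumr_ge0 => J _.
rewrite /cdot; case: (f J p) (g J p) => [a b] [c e] /=.
have -> : s ^+ 2 * (a * a + b * b) + 2 * s * t * (a * c + b * e) + t ^+ 2 * (c * c + e * e) =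
  (s * a + t * c) ^+ 2 + (s * b + t * e) ^+ 2 by ring.
by rewrite addr_ge0// sqr_ge0.
Qed.

Lemma rinner_CauchySchwarz (f g : heis_form R n) : formL2 f -> formL2 g ->
  rinner f g ^+ 2 <= rinner f f * rinner g g.
Proof.
move=> lf lg; have Q s t := rinner_quadratic s t lf lg.
have := rinner_ge0 g; have := rinner_ge0 f.
move: (rinner f f) (rinner g g) (rinner f g) Q => a b c Q a0.
rewrite le_eqVlt => /orP[/eqP b0|b0]; last first.
  have := Q b (- c).
  have -> : b ^+ 2 * a + 2 * b * - c * c + (- c) ^+ 2 * b = b * (a * b - c ^+ 2) by ring.
  by rewrite pmulr_rge0// subr_ge0.
rewrite -b0 mulr0; have [->|c0] := eqVneq c 0; first by rewrite expr0n.
have := Q 1 (- (a + 1) / (2 * c)); rewrite -b0 mulr0 addr0.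
have -> : 1 ^+ 2 * a + 2 * 1 * (- (a + 1) / (2 * c)) * c = - 1 by field.
by rewrite oppr_ge0 ler10.
Qed.

End L2.

Section abstract_neumann.
Context {R : realType} {n : nat}.

(** If u is in the domain of dbar_b and killed by the adjoint of dbar_b, then
    |u|^3 <= |dbar_b u|^2 |N u|. With w = N u and b' = dbar_b w, the decomposition
    of u as the sum of its images under dbar_b and its adjoint gives
    |u|^2 = <dbar_b u, b'>, the exact part being orthogonal to u, and
    |b'|^2 <= <w, u>. *)
Lemma neumann_estimate (q : nat) (N : heis_form R n -> heis_form R n) (u b : heis_form R n) :
  (0 < q)%N -> neumann_operator q N -> dbar_graph q u b ->
  dbar_adj_graph q.-1 u (fun _ _ => 0) ->
  rinner u u ^+ 3 <= rinner b b ^+ 2 * rinner (N u) (N u).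
Proof.
move=> q0 HN ub u0.
have [Lu Lb _] := ub.
have [a' [b' [c' [d' [wa wb bc ad [_ uE]]]]]] := neumann_right HN Lu.
set w := N u in wa wb *.
have [_ La _] := wa; have [Lw Lb' _] := wb; have [_ Lc _] := bc; have [_ Ld _] := ad.
have fu := L2form_formL2 Lu; have fb := L2form_formL2 Lb; have fw := L2form_formL2 Lw.
have fc := L2form_formL2 Lc; have fd := L2form_formL2 Ld; have fb' := L2form_formL2 Lb'.
have fdc := formL2D fd fc.
have refl (f : heis_form R n) : form_ae_eq f f by move=> J; apply: aeW.
have e1 : rinner b b' = rinner u c'.
  by have [_ _ H] := bc; rewrite /rinner (H _ _ ub).
have e2 : rinner d' u = 0.
  have [_ _ H] := u0; rewrite /rinner (H _ _ ad).
  by rewrite -/(rinner _ _) rinnerE (_ : fdot _ _ = fun=> 0) ?Rintegral_cst ?mul0r//;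
    [exact: measurable_heis_ball|apply/funext => p; apply: big1 => J _; rewrite /cdot !mulr0 addr0].
have e3 : rinner b' b' = rinner w c' by have [_ _ H] := bc; rewrite /rinner (H _ _ wb).
have e4 : rinner d' w = rinner a' a' by have [_ _ H] := wa; rewrite /rinner (H _ _ ad).
have E1 : rinner u u = rinner b b'.
  rewrite (rinner_ae fu fu fu fdc (refl _) uE) rinnerDr// -e1 rinner_sym e2 add0r//.
have E2 : rinner w u = rinner a' a' + rinner b' b'.
  by rewrite (rinner_ae fw fw fu fdc (refl _) uE) rinnerDr// -e3 rinner_sym e4.
have C1 := rinner_CauchySchwarz fb fb'.
have C2 := rinner_CauchySchwarz fw fu.
have a0 := rinner_ge0 a'; have b0 := rinner_ge0 b; have w0 := rinner_ge0 w.
have b'0 := rinner_ge0 b'; have := rinner_ge0 u.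
rewrite le_eqVlt => /orP[/eqP<-|u1]; first by rewrite expr0n /= mulr_ge0// sqr_ge0.
rewrite -(ler_pM2r u1) -exprSr.
apply: (@le_trans _ _ (rinner b b ^+ 2 * rinner b' b' ^+ 2)).
  rewrite -exprMn (_ : 4 = 2 * 2)%N// exprM ler_sqr ?nnegrE ?sqr_ge0 ?mulr_ge0//.
  by rewrite {1}E1.
rewrite -[X in _ <= X]mulrA; apply: ler_wpM2l; first exact: sqr_ge0.
apply: le_trans C2; rewrite ler_sqr ?nnegrE// ?E2 ?addr_ge0//.
by rewrite lerDr.
Qed.

End abstract_neumann.

(** * Wedge signs and radial functions *)

Section wedge_signs.
Context {R : realType} {n : nat}.
Notation C := (R[i]).
Implicit Types (J K : {set 'I_n}).

Lemma wedge_sign_sq (k : 'I_n) J : wedge_sign k J * wedge_sign k J = 1 :> C.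
Proof. by rewrite /wedge_sign -expr2 sqrr_sign. Qed.

Lemma wedge_sign_conj (k : 'I_n) J : conjc (wedge_sign k J) = wedge_sign k J :> C.
Proof. by rewrite /wedge_sign rmorphXn rmorphN1. Qed.

(** Contractions with two different indices anticommute. *)
Lemma wedge_sign_anti (k a : 'I_n) J : k != a -> k \notin J -> a \notin J ->
  wedge_sign k J * wedge_sign a (k |: J) = - (wedge_sign a J * wedge_sign k (a |: J)) :> C.
Proof.
move=> ka kJ aJ.
have card (c d : 'I_n) : c \notin J ->
    #|[set j in c |: J | (j < d)%N]| = ((c < d) + #|[set j in J | (j < d)%N]|)%N.
  move=> cJ.
  have [cd|dc] := ltnP c d.
    rewrite (_ : [set j in c |: J | (j < d)%N] = c |: [set j in J | (j < d)%N]).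
      by rewrite cardsU1 inE (negbTE cJ).
    by apply/setP => j; rewrite !inE; case: eqP => // ->; rewrite cd.
  congr #|pred_of_set _|; apply/setP => j; rewrite !inE.
  by case: eqP => // ->; rewrite ltnNge dc /= !andbF.
rewrite /wedge_sign !card// -!exprD.
set x := #|_|; set y := #|_|.
have [lt|gt|eq] := ltngtP k a; last by move: ka; rewrite -val_eqE /= eq eqxx.
- by rewrite add0n add1n addnS exprS mulN1r addnC.
- by rewrite add0n add1n addnS exprS mulN1r addnC opprK.
Qed.

End wedge_signs.

Section radial.
Context {R : realType} {n : nat}.
Notation X := (heis R n).
Notation C := (R[i]).
Local Notation Re := complex.Re.
Local Notation Im := complex.Im.

(** Smooth functions whose gradient in (x, y) is a multiple of (x, y), with a factor
    G that is the same in all directions. Smooth functions of t and |z|^2 are of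
    this kind, G/2 being the derivative in |z|^2. *)
Definition radial (r : X -> R) : Prop := smooth r /\ exists G : X -> R,
  forall k p, 'D_(dir_x k) r p = p.2.1 ord0 k * G p /\ 'D_(dir_y k) r p = p.2.2 ord0 k * G p.

Lemma radialD (f g : X -> R) : radial f -> radial g -> radial (fun p => f p + g p).
Proof.
move=> [sf [F HF]] [sg [G HG]]; split; first exact: smoothD.
exists (fun p => F p + G p) => k p; have [f1 f2] := HF k p; have [g1 g2] := HG k p.
have df v := @smooth_derivable _ _ f v p sf; have dg v := @smooth_derivable _ _ g v p sg.
by rewrite !(deriveD (df _) (dg _)) f1 f2 g1 g2 !mulrDr.
Qed.

Lemma radialM (f g : X -> R) : radial f -> radial g -> radial (fun p => f p * g p).
Proof.
move=> [sf [F HF]] [sg [G HG]]; split; first exact: smoothM.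
exists (fun p => f p * G p + g p * F p) => k p; have [f1 f2] := HF k p; have [g1 g2] := HG k p.
have df v := @smooth_derivable _ _ f v p sf; have dg v := @smooth_derivable _ _ g v p sg.
by rewrite !(deriveM (df _) (dg _)) f1 f2 g1 g2 /GRing.scale /=; split; ring.
Qed.

Lemma radial_cst (c : R) : radial (fun=> c).
Proof.
split; first exact: smooth_cst.
by exists (fun=> 0) => k p; rewrite !derive_cst !mulr0.
Qed.

Lemma radialN (f : X -> R) : radial f -> radial (fun p => - f p).
Proof.
move=> rf; have -> : (fun p => - f p) = fun p => -1 * f p by apply/funext => p; rewrite mulN1r.
exact: radialM (radial_cst _) rf.
Qed.

Lemma radial_comp (I : Type) (d : I -> I) (g : I -> R -> R) (f : X -> R) :
  (forall i (x : R), is_derive x (1 : R) (g i) (g (d i) x)) ->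
  radial f -> forall i, radial (fun p => g i (f p)).
Proof.
move=> dg [sf [F HF]] i; split; first exact: (smooth_comp dg sf).
exists (fun p => g (d i) (f p) * F p) => k p; have [f1 f2] := HF k p.
have D v : 'D_v (fun p => g i (f p)) p = g (d i) (f p) * 'D_v f p.
  by case: (is_derive_comp_line (dg i (f p)) (derivableP (@smooth_derivable _ _ f v p sf))).
by rewrite !D f1 f2; split; ring.
Qed.

Lemma is_derive_coord_t (v p : X) : is_derive p v (fun p : X => p.1) v.1.
Proof. by apply: is_derive_affine => h /=; rewrite addrC. Qed.

Lemma is_derive_coord_x k (v p : X) : is_derive p v (fun p : X => p.2.1 ord0 k) (v.2.1 ord0 k).
Proof. by apply: is_derive_affine => h /=; rewrite !mxE addrC. Qed.

Lemma is_derive_coord_y k (v p : X) : is_derive p v (fun p : X => p.2.2 ord0 k) (v.2.2 ord0 k).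
Proof. by apply: is_derive_affine => h /=; rewrite !mxE addrC. Qed.

Lemma derive_znorm2 (v p : X) : 'D_v (@znorm2 R n) p =
  2 * \sum_(j < n) (p.2.1 ord0 j * v.2.1 ord0 j + p.2.2 ord0 j * v.2.2 ord0 j).
Proof.
have E : @znorm2 R n = \sum_(j < n) (fun p : X => p.2.1 ord0 j ^+ 2 + p.2.2 ord0 j ^+ 2).
  by apply/funext => s; rewrite fct_sumE.
have dj j : is_derive p v (fun p : X => p.2.1 ord0 j ^+ 2 + p.2.2 ord0 j ^+ 2)
   (2 * (p.2.1 ord0 j * v.2.1 ord0 j + p.2.2 ord0 j * v.2.2 ord0 j)).
  have dx := is_derive_coord_x j v p; have dy := is_derive_coord_y j v p.
  have d1 := is_deriveM dx dx; have d2 := is_deriveM dy dy.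
  have [dv dE] := is_deriveD d1 d2; split.
    by under eq_fun do rewrite !expr2; exact: dv.
  under eq_fun do rewrite !expr2.
  by rewrite [LHS]dE /GRing.scale /=; ring.
rewrite E derive_sum; last by move=> j; case: (dj j).
by rewrite mulr_sumr; apply: eq_bigr => j _; case: (dj j).
Qed.

Lemma derive_znorm2_dir k (p : X) :
  [/\ 'D_(dir_x k) (@znorm2 R n) p = p.2.1 ord0 k * 2,
      'D_(dir_y k) (@znorm2 R n) p = p.2.2 ord0 k * 2 &
      'D_dir_t (@znorm2 R n) p = 0].
Proof.
rewrite !derive_znorm2 /=; split.
- rewrite (bigD1 k)//= big1 ?addr0.
    by rewrite !mxE !eqxx /=; ring.
  by move=> j jk; rewrite !mxE (negbTE jk) /= !mulr0 addr0.
- rewrite (bigD1 k)//= big1 ?addr0.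
    by rewrite !mxE !eqxx /=; ring.
  by move=> j jk; rewrite !mxE (negbTE jk) /= !mulr0 addr0.
- by rewrite big1 ?mulr0// => j _; rewrite !mxE !mulr0 addr0.
Qed.

Lemma radial_t : radial (fun p : X => p.1).
Proof.
split; first exact: smooth_t.
exists (fun=> 0) => k p; rewrite !mulr0.
by split; [case: (is_derive_coord_t (dir_x k) p)|case: (is_derive_coord_t (dir_y k) p)].
Qed.

Lemma radial_znorm2 : radial (@znorm2 R n).
Proof.
split; first exact: smooth_znorm2.
by exists (fun=> 2) => k p; have [-> -> _] := derive_znorm2_dir k p.
Qed.

(** Complex-valued functions with radial real and imaginary parts. *)
Definition cradial (f : X -> C) : Prop :=
  radial (fun p => Re (f p)) /\ radial (fun p => Im (f p)).

Lemma cradial_csmooth (f : X -> C) : cradial f -> csmooth f.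
Proof. by case=> [[? _] [? _]]. Qed.

Lemma cradial_conj (f : X -> C) : cradial f -> cradial (fun p => conjc (f p)).
Proof.
move=> [rf If]; split.
  by have -> : (fun p => Re (conjc (f p))) = (fun p => Re (f p)) by apply/funext => p; case: (f p).
have -> : (fun p => Im (conjc (f p))) = (fun p => - Im (f p)) by apply/funext => p; case: (f p).
exact: radialN.
Qed.

Lemma cradial_rM (r : X -> R) (f : X -> C) : radial r -> cradial f ->
  cradial (fun p => Complex (r p) 0 * f p).
Proof.
move=> rr [rf If]; split.
  have -> : (fun p => Re (Complex (r p) 0 * f p)) = (fun p => r p * Re (f p)).
    by apply/funext => p; rewrite ReM /=; ring.
  exact: radialM.
have -> : (fun p => Im (Complex (r p) 0 * f p)) = (fun p => r p * Im (f p)).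
  by apply/funext => p; rewrite ImM /=; ring.
exact: radialM.
Qed.

(** If f is radial, Lbar_k f is z_k times a function that does not depend on k. *)
Lemma Lbar_cradial (f : X -> C) : cradial f ->
  exists Psi : X -> C, forall k p, Lbar k f p = zcoord p k * Psi p.
Proof.
move=> [[rf [F HF]] [If [G HG]]].
exists (fun p => 2%:R^-1 * Complex (F p) (G p) - Complex 0 1 * cderive dir_t f p) => k p.
rewrite /Lbar /d_zbar {1 2}/cderive.
have [-> ->] := HF k p; have [-> ->] := HG k p.
rewrite /zcoord; move: (2%:R^-1 : C) (cderive dir_t f p) (p.2.1 ord0 k) (p.2.2 ord0 k) (F p) (G p) => h ct x y a b.
have -> : Complex (x * a) (x * b) + Complex 0 1 * Complex (y * a) (y * b) = Complex x y * Complex a b.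
  by apply: complex_ext => /=; ring.
by move: (Complex x y) (Complex a b) (Complex 0 1) => z w i; ring.
Qed.

End radial.

(** * Cutoffs *)

Section bump_limit.
Context {R : realType} {n : nat}.
Notation X := (heis R n).
Notation MX := (measurableTypeR R * ('rV[R]_n * 'rV[R]_n))%type.
Notation C := (R[i]).
Notation mu := (heis_vol R n).
Local Notation Omega := (@heis_ball R n).

(** Smooth cutoffs, supported in rho <= 1 - 1/m and tending to 1 where rho < 1. *)
Definition cutoff (m : nat) (p : X) : R := flat_exp 1 (m%:R * (1 - rho p) - 1).

Lemma radial_cutoff m : radial (cutoff m).
Proof.
have r1 : radial (fun p : X => m%:R * (1 - rho p) - 1).
  apply: radialD; last exact: radial_cst.
  apply: radialM; first exact: radial_cst.
  apply: radialD; first exact: radial_cst.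
  apply: radialN.
  have -> : @rho R n = fun p => p.1 * p.1 + znorm2 p * znorm2 p.
    by apply/funext => p; rewrite /rho !expr2.
  by apply: radialD; apply: radialM; [exact: radial_t..|exact: radial_znorm2|exact: radial_znorm2].
exact: (radial_comp (@is_derive_flat_exp R) r1 1).
Qed.

Lemma cutoff_support m : exists K : set X, [/\ compact K, K `<=` Omega° &
  forall p, ~ K p -> cutoff m p = 0].
Proof.
case: m => [|m].
  exists set0; split => //; first exact: compact0.
  by move=> p _; rewrite /cutoff mul0r sub0r flat_exp_le0// oppr_le0.
have m0 : 0 < m.+1%:R^-1 :> R by rewrite invr_gt0.
exists [set p | rho p <= 1 - m.+1%:R^-1]; split.
- by apply: compact_le_rho; rewrite gerBl ltW.
- move=> p /= rp; apply: lt_rho_interior => /=; apply: le_lt_trans rp _.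
  by rewrite gtrBl.
- move=> p /= /negP; rewrite -ltNge ltrBlDl -ltrBlDr => rp.
  rewrite /cutoff flat_exp_le0// subr_le0 mulrC -ler_pdivlMr// mul1r ltW//.
Qed.

Lemma cutoff_test m (f : X -> C) : csmooth f ->
  test_function (fun p => Complex (cutoff m p) 0 * f p).
Proof.
move=> sf; split.
  by apply: csmoothM => //; apply: csmooth_real; case: (radial_cutoff m).
have [K [cK KO K0]] := cutoff_support m; exists K; split => // p Kp.
by rewrite K0// mul0r.
Qed.

Lemma cvg_cutoff (p : X) : Omega p ->
  cutoff m p @[m --> \oo] --> (if rho p < 1 then 1 else 0 : R).
Proof.
move=> Op; case: ifPn => [p1|]; first by apply: cvg_flat_exp; rewrite subr_gt0.
rewrite -leNgt => p1; rewrite /cutoff; have -> : rho p = 1 by apply/eqP; rewrite eq_le p1 andbT.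
have -> : (fun m : nat => flat_exp 1 (m%:R * (1 - 1) - 1 : R)) = fun=> 0.
  by apply/funext => m; rewrite subrr mulr0 sub0r flat_exp_le0// oppr_le0.
exact: cvg_cst.
Qed.

Lemma measurable_heis_sphere : measurable ([set p | rho p = 1] : set MX).
Proof.
have := continuous_measurable_heis (@continuous_rho R n) measurableT (measurable_set1 (1 : R)).
by rewrite setTI.
Qed.

(** The lines parallel to the t-axis meet the sphere in at most two points. *)
Lemma heis_sphere_null : mu ([set p | rho p = 1] : set MX) = 0%E.
Proof.
have mS := measurable_heis_sphere.
rewrite /heis_vol /= sfprod_ysection//.
rewrite (eq_integral (fun=> 0%E)) ?integral0// => y _.
apply: countable_lebesgue_measure0.
apply: (@sub_countable _ _ _ [set Num.sqrt (1 - znorm2 ((0, y) : X) ^+ 2); - Num.sqrt (1 - znorm2 ((0, y) : X) ^+ 2)]); last first.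
  by apply: finite_set_countable; exact: finite_set2.
apply: subset_card_le => t; rewrite /ysection /= inE /= /rho /= => h.
have e : t ^+ 2 = 1 - znorm2 ((0, y) : X) ^+ 2 by rewrite -h /znorm2 /=; ring.
rewrite -e sqrtr_sqr; have [t0|t0] := lerP 0 t.
  by left; rewrite ger0_norm.
by right; rewrite ltr0_norm// opprK.
Qed.

(** Removal of the cutoff, by dominated convergence; the sphere is negligible. *)
Lemma cutoff_integral0 (f : X -> R) : mu.-integrable (Omega : set MX) (EFin \o f) ->
  (forall m, \int[mu]_(p in Omega) (cutoff m p * f p) = 0) ->
  \int[mu]_(p in Omega) f p = 0.
Proof.
move=> fI I0; have mO := @measurable_heis_ball R n.
have mf : measurable_fun (Omega : set MX) f by have /integrableP[/measurable_EFinP] := fI.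
have mc m : measurable_fun (Omega : set MX) (cutoff m).
  by apply: measurable_funTS; apply: continuous_measurable_heis; apply: smooth_continuous; case: (radial_cutoff m).
pose f' p := (if rho p < 1 then 1 else 0) * f p.
have D : \int[mu]_(p in Omega) (cutoff m p * f p) @[m --> \oo] --> \int[mu]_(p in Omega) f' p.
  apply: (@Rdominated_cvg _ MX R mu Omega _ f' (fun p => `|f p|)) => //.
  - by move=> m; apply: measurable_funM.
  - by move=> p Op; apply: cvgM; [exact: cvg_cutoff|exact: cvg_cst].
  - exact: integrable_norm.
  - move=> m p Op; rewrite normrM ler_piMl// ger0_norm ?flat_exp_ge0//.
    exact: flat_exp_le1.
have <- : \int[mu]_(p in Omega) f' p = \int[mu]_(p in Omega) f p.
  congr fine; apply: ae_eq_integral => //.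
  - apply/measurable_EFinP.
    apply: (@measurable_fun_cvg _ _ _ _ (fun m p => cutoff m p * f p)) => [m|p Op].
      exact: (measurable_funM (mc m) mf).
    by apply: cvgM; [exact: cvg_cutoff|exact: cvg_cst].
  - exact/measurable_EFinP.
  - exists [set p | rho p = 1]; split => //.
    + exact: measurable_heis_sphere.
    + exact: heis_sphere_null.
    + move=> p /= /not_implyP[Op]; apply: contra_notP => rp.
      rewrite /f' ifT ?mul1r// lt_neqAle; apply/andP; split; last exact: Op.
      exact/eqP.
rewrite -(cvg_lim _ D)//; apply: lim_near_cst => //.
by apply: nearW => m; exact: I0.
Qed.

End bump_limit.

(** * Contraction with the antiholomorphic Euler field *)

Section contraction.
Context {R : realType} {n : nat}.
Notation X := (heis R n).
Notation MX := (measurableTypeR R * ('rV[R]_n * 'rV[R]_n))%type.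
Notation C := (R[i]).
Notation mu := (heis_vol R n).
Local Notation Omega := (@heis_ball R n).
Local Notation Re := complex.Re.
Local Notation Im := complex.Im.
Implicit Types (J K : {set 'I_n}).

(** The contraction of the form with coefficients H by the antiholomorphic Euler
    field sum_a conj(z_a) d/d conj(z_a). *)
Definition contract (H : heis_form R n) : heis_form R n := fun J p =>
  \sum_(a | a \notin J) wedge_sign a J * (conjc (zcoord p a) * H (a |: J) p).

Lemma csmooth_contract (H : heis_form R n) J : (forall K, csmooth (H K)) -> csmooth (contract H J).
Proof.
move=> sH; apply: csmooth_sum => a _; apply: csmoothM; first exact: csmooth_cst.
by apply: csmoothM => //; apply: csmooth_conj; exact: csmooth_zcoord.
Qed.

Lemma contract_L2form q (H : heis_form R n) : (forall K, csmooth (H K)) ->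
  (forall K, #|K| != q.+1 -> H K = fun=> 0) -> L2form q (contract H).
Proof.
move=> sH H0; split => [J Jq|J]; last by apply: csmooth_L2fun; exact: csmooth_contract.
apply/funext => p; apply: big1 => a aJ; rewrite H0 ?mulr0//.
by rewrite cardsU1 aJ add1n eqSS.
Qed.

(** Differentiating conj(z_k) is the only contribution. *)
Lemma Lbar_contract (H : heis_form R n) k J p : (forall K, csmooth (H K)) ->
  (forall k K p, Lbar k (H K) p = 0) -> k \notin J ->
  Lbar k (contract H J) p = wedge_sign k J * H (k |: J) p.
Proof.
move=> sH LH kJ.
have sz a : csmooth (fun q : X => conjc (zcoord q a)) by apply: csmooth_conj; exact: csmooth_zcoord.
have st a : csmooth (fun q : X => conjc (zcoord q a) * H (a |: J) q) by apply: csmoothM.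
rewrite /contract Lbar_sum; last first.
  by move=> a _; apply: csmoothM => //; exact: csmooth_cst.
rewrite (bigD1 k)//= big1 => [|a /andP[aJ ak]].
  by rewrite addr0 (LbarZ _ _ _ (st k)) (LbarM _ _ (sz k) (sH _)) LH mulr0 addr0 Lbar_zcoord_conj eqxx mul1r.
by rewrite (LbarZ _ _ _ (st a)) (LbarM _ _ (sz a) (sH _)) LH mulr0 addr0 Lbar_zcoord_conj eq_sym (negbTE ak) mul0r mulr0.
Qed.

Lemma test_cintegrable (f phi : X -> C) : csmooth f -> csmooth phi -> cintegrable (fun p => f p * phi p).
Proof. by move=> sf sp; apply: L2fun_cintegrableM; exact: csmooth_L2fun. Qed.

(** On smooth functions the distributional Lbar_k is the classical one. *)
Lemma Lbar_distr_smooth k (u phi : X -> C) : csmooth u -> test_function phi ->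
  Lbar_distr k u phi = cintegral (fun p => Lbar k u p * phi p).
Proof.
move=> su tp; have sp := tp.1.
have i1 := test_cintegrable (csmooth_Lbar k su) sp.
have i2 := test_cintegrable su (csmooth_Lbar k sp).
have := cintegral_Lbar_test k (test_functionMl su tp).
rewrite (_ : Lbar k _ = fun p => Lbar k u p * phi p + u p * Lbar k phi p).
  by rewrite cintegralD// => /eqP; rewrite addr_eq0 => /eqP ->.
by apply/funext => p; rewrite LbarM.
Qed.

(** If the coefficients of H are CR functions, dbar_b (contract H) = (q + 1) H: each
    of the q + 1 elements k of K contributes H_K once. *)
Lemma dbar_graph_contract q (H : heis_form R n) : (forall K, csmooth (H K)) ->
  (forall K, #|K| != q.+1 -> H K = fun=> 0) -> (forall k K p, Lbar k (H K) p = 0) ->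
  dbar_graph q (contract H) (fun K p => q.+1%:R * H K p).
Proof.
move=> sH H0 LH; split.
- exact: contract_L2form.
- split => [K Kq|K]; first by rewrite H0//; apply/funext => p; rewrite mulr0.
  by apply: csmooth_L2fun; apply: csmoothM => //; exact: csmooth_cst.
move=> K phi tp; have sp := tp.1.
have E k J : k \notin J -> k |: J = K ->
    wedge_sign k J * Lbar_distr k (contract H J) phi = cintegral (fun p => H K p * phi p).
  move=> kJ kJK; rewrite Lbar_distr_smooth//; last exact: csmooth_contract.
  rewrite -cintegralZ; last by apply: test_cintegrable => //; apply: csmooth_Lbar; exact: csmooth_contract.
  congr cintegral; apply/funext => p.
  by rewrite Lbar_contract// !mulrA wedge_sign_sq mul1r kJK.
have -> : \sum_(k < n) \sum_(J : {set 'I_n} | (k \notin J) && (k |: J == K))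
    wedge_sign k J * Lbar_distr k (contract H J) phi =
    \sum_(k in K) cintegral (fun p => H K p * phi p).
  rewrite [RHS]big_mkcond; apply: eq_bigr => k _; case: ifPn => kK.
    rewrite (big_pred1 (K :\ k)).
      by apply: E; [rewrite !inE eqxx|exact: finset.setD1K].
    move=> J /=; apply/andP/eqP => [[kJ /eqP <-]|->].
      by rewrite finset.setU1K.
    by rewrite !inE eqxx finset.setD1K.
  apply: big_pred0 => J; apply/negbTE; rewrite negb_and negbK; apply/orP; right.
  by apply: contra kK => /eqP <-; rewrite finset.setU11.
have -> : (fun p => q.+1%:R * H K p * phi p) = (fun p => q.+1%:R * (H K p * phi p)).
  by apply/funext => p; rewrite mulrA.
rewrite cintegralZ; last exact: test_cintegrable.
rewrite sumr_const -[RHS]mulr_natl.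
have [->//|Kq] := eqVneq #|K| q.+1.
rewrite H0// (_ : (fun p => _) = fun=> 0) ?cintegral0 ?mulr0//.
by apply/funext => p; rewrite mul0r.
Qed.

(** The formal adjoint of dbar_b, up to conjugation, kills cutoff(rho) times a
    contraction: the term indexed by (k, a) is a factor symmetric in k and a
    times an antisymmetric sign. *)
Lemma Lbar_cutoff_contract m (H : heis_form R n) : (forall K, cradial (H K)) -> forall J p,
  \sum_(k | k \notin J) wedge_sign k J *
    Lbar k (fun q => Complex (cutoff m q) 0 * conjc (contract H (k |: J) q)) p = 0.
Proof.
move=> rH J p.
have cM (a b : C) : conjc (a * b) = conjc a * conjc b by exact: rmorphM.
have cS (P : pred 'I_n) (F : 'I_n -> C) :
    conjc (\sum_(a | P a) F a) = \sum_(a | P a) conjc (F a) by exact: rmorph_sum.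
pose f K (q : X) := Complex (cutoff m q) 0 * conjc (H K q).
have rf K : cradial (f K) by apply: cradial_rM; [exact: radial_cutoff|exact: cradial_conj].
have /choice[Psi HPsi] := fun K => Lbar_cradial (rf K).
pose T k a : C := wedge_sign k J * wedge_sign a (k |: J) *
  (zcoord p a * zcoord p k * Psi (a |: (k |: J)) p).
have E k : k \notin J -> wedge_sign k J *
    Lbar k (fun q => Complex (cutoff m q) 0 * conjc (contract H (k |: J) q)) p =
    \sum_(a | (a \notin J) && (a != k)) T k a.
  move=> kJ.
  have -> : (fun q => Complex (cutoff m q) 0 * conjc (contract H (k |: J) q)) =
     (fun q => \sum_(a | a \notin k |: J) wedge_sign a (k |: J) * (zcoord q a * f (a |: (k |: J)) q)).
    apply/funext => q; rewrite /contract cS mulr_sumr; apply: eq_bigr => a _.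
    rewrite !cM wedge_sign_conj conjcK /f.
    by move: (wedge_sign _ _) (zcoord _ _) (Complex _ _) (conjc _) => s z c h; ring.
  have sf K : csmooth (f K) by exact: cradial_csmooth.
  have sz a := @csmooth_zcoord R n a.
  rewrite Lbar_sum; last by move=> a _; apply: csmoothM; [exact: csmooth_cst|exact: csmoothM].
  rewrite mulr_sumr; apply: eq_big => [a|a _]; first by rewrite !inE negb_or andbC.
  have st : csmooth (fun q : X => zcoord q a * f (a |: (k |: J)) q) by apply: csmoothM.
  rewrite (LbarZ _ _ _ st) (LbarM _ _ (sz a) (sf _)) Lbar_zcoord mul0r add0r HPsi /T.
  by move: (wedge_sign _ _) (wedge_sign _ _) (zcoord _ _) (zcoord _ _) (Psi _ _) => s s' z z' h; ring.
rewrite (eq_bigr _ E).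
set S := (X in X = _).
have : S = - S.
  rewrite {1}/S (exchange_big_dep (fun a => a \notin J)) /=; last by move=> k a _ /andP[].
  rewrite /S -sumrN; apply: eq_bigr => a aJ; rewrite -sumrN.
  apply: eq_big => [k|k /andP[kJ]]; first by rewrite aJ /= eq_sym.
  rewrite aJ /= => ak; rewrite /T wedge_sign_anti 1?eq_sym//.
  by rewrite finset.setUCA mulNr [zcoord p a * zcoord p k]mulrC.
by move/eqP; rewrite -addr_eq0 -mulr2n mulrn_eq0 /= => /eqP.
Qed.

(** Contractions of forms with radial coefficients are in the domain of the adjoint
    of dbar_b, which kills them. For y = dbar_b x, the distributional definition of
    dbar_b is applied to the test forms cutoff(rho) conj(contract H). *)
Lemma dbar_adj_graph_contract q (H : heis_form R n) : (forall K, cradial (H K)) ->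
  (forall K, #|K| != q.+2 -> H K = fun=> 0) ->
  dbar_adj_graph q (contract H) (fun _ _ => 0).
Proof.
move=> rH H0; have sH K : csmooth (H K) by exact: cradial_csmooth.
have su K : csmooth (contract H K) by exact: csmooth_contract.
split; first exact: contract_L2form.
  by split => // J; exact: L2fun0.
move=> x y [[_ Lx] [_ Ly] xy].
have -> : inner x (fun _ _ => 0) = 0.
  rewrite /inner (_ : (fun p => _) = fun=> 0) ?cintegral0//.
  by apply/funext => p; apply: big1 => J _; rewrite conjc0 mulr0.
pose S p := \sum_(K : {set 'I_n}) y K p * conjc (contract H K p).
have iy K : cintegrable (fun p => y K p * conjc (contract H K p)).
  by apply: L2fun_cintegrableM => //; apply: csmooth_L2fun; exact: csmooth_conj.
have iS : cintegrable S by apply: cintegrable_sum => K _; exact: iy.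
pose phi m K p := Complex (cutoff m p) 0 * conjc (contract H K p).
have tphi m K : test_function (phi m K) by apply: cutoff_test; exact: csmooth_conj.
have sphi m K : csmooth (phi m K) := (tphi m K).1.
have ix m k J K : cintegrable (fun p => x J p * Lbar k (phi m K) p).
  by apply: L2fun_cintegrableM => //; apply: csmooth_L2fun; exact: csmooth_Lbar.
have Z m : cintegral (fun p => Complex (cutoff m p) 0 * S p) = 0.
  have -> : (fun p => Complex (cutoff m p) 0 * S p) = (fun p => \sum_(K : {set 'I_n}) y K p * phi m K p).
    by apply/funext => p; rewrite /S mulr_sumr; apply: eq_bigr => K _; rewrite mulrCA.
  rewrite cintegral_sum; last by move=> K _; apply: L2fun_cintegrableM => //; exact: csmooth_L2fun.
  under eq_bigr => K _ do rewrite (xy K _ (tphi m K)).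
  transitivity (\sum_(J : {set 'I_n}) \sum_(k | k \notin J)
      wedge_sign k J * Lbar_distr k (x J) (phi m (k |: J))).
    rewrite exchange_big /= [RHS](exchange_big_dep predT)//=; apply: eq_bigr => k _.
    rewrite (exchange_big_dep (fun J => k \notin J)) /=; last by move=> K J _ /andP[].
    apply: eq_bigr => J kJ; rewrite (big_pred1 (k |: J))// => K /=.
    by rewrite kJ /= eq_sym.
  apply: big1 => J _.
  have -> : \sum_(k | k \notin J) wedge_sign k J * Lbar_distr k (x J) (phi m (k |: J)) =
      - cintegral (fun p => \sum_(k | k \notin J) wedge_sign k J * (x J p * Lbar k (phi m (k |: J)) p)).
    rewrite cintegral_sum; last by move=> k _; apply: cintegrableZ; exact: ix.
    by rewrite -sumrN; apply: eq_bigr => k _; rewrite cintegralZ// mulrN.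
  rewrite (_ : (fun p => _) = fun=> 0) ?cintegral0 ?oppr0//; apply/funext => p.
  under eq_bigr => k _ do rewrite mulrCA.
  by rewrite -mulr_sumr Lbar_cutoff_contract// mulr0.
rewrite /inner; apply: complex_ext => /=.
  apply: (@cutoff_integral0 _ _ (fun p => Re (S p))); first exact: iS.1.
  move=> m; transitivity (Re (cintegral (fun p => Complex (cutoff m p) 0 * S p))); last by rewrite Z.
  by apply: eq_Rintegral => p _; rewrite ReM mul0r subr0.
apply: (@cutoff_integral0 _ _ (fun p => Im (S p))); first exact: iS.2.
move=> m; transitivity (Im (cintegral (fun p => Complex (cutoff m p) 0 * S p))); last by rewrite Z.
by apply: eq_Rintegral => p _; rewrite ImM mul0r addr0.
Qed.

End contraction.

(** * Concentration of CR functions *)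

Section cr_functions.
Context {R : realType} {n : nat}.
Notation X := (heis R n).
Notation C := (R[i]).
Local Notation Re := complex.Re.
Local Notation Im := complex.Im.

(** The function exp(- i k w), with w = t + i |z|^2. *)
Definition cr_exp (k : R) (p : X) : C :=
  Complex (expR (k * znorm2 p) * cos (k * p.1)) (- (expR (k * znorm2 p) * sin (k * p.1))).

Lemma cr_exp_cradial k : cradial (cr_exp k).
Proof.
have rt : radial (fun p : X => k * p.1) by apply: radialM; [exact: radial_cst|exact: radial_t].
have rz : radial (fun p : X => k * znorm2 p) by apply: radialM; [exact: radial_cst|exact: radial_znorm2].
have rE : radial (fun p : X => expR (k * znorm2 p)).
  exact: (@radial_comp _ _ unit id (fun=> expR) _ _ rz tt).
have [[sc ss] [F HF]] := (smooth_cos_sin rt.1, rt.2).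
have dt v p : is_derive p v (fun p : X => k * p.1) ('D_v (fun p : X => k * p.1) p).
  exact/derivableP/smooth_derivable/rt.1.
have rc : radial (fun p : X => cos (k * p.1)).
  split => //; exists (fun p => - sin (k * p.1) * F p) => j p; have [f1 f2] := HF j p.
  have D v : 'D_v (fun p => cos (k * p.1)) p = - sin (k * p.1) * 'D_v (fun p : X => k * p.1) p.
    by case: (is_derive_comp_line (is_derive_cos _) (dt v p)).
  by rewrite !D f1 f2; split; ring.
have rs : radial (fun p : X => sin (k * p.1)).
  split => //; exists (fun p => cos (k * p.1) * F p) => j p; have [f1 f2] := HF j p.
  have D v : 'D_v (fun p => sin (k * p.1)) p = cos (k * p.1) * 'D_v (fun p : X => k * p.1) p.
    by case: (is_derive_comp_line (is_derive_sin _) (dt v p)).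
  by rewrite !D f1 f2; split; ring.
by split; [exact: radialM|apply: radialN; exact: radialM].
Qed.

Lemma Lbar_cr_exp (k : R) j p : Lbar j (cr_exp k) p = 0.
Proof.
have dkt v : is_derive p v (fun p : X => k * p.1) (k * v.1).
  have := is_deriveM (is_derive_cst k p v) (is_derive_coord_t v p).
  by congr (is_derive _ _ _ _); rewrite /GRing.scale /=; ring.
have dkz v : is_derive p v (fun p : X => k * znorm2 p) (k * 'D_v (@znorm2 R n) p).
  have := is_deriveM (is_derive_cst k p v) (derivableP (@smooth_derivable _ _ _ v p (@smooth_znorm2 R n))).
  by congr (is_derive _ _ _ _); rewrite /GRing.scale /=; ring.
have dE v := @is_derive_comp_line _ _ expR (fun p : X => k * znorm2 p) p v _ _ (is_derive_expR _) (dkz v).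
have dc v := @is_derive_comp_line _ _ (@cos R) (fun p : X => k * p.1) p v _ _ (is_derive_cos _) (dkt v).
have ds v := @is_derive_comp_line _ _ (@sin R) (fun p : X => k * p.1) p v _ _ (is_derive_sin _) (dkt v).
set E := expR (k * znorm2 p) in dE.
set c := cos (k * p.1) in ds. set s := sin (k * p.1) in dc.
have D v : cderive v (cr_exp k) p =
    Complex (E * (- s * (k * v.1)) + c * (E * (k * 'D_v (@znorm2 R n) p)))
      (- (E * (c * (k * v.1)) + s * (E * (k * 'D_v (@znorm2 R n) p)))).
  by rewrite /cderive; congr Complex; [case: (is_deriveM (dE v) (dc v))|case: (is_deriveN (is_deriveM (dE v) (ds v)))].
have hE : (2%:R^-1 : C) = Complex 2^-1 0 by apply: complex_ext => /=; field.
have [zx zy zt] := derive_znorm2_dir j p.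
by rewrite /Lbar /d_zbar !D zx zy zt hE /zcoord; apply: complex_ext => /=; field.
Qed.

Lemma cr_exp_sq (k : R) p : cdot (cr_exp k p) (cr_exp k p) = expR (k * znorm2 p) ^+ 2.
Proof.
rewrite /cdot /cr_exp /= mulrNN -!expr2 !exprMn -mulrDr cos2Dsin2 ?mulr1//.
Qed.

End cr_functions.

Section concentration.
Context {R : realType} {n : nat}.
Hypothesis n0 : (0 < n)%N.
Notation X := (heis R n).
Notation MX := (measurableTypeR R * ('rV[R]_n * 'rV[R]_n))%type.
Notation mu := (heis_vol R n).
Local Notation Omega := (@heis_ball R n).
Notation integrable_on f := (mu.-integrable (Omega : set MX) (EFin \o f)).

Let mO : measurable (Omega : set MX) := @measurable_heis_ball R n.

(** The part of the ball where |z|^2 is close to 1 contains a box of positive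
    volume. *)
Lemma box_near_sphere (d : R) : 0 < d <= 1 -> exists A : set MX,
  [/\ measurable A, A `<=` Omega, (forall p : X, A p -> 1 - d < znorm2 p) &
   exists2 v : R, 0 < v & mu A = v%:E].
Proof.
move=> /andP[d0 d1].
(* The box is centred at a point with t = 0 and |z|^2 = 1 - d/2. *)
pose a := Num.sqrt (1 - d / 2).
have a2 : a ^+ 2 = 1 - d / 2 by rewrite sqr_sqrtr//; lra.
pose c : X := (0, (a *: delta_mx ord0 (Ordinal n0), 0)).
have zc : znorm2 c = 1 - d / 2.
  rewrite /znorm2 (bigD1 (Ordinal n0))//= big1.
    by rewrite !mxE !eqxx /= mulr1 a2; ring.
  by move=> j jk; rewrite !mxE (negbTE jk) /= mulr0 expr0n /= addr0.
pose U : set X := [set p | rho p < 1] `&` [set p | 1 - d < znorm2 p].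
have oU : open U.
  apply: openI.
    by apply: (@open_comp _ _ rho [set x | x < 1]) => [p _|]; [exact: continuous_rho|exact: open_lt].
  apply: (@open_comp _ _ (@znorm2 R n) [set x | 1 - d < x]) => [p _|]; last exact: open_gt.
  exact: (smooth_continuous (@smooth_znorm2 R n)).
have Uc : U c.
  split => /=; last by rewrite zc; lra.
  by rewrite /rho zc /= expr0n /= add0r; nra.
have /nbhs_ballP[r /= r0 rU] : nbhs c U by exact: open_nbhs_nbhs.
have r2 : 0 <= r / 2 by rewrite divr_ge0// ltW.
exists (heis_box c (r / 2) (r / 2)).
have AU : heis_box c (r / 2) (r / 2) `<=` U.
  move=> p [pt [px py]]; apply: rU; rewrite -ball_normE /= distrC.
  apply: (@le_lt_trans _ _ (r / 2)); last by rewrite ltr_pdivrMr// ltr_pMr// ltr1n.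
  apply: heis_norm_le => // [|k|k]; first exact: ltW.
    by move: (px k); rewrite /= !mxE => /ltW.
  by move: (py k); rewrite /= !mxE => /ltW.
split.
- exact: measurable_heis_box.
- by move=> p /AU[/= /ltW].
- by move=> p /AU[].
- have -> := heis_vol_box c r2 r2.
  exists ((r / 2) *+ 2 * (((r / 2) *+ 2) ^+ n) ^+ 2) => //.
  by rewrite -mulr_natr divfK// mulr_gt0// !exprn_gt0.
Qed.

(** The part of the ball where |z|^2 is close to 1 has small volume, since t is
    close to 0 there. *)
Lemma thin_box (e : R) : 0 < e -> exists2 d : R, 0 < d < 1 & exists A : set MX,
  [/\ measurable A, (forall p : X, Omega p -> 1 - d < znorm2 p -> A p) &
   exists2 v : R, v <= e & mu A = v%:E].
Proof.
move=> e0; pose q : R := ((2 *+ 2) ^+ n) ^+ 2.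
have q0 : 0 < q by rewrite !exprn_gt0// mulrn_wgt0.
pose s := Num.min 1 (e / (2 * q)).
have s0 : 0 < s by rewrite lt_min ltr01 divr_gt0// mulr_gt0.
have s1 : s <= 1 by rewrite ge_min lexx.
have se : s *+ 2 * q <= e.
  have : s <= e / (2 * q) by rewrite ge_min lexx orbT.
  by rewrite ler_pdivlMr ?mulr_gt0// (_ : s * (2 * q) = s *+ 2 * q)//; ring.
(* With |z|^2 > 1 - d and rho <= 1, one has t^2 < 2 d, which is s^2 here. *)
exists (s ^+ 2 / 2); first by rewrite divr_gt0 ?exprn_gt0//=; nra.
exists (heis_box 0 s 2); split.
- exact: measurable_heis_box.
- move=> p Op zp.
  have Np := heis_ball_norm Op.
  split; last split.
  + rewrite subr0 -ltr_sqr ?nnegrE ?normr_ge0 ?(ltW s0)// real_normK ?num_real//.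
    have : p.1 ^+ 2 + znorm2 p ^+ 2 <= 1 by exact: Op.
    have := znorm2_ge0 p.
    move: (znorm2 p) zp => z zp z0 h. nra.
  + by move=> k; rewrite mxE subr0 (le_lt_trans (heis_norm_x _ _))// (le_lt_trans Np)// ltr1n.
  + by move=> k; rewrite mxE subr0 (le_lt_trans (heis_norm_y _ _))// (le_lt_trans Np)// ltr1n.
- by exists (s *+ 2 * q) => //; exact: (heis_vol_box 0 (ltW s0) (ler0n _ 2)).
Qed.

Lemma Rintegral_indic_ball (A : set MX) (v : R) : measurable A -> mu A = v%:E ->
  integrable_on (\1_A : X -> R) /\ \int[mu]_(p in Omega) (\1_A p : R) <= v.
Proof.
move=> mA Av; split.
  apply: (@bounded_integrable _ _ _ mu _ _ 1) => //; first exact: heis_vol_ball_lty.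
  by move=> p _; rewrite indicE; case: (p \in A); rewrite ?normr1 ?normr0.
rewrite /Rintegral integral_indic// -lee_fin fineK.
  by rewrite -Av; apply: le_measure; rewrite ?inE//; exact: measurableI.
rewrite ge0_fin_numE//; apply: (@le_lt_trans _ _ (mu A)); last by rewrite Av ltry.
by apply: le_measure; rewrite ?inE//; exact: measurableI.
Qed.

Lemma Rintegral_indic_sub (A : set MX) (v : R) : measurable A -> A `<=` Omega -> mu A = v%:E ->
  \int[mu]_(p in Omega) (\1_A p : R) = v.
Proof.
move=> mA AO Av; rewrite /Rintegral integral_indic//.
have E : mu (A `&` Omega) = v%:E by rewrite setIidl.
exact: (congr1 fine E).
Qed.

(** The square of the L^2 norm of exp(- i k w) on the ball. *)
Definition mass (k : nat) : R := \int[mu]_(p in Omega) (expR (k%:R * znorm2 p) ^+ 2).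

(** The modulus of exp(- i k w), normalised in L^2. *)
Definition peak (k : nat) (p : X) : R := (Num.sqrt (mass k))^-1 * expR (k%:R * znorm2 p).

Lemma smooth_exp_znorm2 (k : R) : smooth (fun p : X => expR (k * znorm2 p)).
Proof. by apply: smooth_expR; apply: smoothM; [exact: smooth_cst|exact: smooth_znorm2]. Qed.

Lemma smooth_peak k : smooth (peak k).
Proof. by apply: smoothM; [exact: smooth_cst|exact: smooth_exp_znorm2]. Qed.

Lemma peak_ge0 k p : 0 <= peak k p.
Proof. by rewrite /peak mulr_ge0 ?expR_ge0// invr_ge0 sqrtr_ge0. Qed.

Lemma smooth_integrable_on (f : X -> R) : smooth f -> integrable_on f.
Proof. exact: smooth_ball_integrable. Qed.

(** The mass grows at least like exp(2 k (1 - d)), for every d > 0. *)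
Lemma mass_ge (d : R) : 0 < d <= 1 -> exists2 v : R, 0 < v &
  forall k, expR (k%:R * (1 - d)) ^+ 2 * v <= mass k.
Proof.
move=> d01; have [A [mA AO Az [v v0 Av]]] := box_near_sphere d01.
exists v => // k; have [iA _] := Rintegral_indic_ball mA Av.
rewrite -(Rintegral_indic_sub mA AO Av) -RintegralZl//.
apply: le_Rintegral => //.
- exact: RintegrableZ.
- by apply: smooth_integrable_on; apply: smoothX; exact: smooth_exp_znorm2.
- move=> p Op; rewrite indicE; have [pA|pA] := boolP (p \in A); last by rewrite mulr0 sqr_ge0.
  rewrite mulr1 ler_sqr ?nnegrE ?expR_ge0// ler_expR ler_wpM2l//.
  by apply/ltW/Az; rewrite -inE.
Qed.

Lemma mass_gt0 k : 0 < mass k.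
Proof.
have [|v v0 H] := @mass_ge 1; first by rewrite ltr01 lexx.
by apply: lt_le_trans (H k); rewrite mulr_gt0// exprn_gt0// expR_gt0.
Qed.

Lemma peak_sq k p : peak k p ^+ 2 = (mass k)^-1 * expR (k%:R * znorm2 p) ^+ 2.
Proof. by rewrite /peak exprMn exprVn sqr_sqrtr// ltW// mass_gt0. Qed.

Lemma integral_peak_sq k : \int[mu]_(p in Omega) (peak k p ^+ 2) = 1.
Proof.
transitivity (\int[mu]_(p in Omega) ((mass k)^-1 * expR (k%:R * znorm2 p) ^+ 2)).
  by apply: eq_Rintegral => p _; exact: peak_sq.
rewrite RintegralZl//; last by apply: smooth_integrable_on; apply: smoothX; exact: smooth_exp_znorm2.
by rewrite mulVf// gt_eqF// mass_gt0.
Qed.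

(** Chebyshev's correlation inequality: weighting by an increasing function of
    |z|^2 does not decrease the mean of |z|^2. It comes from
    (exp(2 k |z|^2) - exp(2 k m)) (|z|^2 - m) >= 0. *)
Lemma peak_znorm2_ge : exists2 m : R, 0 < m & forall k,
  m <= \int[mu]_(p in Omega) (peak k p ^+ 2 * znorm2 p).
Proof.
have [|A [mA AO Az [v v0 Av]]] := @box_near_sphere 2^-1; first by lra.
have [iA _] := Rintegral_indic_ball mA Av.
pose V : R := fine (mu Omega).
have i1 : integrable_on ((fun=> (1 : R)) : X -> R) by apply: smooth_integrable_on; exact: smooth_cst.
have iz : integrable_on (@znorm2 R n) by apply: smooth_integrable_on; exact: smooth_znorm2.
have V1 : \int[mu]_(p in Omega) (1 : R) = V by rewrite Rintegral_cst// mul1r.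
have zA : 2^-1 * v <= \int[mu]_(p in Omega) znorm2 p.
  rewrite -(Rintegral_indic_sub mA AO Av) -RintegralZl//.
  apply: le_Rintegral => //; first exact: RintegrableZ.
  move=> p Op; rewrite indicE; have [pA|pA] := boolP (p \in A); last by rewrite mulr0 znorm2_ge0.
  by rewrite mulr1; have := Az p; rewrite -inE => /(_ pA); lra.
have Vv : v <= V.
  rewrite -V1 -(Rintegral_indic_sub mA AO Av); apply: le_Rintegral => //.
have V0 : 0 < V := lt_le_trans v0 Vv.
(* A lower bound for the mean of |z|^2 over the ball. *)
pose m := 2^-1 * v / V.
have m0 : 0 < m by rewrite divr_gt0// mulr_gt0.
exists m => // k.
pose e := expR (k%:R * m) ^+ 2.
have sP : smooth (fun p : X => peak k p ^+ 2) by apply: smoothX; exact: smooth_peak.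
have iP := smooth_integrable_on sP.
have iPz : integrable_on (fun p => peak k p ^+ 2 * znorm2 p).
  by apply: smooth_integrable_on; apply: smoothM => //; exact: smooth_znorm2.
pose c := (mass k)^-1 * e.
have c0 : 0 <= c by rewrite mulr_ge0 ?invr_ge0 ?sqr_ge0// ltW// mass_gt0.
have im : integrable_on (fun p => znorm2 p - m * 1) by apply: RintegrableB => //; exact: RintegrableZ.
have K : \int[mu]_(p in Omega) (c * (znorm2 p - m * 1)) <=
         \int[mu]_(p in Omega) (peak k p ^+ 2 * znorm2 p - m * peak k p ^+ 2).
  apply: le_Rintegral => //; first exact: RintegrableZ.
    by apply: RintegrableB => //; exact: RintegrableZ.
  move=> p Op; rewrite peak_sq -subr_ge0 /c.
  set E := expR (k%:R * znorm2 p) ^+ 2.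
  have -> : (mass k)^-1 * E * znorm2 p - m * ((mass k)^-1 * E) - (mass k)^-1 * e * (znorm2 p - m * 1) =
     (mass k)^-1 * ((E - e) * (znorm2 p - m)) by ring.
  apply: mulr_ge0; first by rewrite invr_ge0 ltW// mass_gt0.
  have [zm|zm] := lerP m (znorm2 p).
    by rewrite mulr_ge0// subr_ge0// ler_sqr ?nnegrE ?expR_ge0// ler_expR ler_wpM2l.
  rewrite mulr_le0 ?subr_le0 ?(ltW zm)// ler_sqr ?nnegrE ?expR_ge0// ler_expR ler_wpM2l//.
  exact: ltW.
move: K; rewrite RintegralZl// RintegralB//; last exact: RintegrableZ.
rewrite RintegralZl// V1 RintegralB//; last exact: RintegrableZ.
rewrite RintegralZl// integral_peak_sq mulr1 => K.
rewrite -subr_ge0; apply: le_trans K.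
apply: mulr_ge0 => //; rewrite subr_ge0; apply: le_trans zA.
by rewrite /m divfK// gt_eqF.
Qed.

(** The peaks concentrate where |z| = 1, so that their L^1 norms tend to 0. With t
    the value of the peak at |z|^2 = 1 - d, and A a set of small volume containing
    the points of the ball where |z|^2 > 1 - d, one has
    peak <= t + l 1_A + peak^2 / l. *)
Lemma peak_L1_small (e : R) : 0 < e -> exists N : nat, forall k, (N <= k)%N ->
  \int[mu]_(p in Omega) peak k p <= e.
Proof.
move=> e0; pose l := 3 / e.
have l0 : 0 < l by rewrite divr_gt0.
have [|d /andP[d0 d1] [A [mA Az [v ve Av]]]] := @thin_box (e / 3 / l); first by rewrite !divr_gt0.
have [iA IA] := Rintegral_indic_ball mA Av.
have [|v' v'0 Hm] := @mass_ge (d / 2); first by apply/andP; split; lra.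
pose V : R := fine (mu Omega).
have V0 : 0 <= V by rewrite fine_ge0.
have i1 : integrable_on ((fun=> (1 : R)) : X -> R) by apply: smooth_integrable_on; exact: smooth_cst.
have V1 : \int[mu]_(p in Omega) (1 : R) = V by rewrite Rintegral_cst// mul1r.
pose C := 2 * V / (d * Num.sqrt v').
have sv : 0 < Num.sqrt v' by rewrite sqrtr_gt0.
(* For such k, [2 / (k%:R * d * Num.sqrt v') * V <= e / 3]. *)
exists (Num.truncn (C * (3 / e))).+1 => k kN.
have k0 : 0 < k%:R :> R by rewrite ltr0n (leq_trans _ kN).
have Hm0 := Hm k.
pose t := (Num.sqrt (mass k))^-1 * expR (k%:R * (1 - d)).
have sP : smooth (fun p : X => peak k p ^+ 2) by apply: smoothX; exact: smooth_peak.
have iP := smooth_integrable_on sP.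
have -> : e = e / 3 + e / 3 + e / 3 by field.
have tV : t * V <= e / 3.
  (* [mass_ge] with d/2 gives t <= exp(- k d / 2) / sqrt v'. *)
  have tb : t <= 2 / (k%:R * d * Num.sqrt v').
    set M := mass k in t Hm0 *.
    rewrite ler_pdivlMr; last by rewrite !mulr_gt0.
    have sM : 0 < Num.sqrt M by rewrite sqrtr_gt0 mass_gt0.
    have Es : expR (k%:R * (1 - d / 2)) * Num.sqrt v' <= Num.sqrt M.
      by rewrite -[X in X * _](ger0_norm (expR_ge0 _)) -sqrtr_sqr -sqrtrM ?sqr_ge0// ler_wsqrtr.
    have E1 := expR_ge1Dx (k%:R * d / 2).
    have E2 : expR (k%:R * (1 - d)) * expR (k%:R * d / 2) = expR (k%:R * (1 - d / 2)).
      by rewrite -expRD; congr expR; field.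
    have E0 := expR_ge0 (k%:R * (1 - d)).
    rewrite /t; set E := expR (k%:R * (1 - d)) in E0 E2 *.
    rewrite [X in X <= _](_ : _ = (Num.sqrt M)^-1 * (E * (k%:R * d * Num.sqrt v'))); last by rewrite [RHS]mulrA.
    rewrite ler_pdivrMl//; move: Es; rewrite -E2 => Es.
    have E3 : E * (1 + k%:R * d / 2) * Num.sqrt v' <= Num.sqrt M.
      by apply: le_trans Es; rewrite ler_wpM2r ?(ltW sv)// ler_wpM2l.
    have : 0 <= E * Num.sqrt v' by rewrite mulr_ge0 ?(ltW sv).
    by lra.
  apply: le_trans (ler_wpM2r V0 tb) _.
  have : C * (3 / e) <= k%:R.
    by apply: (le_trans (ltW (truncnS_gt _))); rewrite ler_nat.
  rewrite mulrA ler_pdivrMr// => h.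
  rewrite (_ : 2 / (k%:R * d * Num.sqrt v') * V = C / k%:R); last first.
    by rewrite /C; field; rewrite !gt_eqF.
  by rewrite ler_pdivrMr//; lra.
apply: (@le_trans _ _ (\int[mu]_(p in Omega) (t * 1 + l * \1_A p + l^-1 * peak k p ^+ 2))).
  apply: le_Rintegral => //.
  - by apply: smooth_integrable_on; exact: smooth_peak.
  - by apply: RintegrableD => //; [apply: RintegrableD => //|]; exact: RintegrableZ.
  - move=> p Op; have pk := peak_ge0 k p.
    have t0 : 0 <= t by rewrite mulr_ge0 ?expR_ge0// invr_ge0 sqrtr_ge0.
    have [zd|zd] := lerP (znorm2 p) (1 - d).
      apply: (@le_trans _ _ t); last first.
        by rewrite mulr1 -addrA lerDl addr_ge0// mulr_ge0 ?invr_ge0 ?sqr_ge0// ltW.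
      by rewrite ler_wpM2l ?invr_ge0 ?sqrtr_ge0// ler_expR ler_wpM2l.
    rewrite indicE mem_set ?mulr1; last exact: Az.
    have [pl|pl] := lerP (peak k p) l.
      by rewrite (le_trans pl)// -addrA addrCA lerDl addr_ge0// mulr_ge0 ?invr_ge0 ?sqr_ge0// ltW.
    apply: (@le_trans _ _ (l^-1 * peak k p ^+ 2)); last by rewrite lerDr addr_ge0// ltW.
    by rewrite ler_pdivlMl// expr2 ler_wpM2r// ltW.
rewrite RintegralD//; last 2 first.
  by apply: RintegrableD => //; exact: RintegrableZ.
  exact: RintegrableZ.
rewrite RintegralD//; last 2 first.
  exact: RintegrableZ.
  exact: RintegrableZ.
rewrite !RintegralZl// V1 integral_peak_sq mulr1; apply: lerD; first apply: lerD => //.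
  rewrite -ler_pdivlMl// mulrC; apply: (le_trans IA); exact: ve.
by rewrite /l invf_div.
Qed.

End concentration.

(** * Packets *)

Section modulus.
Context {R : realType}.
Notation C := (R[i]).
Local Notation Re := complex.Re.
Local Notation Im := complex.Im.
Implicit Types a b : C.

Lemma normc_ge0 a : 0 <= Normc.normc a.
Proof. by case: a => x y; exact: sqrtr_ge0. Qed.

Lemma sqr_normc_cdot a : Normc.normc a ^+ 2 = cdot a a.
Proof. by case: a => x y; rewrite /cdot /= sqr_sqrtr ?addr_ge0 ?sqr_ge0// -!expr2. Qed.

Lemma normc_conj a : Normc.normc (conjc a) = Normc.normc a.
Proof. by case: a => x y; rewrite /= sqrrN. Qed.

Lemma cdot_normc_le a b : `|cdot a b| <= Normc.normc a * Normc.normc b.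
Proof.
rewrite -ler_sqr ?nnegrE ?mulr_ge0 ?normc_ge0// exprMn !sqr_normc_cdot real_normK ?num_real//.
case: a b => [x y] [u v]; rewrite /cdot /= -subr_ge0.
have -> : (x * x + y * y) * (u * u + v * v) - (x * u + y * v) ^+ 2 = (x * v - y * u) ^+ 2 by ring.
exact: sqr_ge0.
Qed.

Lemma normc_sum (I : Type) (s : seq I) (P : pred I) (F : I -> C) :
  Normc.normc (\sum_(i <- s | P i) F i) <= \sum_(i <- s | P i) Normc.normc (F i).
Proof.
elim/big_ind2 : _ => [|x a y b xa yb|//]; first by rewrite Normc.normc0.
by apply: le_trans (le_normcD _ _) _; exact: lerD.
Qed.

End modulus.

Section packets.
Context {R : realType} {n : nat}.
Notation X := (heis R n).
Notation MX := (measurableTypeR R * ('rV[R]_n * 'rV[R]_n))%type.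
Notation C := (R[i]).
Notation mu := (heis_vol R n).
Local Notation Omega := (@heis_ball R n).
Notation integrable_on f := (mu.-integrable (Omega : set MX) (EFin \o f)).
Local Notation normc := Normc.normc.

Let mO : measurable (Omega : set MX) := @measurable_heis_ball R n.

(** The form h dzbar^A, with the single coefficient h. *)
Definition monoform (A : {set 'I_n}) (h : X -> C) : heis_form R n :=
  fun K p => if K == A then h p else 0.

Lemma monoform_formL2 A (h : X -> C) : L2fun h -> formL2 (monoform A h).
Proof. by move=> lh K; rewrite /monoform; case: eqP => _; [exact: lh|exact: L2fun0]. Qed.

Lemma normc_wedge_sign a (J : {set 'I_n}) : normc (wedge_sign a J : C) = 1.
Proof.
have := normc_ge0 (wedge_sign a J : C).
have : normc (wedge_sign a J : C) ^+ 2 = 1.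
  by rewrite expr2 -Normc.normcM wedge_sign_sq Normc.normc1.
by move=> /eqP; rewrite sqrf_eq1 => /orP[/eqP//|/eqP->]; rewrite oppr_ge0 ler10.
Qed.

Lemma normc_zcoord_le1 (p : X) a : Omega p -> normc (zcoord p a) <= 1.
Proof.
move=> Op; rewrite -(@ler_sqr _ _ 1) ?nnegrE ?normc_ge0// expr1n sqr_normc_cdot.
by apply: le_trans (znorm2_le1 Op); rewrite /cdot /= -!expr2; exact: znorm2_ge_coord.
Qed.

Lemma normc_contract_monoform A h J (p : X) : Omega p ->
  normc (contract (monoform A h) J p) <= n%:R * normc (h p).
Proof.
move=> Op; apply: le_trans (normc_sum _ _ _) _.
apply: (@le_trans _ _ (\sum_(a < n) normc (h p))); last by rewrite sumr_const card_ord mulr_natl.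
rewrite big_mkcond; apply: ler_sum => a _; case: ifP => _; last exact: normc_ge0.
rewrite !Normc.normcM normc_wedge_sign normc_conj mul1r /monoform.
case: eqP => _; last by rewrite Normc.normc0 mulr0 normc_ge0.
by rewrite ler_piMl ?normc_ge0 ?normc_zcoord_le1.
Qed.

(* All forms have #|{set 'I_n}| coefficients, sums of at most n terms for
   contractions. *)
Let M : R := #|{set 'I_n}|%:R * n%:R ^+ 2.

Lemma fdot_contract_le A h A' h' (p : X) : Omega p ->
  `|fdot (contract (monoform A h)) (contract (monoform A' h')) p| <=
  M * (normc (h p) * normc (h' p)).
Proof.
move=> Op; apply: le_trans (ler_norm_sum _ _ _) _.
apply: (@le_trans _ _ (\sum_(J : {set 'I_n}) n%:R ^+ 2 * (normc (h p) * normc (h' p)))).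
  apply: ler_sum => J _; apply: le_trans (cdot_normc_le _ _) _.
  by rewrite expr2 mulrACA ler_pM ?normc_ge0 ?normc_contract_monoform.
by rewrite sumr_const -[leLHS]mulr_natl mulrA.
Qed.

(** The coefficient at A :\ a alone gives this bound. *)
Lemma fdot_contract_ge (A : {set 'I_n}) h a (p : X) : a \in A ->
  normc (zcoord p a) ^+ 2 * normc (h p) ^+ 2 <=
  fdot (contract (monoform A h)) (contract (monoform A h)) p.
Proof.
move=> aA; set w := zcoord p a; rewrite /fdot (bigD1 (A :\ a)) //=.
rewrite -[X in X <= _]addr0; apply: lerD; last first.
  by apply: sumr_ge0 => J _; rewrite -sqr_normc_cdot sqr_ge0.
rewrite -sqr_normc_cdot /contract (bigD1 a) ?inE ?eqxx// big1.
  by set T := wedge_sign a _ * _; rewrite /= addr0 /T !Normc.normcM normc_wedge_sign normc_conj mul1r /monoform finset.setD1K// eqxx exprMn; exact: lexx.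
move=> b /andP[bA ba]; rewrite /monoform ifF ?mulr0//.
apply/negbTE/eqP => /setP/(_ a); rewrite !inE eqxx /= orbF aA => /eqP ab.
by rewrite ab eqxx in ba.
Qed.

(** The functions exp(- i k w), normalised in L^2. *)
Definition cr_peak (k : nat) (p : X) : C :=
  Complex (Num.sqrt (@mass R n k))^-1 0 * cr_exp k%:R p.

Lemma normc_cr_peak k p : normc (cr_peak k p) = peak k p.
Proof.
apply/eqP; rewrite -(@eqrXn2 _ 2) ?normc_ge0 ?peak_ge0//; apply/eqP.
rewrite /cr_peak Normc.normcM exprMn [X in _ * X]sqr_normc_cdot cr_exp_sq.
by rewrite sqr_normc_cdot /cdot /= mulr0 addr0 -expr2 -exprMn.
Qed.

Lemma cr_peak_cradial k : cradial (cr_peak k).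
Proof. by apply: cradial_rM (cr_exp_cradial _); exact: radial_cst. Qed.

Lemma Lbar_cr_peak k j p : Lbar j (cr_peak k) p = 0.
Proof. by rewrite LbarZ ?Lbar_cr_exp ?mulr0//; exact: cradial_csmooth (cr_exp_cradial _). Qed.

(** For #|A| = q + 1 this is a (0,q)-form. *)
Definition packet k A : heis_form R n := contract (monoform A (cr_peak k)).

Lemma monoform_cradial A k K : cradial (monoform A (cr_peak k) K).
Proof.
rewrite /monoform; case: eqP => _; first exact: cr_peak_cradial.
by split; exact: radial_cst.
Qed.

Lemma Lbar_monoform A k j K p : Lbar j (monoform A (cr_peak k) K) p = 0.
Proof.
rewrite /monoform; case: eqP => _; first exact: Lbar_cr_peak.
exact: Lbar_cst.
Qed.

Lemma packet_formL2 k A : formL2 (packet k A).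
Proof.
move=> J; apply/csmooth_L2fun/csmooth_contract => K.
exact: cradial_csmooth (monoform_cradial _ _ _).
Qed.

Lemma rinner_packet_le j A k B :
  `|rinner (packet j A) (packet k B)| <= M * \int[mu]_(p in Omega) (peak j p * peak k p).
Proof.
have iP : integrable_on (fun p => peak j p * peak k p).
  by apply: smooth_integrable_on; apply: smoothM; exact: smooth_peak.
have iF := fdot_integrable (packet_formL2 j A) (packet_formL2 k B).
rewrite rinnerE -RintegralZl//; apply: le_trans (le_normr_Rintegral mO iF) _.
apply: le_Rintegral => //.
- exact: integrable_norm.
- exact: RintegrableZ.
- by move=> p Op; rewrite -!normc_cr_peak; exact: fdot_contract_le.
Qed.

Lemma rinner_packet_le1 k A : (0 < n)%N -> rinner (packet k A) (packet k A) <= M.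
Proof.
move=> n0; apply: le_trans (ler_norm _) _; apply: le_trans (rinner_packet_le _ _ _ _) _.
rewrite -[leRHS]mulr1 -(integral_peak_sq n0 k) lexx//.
Qed.

(** Packets are asymptotically orthogonal. *)
Lemma rinner_packet_small j (e : R) : (0 < n)%N -> 0 < e -> exists K : nat,
  forall k A B, (K <= k)%N -> `|rinner (packet j A) (packet k B)| <= e.
Proof.
move=> n0 e0; pose c := (Num.sqrt (@mass R n j))^-1 * expR j%:R.
have c0 : 0 < c by rewrite mulr_gt0 ?expR_gt0// invr_gt0 sqrtr_gt0 mass_gt0.
have M0 : 0 <= M by rewrite mulr_ge0.
have D0 : 0 < (M + 1) * c by rewrite mulr_gt0// ltr_wpDl.
have [K HK] := peak_L1_small n0 (divr_gt0 e0 D0).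
exists K => k A B Kk; apply: le_trans (rinner_packet_le _ _ _ _) _.
have iP : integrable_on (@peak R n k) by apply: smooth_integrable_on; exact: smooth_peak.
have I1 : \int[mu]_(p in Omega) (peak j p * peak k p) <= c * \int[mu]_(p in Omega) peak k p.
  rewrite -RintegralZl//; apply: le_Rintegral => //.
  - by apply: smooth_integrable_on; apply: smoothM; exact: smooth_peak.
  - exact: RintegrableZ.
  - move=> p Op; rewrite ler_wpM2r ?peak_ge0// ler_wpM2l ?invr_ge0 ?sqrtr_ge0//.
    by rewrite ler_expR ler_piMr// znorm2_le1.
apply: (le_trans (ler_wpM2l M0 I1)).
have := HK k Kk; rewrite ler_pdivlMr//.
have : 0 <= c * \int[mu]_(p in Omega) peak k p.
  by rewrite mulr_ge0 ?(ltW c0)// Rintegral_ge0// => p _; exact: peak_ge0.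
by move: (\int[mu]_(p in Omega) peak k p) => x h1 h2; lra.
Qed.

(** By the pigeonhole principle some coordinate carries a fixed share of the
    mass of |z|^2. *)
Lemma rinner_packet_ge : (0 < n)%N -> exists2 c : R, 0 < c & forall k, exists a,
  forall A : {set 'I_n}, a \in A -> c <= rinner (packet k A) (packet k A).
Proof.
move=> n0; have [m m0 Hm] := @peak_znorm2_ge R n n0.
have nR : 0 < n%:R :> R by rewrite ltr0n.
exists (m / n%:R); first by rewrite divr_gt0.
move=> k; pose f a (p : X) := normc (zcoord p a) ^+ 2 * normc (cr_peak k p) ^+ 2.
have sf a : smooth (f a).
  have -> : f a = fun p => (p.2.1 ord0 a ^+ 2 + p.2.2 ord0 a ^+ 2) * peak k p ^+ 2.
    by apply/funext => p; rewrite /f normc_cr_peak sqr_normc_cdot /cdot -!expr2.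
  apply: smoothM; last by apply: smoothX; exact: smooth_peak.
  by apply: smoothD; apply: smoothX; [exact: smooth_x|exact: smooth_y].
have iF a := smooth_integrable_on (sf a).
have [a Ha] : exists a, m / n%:R <= \int[mu]_(p in Omega) f a p.
  apply: contrapT => /forallNP H; have := Hm k; apply/negP; rewrite -ltNge.
  have -> : \int[mu]_(p in Omega) (peak k p ^+ 2 * znorm2 p) = \sum_a \int[mu]_(p in Omega) f a p.
    rewrite -Rintegral_sum_ball//; apply: eq_Rintegral => p _.
    rewrite /znorm2 mulr_sumr; apply: eq_bigr => a _.
    by rewrite /f normc_cr_peak sqr_normc_cdot /cdot -!expr2 mulrC.
  have -> : m = \sum_(a < n) m / n%:R.
    by rewrite sumr_const card_ord -[RHS]mulr_natr divfK// gt_eqF.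
  apply: ltr_sum => [|a _]; first by apply/hasP; exists (Ordinal n0); rewrite ?mem_index_enum.
  by rewrite ltNge; apply/negP; exact: H.
exists a => A aA; apply: (le_trans Ha); rewrite rinnerE; apply: le_Rintegral => //.
  exact: fdot_integrable (packet_formL2 k A) (packet_formL2 k A).
by move=> p Op; exact: fdot_contract_ge.
Qed.

End packets.

(** * Non-compactness of the Neumann operator *)

Section difference.
Context {R : realType} {n : nat}.
Implicit Types f g h : heis_form R n.

(** The difference g - f, written as in the linearity of the Neumann operator. *)
Definition form_sub f g : heis_form R n := fun J p => -1 * f J p + g J p.

Lemma form_sub_formL2 f g : formL2 f -> formL2 g -> formL2 (form_sub f g).
Proof. by move=> lf lg J; apply: L2funD => //; exact: L2funN. Qed.

Lemma rinner_sub f g : formL2 f -> formL2 g ->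
  rinner (form_sub f g) (form_sub f g) = rinner f f - 2 * rinner f g + rinner g g.
Proof.
move=> lf lg.
have lN : formL2 (fun J p => -1 * f J p) by move=> J; exact: L2funN.
have rN h h' : formL2 h -> formL2 h' -> rinner h (fun J p => -1 * h' J p) = - rinner h h'.
  move=> lh lh'; rewrite !rinnerE -[RHS]mulN1r -RintegralZl; last 2 first.
  - exact: measurable_heis_ball.
  - exact: fdot_integrable.
  apply: eq_Rintegral => p _; rewrite /fdot mulr_sumr; apply: eq_bigr => J _.
  by rewrite /cdot ReM ImM /=; ring.
rewrite /form_sub rinnerDr//; last exact: form_sub_formL2.
rewrite rN//; last exact: form_sub_formL2.
rewrite !(rinner_sym (fun J p => _ + _)) !rinnerDr// !rN// (rinner_sym g f).
by move: (rinner f f) (rinner f g) (rinner g g) => x y z; ring.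
Qed.

Lemma rinner_sub_le f g : formL2 f -> formL2 g ->
  rinner (form_sub f g) (form_sub f g) <= 2 * rinner f f + 2 * rinner g g.
Proof.
move=> lf lg; have := rinner_quadratic 1 1 lf lg; rewrite rinner_sub// !expr1n !mul1r => h.
lra.
Qed.

End difference.

Section packets_dbar.
Context {R : realType} {n : nat}.
Notation X := (heis R n).
Notation mu := (heis_vol R n).
Local Notation Omega := (@heis_ball R n).
Local Notation Re := complex.Re.
Local Notation Im := complex.Im.

Lemma form_sub_packet j k (A B : {set 'I_n}) :
  form_sub (packet j A) (packet k B) =
  contract (form_sub (monoform A (@cr_peak R n j)) (monoform B (cr_peak k))).
Proof.
apply/funext => J; apply/funext => p; rewrite /form_sub /packet /contract mulr_sumr -big_split.
apply: eq_bigr => a _; move: (wedge_sign a J) (conjc _) (monoform A _ _ _) (monoform B _ _ _).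
by move=> s z x y /=; ring.
Qed.

Lemma packet_sub_dbar q j k (A B : {set 'I_n}) : #|A| = q.+1 -> #|B| = q.+1 ->
  dbar_graph q (form_sub (packet j A) (packet k B)) (form_sub
    (monoform A (fun p => q.+1%:R * @cr_peak R n j p)) (monoform B (fun p => q.+1%:R * cr_peak k p))).
Proof.
move=> cA cB; rewrite form_sub_packet.
have -> : form_sub (monoform A (fun p => q.+1%:R * @cr_peak R n j p))
    (monoform B (fun p => q.+1%:R * cr_peak k p)) = fun K p => q.+1%:R * form_sub
    (monoform A (@cr_peak R n j)) (monoform B (cr_peak k)) K p.
  apply/funext => K; apply/funext => p; rewrite /form_sub /monoform.
  have E (b : bool) (x : R[i]) : (if b then q.+1%:R * x else 0) = q.+1%:R * (if b then x else 0).
    by case: b; rewrite ?mulr0.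
  by rewrite !E; move: (if _ then _ else _) (if _ then _ else _) => x y; ring.
apply: dbar_graph_contract.
- move=> K; apply: csmoothD; last exact: cradial_csmooth (monoform_cradial _ _ _).
  by apply: csmoothM; [exact: csmooth_cst|exact: cradial_csmooth (monoform_cradial _ _ _)].
- move=> K Kq; apply/funext => p; rewrite /form_sub /monoform !ifF ?mulr0 ?addr0//;
    by apply: contra_neqF Kq => /eqP ->; rewrite ?cA ?cB.
- move=> i K p.
  have s1 := cradial_csmooth (monoform_cradial A j K).
  have s2 := cradial_csmooth (monoform_cradial B k K).
  rewrite LbarD//; last by apply: csmoothM => //; exact: csmooth_cst.
  by rewrite LbarZ// !Lbar_monoform mulr0 addr0.
Qed.

Lemma cradial_form_sub (f g : heis_form R n) : (forall K, cradial (f K)) ->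
  (forall K, cradial (g K)) -> forall K, cradial (form_sub f g K).
Proof.
move=> rf rg K; have [f1 f2] := rf K; have [g1 g2] := rg K; split.
  rewrite (_ : (fun p => _) = fun p => - Re (f K p) + Re (g K p)).
    by apply: radialD => //; exact: radialN.
  by apply/funext => p; rewrite ReD ReM /=; ring.
rewrite (_ : (fun p => _) = fun p => - Im (f K p) + Im (g K p)).
  by apply: radialD => //; exact: radialN.
by apply/funext => p; rewrite ImD ImM /=; ring.
Qed.

Lemma packet_sub_adj q j k (A B : {set 'I_n}) : #|A| = q.+2 -> #|B| = q.+2 ->
  dbar_adj_graph q (form_sub (packet j A) (@packet R n k B)) (fun _ _ => 0).
Proof.
move=> cA cB; rewrite form_sub_packet; apply: dbar_adj_graph_contract.
- by apply: cradial_form_sub => K; exact: monoform_cradial.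
- move=> K Kq; apply/funext => p; rewrite /form_sub /monoform !ifF ?mulr0 ?addr0//;
    by apply: contra_neqF Kq => /eqP ->; rewrite ?cA ?cB.
Qed.

Lemma packet_L2form q k (A : {set 'I_n}) : #|A| = q.+1 -> L2form q (@packet R n k A).
Proof.
move=> cA; apply: contract_L2form => [K|K Kq].
  exact: cradial_csmooth (monoform_cradial _ _ _).
by apply/funext => p; rewrite /monoform ifF//; apply: contra_neqF Kq => /eqP ->.
Qed.

Lemma rinner_monoform c k (A : {set 'I_n}) : (0 < n)%N ->
  let b := monoform A (fun p => c%:R * @cr_peak R n k p) in rinner b b = c%:R ^+ 2.
Proof.
move=> n0 /=; rewrite rinnerE.
transitivity (\int[mu]_(p in Omega) (c%:R ^+ 2 * peak k p ^+ 2 : R)).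
  apply: eq_Rintegral => p _; rewrite /fdot (bigD1 A)//= big1.
    rewrite addr0 /monoform eqxx -sqr_normc_cdot Normc.normcM exprMn normc_cr_peak.
    by rewrite [Normc.normc c%:R]normcMn [Normc.normc 1]Normc.normc1.
  by move=> K KA; rewrite /monoform (negbTE KA) /cdot !mulr0 addr0.
rewrite RintegralZl ?integral_peak_sq ?mulr1//; first exact: measurable_heis_ball.
by apply: smooth_integrable_on; apply: smoothX; exact: smooth_peak.
Qed.

Lemma cr_peak_L2 (c : R[i]) k : L2fun (fun p => c * @cr_peak R n k p).
Proof.
apply: csmooth_L2fun; apply: csmoothM; first exact: csmooth_cst.
exact: cradial_csmooth (cr_peak_cradial _).
Qed.

Lemma rinner_packet_sub_dbar q j k (A B : {set 'I_n}) : (0 < n)%N ->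
  let b := form_sub (monoform A (fun p => q.+1%:R * @cr_peak R n j p))
    (monoform B (fun p => q.+1%:R * cr_peak k p)) in
  rinner b b <= 4 * q.+1%:R ^+ 2.
Proof.
move=> n0 /=; apply: le_trans (rinner_sub_le _ _) _.
- by apply: monoform_formL2; exact: cr_peak_L2.
- by apply: monoform_formL2; exact: cr_peak_L2.
by rewrite !rinner_monoform//; lra.
Qed.

End packets_dbar.

Theorem theorem1 (R : realType) (n q : nat) (hq : (1 <= q)%N)
    (hqn : (q + 2 <= n)%N) (N : heis_form R n -> heis_form R n) :
  neumann_operator q N -> ~ compact_operator q N.
Proof.
case: q hq hqn => // q _ hqn HN cN.
have n0 : (0 < n)%N by apply: leq_trans hqn; rewrite addn2.
have [c c0 Hc] := @rinner_packet_ge R n n0.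
have [A HA] : {A : nat -> {set 'I_n} & forall k, #|A k| = q.+2 /\
    c <= rinner (packet k (A k)) (@packet R n k (A k))}.
  have H k : {A : {set 'I_n} | #|A| = q.+2 /\ c <= rinner (packet k A) (@packet R n k A)}.
    apply: cid; have [a Ha] := Hc k.
    have : (q.+1 <= #|[set~ a]%SET|)%N.
      by rewrite cardsC1 card_ord -ltnS prednK//; apply: leq_trans hqn; rewrite addn2.
    move=> /card_geqP[r [ur sr rs]].
    exists (a |: [set x in r]%SET)%SET; split; last by apply: Ha; rewrite !inE eqxx.
    rewrite cardsU1 cardsE (card_uniqP ur) sr inE.
    by case: (boolP (a \in r)) => // /rs; rewrite !inE eqxx.
  by exists (fun k => proj1_sig (H k)) => k; exact: (proj2_sig (H k)).
pose u k := @packet R n k (A k).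
have uL k : L2form q.+1 (u k) by apply: packet_L2form; exact: (HA k).1.
have uF k := L2form_formL2 (uL k).
have NL k := neumann_L2 HN (uL k).
have NF k := L2form_formL2 (NL k).
(* The square of the bound for |dbar_b (u_k - u_j)|^2. *)
pose D : R := (4 * q.+2%:R ^+ 2) ^+ 2.
have D0 : 0 < D by rewrite exprn_gt0// mulr_gt0// exprn_gt0.
(* The energy estimate for u_k - u_j: almost orthogonal packets have distant
   images. *)
have gap j k : `|rinner (u j) (u k)| <= c / 2 ->
    c ^+ 3 <= D * rinner (form_sub (N (u j)) (N (u k))) (form_sub (N (u j)) (N (u k))).
  move=> jk; set v := form_sub (u j) (u k).
  have vL := form_sub_formL2 (uF j) (uF k).
  have v1 := @packet_sub_dbar R n _ j k _ _ (HA j).1 (HA k).1.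
  have v2 := @packet_sub_adj R n _ j k _ _ (HA j).1 (HA k).1.
have Lv : L2form q.+1 v := let: And3 h _ _ := v1 in h.
  have E := neumann_estimate (ltn0Sn q) HN v1 v2.
  have Nv : form_ae_eq (N v) (form_sub (N (u j)) (N (u k))) := neumann_linear HN (-1) (uL j) (uL k).
  have NvF := L2form_formL2 (neumann_L2 HN Lv).
  have NdF := form_sub_formL2 (NF j) (NF k).
  rewrite (rinner_ae NvF NdF NvF NdF Nv Nv) in E.
  have vc : c <= rinner v v.
    rewrite rinner_sub//; have := (HA j).2; have := (HA k).2; rewrite -/(u j) -/(u k).
    by move: jk; rewrite ler_norml => /andP[_]; lra.
  apply: le_trans (le_trans E _); first by rewrite ler_pXn2r ?nnegrE ?(ltW c0)// rinner_ge0.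
  rewrite ler_wpM2r ?rinner_ge0// ler_pXn2r ?nnegrE ?rinner_ge0 ?mulr_ge0//.
  exact: rinner_packet_sub_dbar.
have [|s sh [g gL cvg]] := cN u uL.
  exists (Num.sqrt (#|{set 'I_n}|%:R * n%:R ^+ 2)) => k; rewrite ler_wsqrtr//.
  exact: rinner_packet_le1.
have gF := L2form_formL2 gL.
pose d := Num.min 1 (c ^+ 3 / (8 * D)).
have d0 : 0 < d by rewrite lt_min ltr01 divr_gt0 ?exprn_gt0 ?mulr_gt0.
have dD : 4 * D * d ^+ 2 < c ^+ 3.
  have d1 : d <= 1 by rewrite ge_min lexx.
  have : d <= c ^+ 3 / (8 * D) by rewrite ge_min lexx orbT.
  rewrite ler_pdivlMr ?mulr_gt0// => d2.
  have c3 : 0 < c ^+ 3 by rewrite exprn_gt0.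
  have : D * (d * d) <= D * d by rewrite ler_pM2l// ler_piMr// ltW.
  by rewrite expr2; lra.
have [i0 _ Hi] := cvgr_lt _ cvg _ d0.
have subE i : form_sub g (N (u (s i))) = fun J p => N (u (s i)) J p - g J p.
  by apply/funext => J; apply/funext => p; rewrite /form_sub mulN1r addrC.
have sge i : (i <= s i)%N by elim: i => // i IH; apply: leq_ltn_trans IH (sh _ _ _).
(* Past i0 the images are within d of their limit; a later index i1 makes the
   packets almost orthogonal. *)
have [K HK] := rinner_packet_small (s i0) n0 (divr_gt0 c0 (ltr0Sn R 1)).
pose i1 := maxn i0 K.
have := gap (s i0) (s i1) (HK _ _ _ (leq_trans (leq_maxr _ _) (sge i1))).
apply/negP; rewrite -ltNge; apply: le_lt_trans dD.
have sq i : (i0 <= i)%N -> rinner (form_sub g (N (u (s i)))) (form_sub g (N (u (s i)))) <= d ^+ 2.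
  move=> ii; have := ltW (Hi _ ii); rewrite /= -subE /L2norm -ler_sqr ?nnegrE ?sqrtr_ge0 ?(ltW d0)//.
  by rewrite sqr_sqrtr//; exact: rinner_ge0.
have -> : form_sub (N (u (s i0))) (N (u (s i1))) =
    form_sub (form_sub g (N (u (s i0)))) (form_sub g (N (u (s i1)))).
  apply/funext => J; apply/funext => p; rewrite /form_sub.
  by move: (g J p) (N _ J p) (N _ J p) => x y z; ring.
have := rinner_sub_le (form_sub_formL2 gF (NF (s i0))) (form_sub_formL2 gF (NF (s i1))).
move=> /(ler_wpM2l (ltW D0))/le_trans; apply.
have := sq i0 (leqnn _); have := sq i1 (leq_maxl _ _).
move: (rinner _ _) (rinner _ _) (d ^+ 2) => x y z; nra.
Qed.
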